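(* Let $g\geq 1$, $n\geq 2$, and let $a=(a_1,\ldots,a_n)$ be nonzero integers with $a_1+\cdots+a_n=0$; put $d=\sum_{i:a_i>0}a_i$ and suppose $d\geq 2$. Let $\mathrm{DR}_{g,a}\subseteq M_{g,n}^{trop}$ be the set of stable marked tropical curves $(\Gamma,p_1,\ldots,p_n)$ for which there exist a tropical modification $\Gamma'$ of $\Gamma$, a tropical curve $\Delta$ of genus $0$ with exactly two legs labelled $0$ and $\infty$, and a finite effective harmonic morphism $\tau:\Gamma'\to\Delta$ such that for every $i$, $\tau$ maps the leg $p_i$ to $0$ with degree $a_i$ if $a_i>0$, and to $\infty$ with degree $-a_i$ if $a_i<0$. Let $\mathrm{PD}_{g,a}\subseteq M_{g,n}^{trop}$ be the set of $(\Gamma,p_1,\ldots,p_n)$ admitting a harmonic function with outgoing slope $-a_i$ along each leg $p_i$. Then $\mathrm{DR}_{g,a}$ is a semilinear subset of $M_{g,n}^{trop}$, contained in $\mathrm{PD}_{g,a}$, of dimension $2g-3+n$.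
   Context: A tropical curve is a connected metric space $\Gamma$ which is the metric realization of a finite connected graph whose edges are closed intervals of positive length and whose legs are half-lines $[0,\infty)$ attached at $0$ (no point at the infinite end), together with a genus function $g:\Gamma\to\mathbb{Z}_{\geq0}$ nonzero at finitely many points; its genus is $b_1(\Gamma)+\sum_x g(x)$. For $x\in\Gamma$, $\mathrm{val}(x)$ is the number of tangent directions at $x$ and $\chi(x)=2-2g(x)-\mathrm{val}(x)$. $\Gamma$ is stable if no point $x$ with $g(x)=0$ has $\mathrm{val}(x)\le1$ and $2g-2+\#\{\text{legs}\}>0$. A tropical modification of $\Gamma$ is a tropical curve obtained by attaching finitely many finite trees (genus zero, finite edges) at points of $\Gamma$; the legs of $\Gamma'$ are those of $\Gamma$. $M_{g,n}^{trop}$ is the moduli space of stable tropical curves of genus $g$ with $n$ labelled legs, a generalized cone complex with one cone $\mathbb{R}_{\geq0}^{E(G)}$ (modulo automorphisms) per combinatorial type $G$ (a stable vertex-weighted graph with $n$ marked legs), coordinates being edge lengths; dimension of a subset is the maximal dimension of its intersections with cones. A subset is semilinear if its preimage in each cone is a finite union of sets defined by finitely many homogeneous $\mathbb{Z}$-linear non-strict inequalities. A morphism $\tau:\Gamma'\to\Gamma''$ of tropical curves is a continuous piecewise-linear map with integer slopes, eventually linear on each leg (a leg mapped eventually to a leg $p$ with slope $a>0$ is said to map to $p$ with degree $a$). It is harmonic if slopes are nonnegative in the sense that for each $x'\in\Gamma'$ the number $d_\tau(x')=\sum_{h'\mapsto h}\mathrm{slope}(h')$ (sum over tangent directions $h'$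 at $x'$ mapping to a tangent direction $h$ at $\tau(x')$) is independent of $h$; finite if no edge or leg segment is contracted (nonzero slope everywhere); effective if $d_\tau(x')\chi(\tau(x'))-\chi(x')\geq 0$ for every $x'\in\Gamma'$. A harmonic function on $\Gamma$ is a continuous piecewise-linear $f:\Gamma\to\mathbb{R}$ with integer slopes, eventually linear on legs, whose outgoing slopes sum to zero at every point. *)

(* Defs.v *)
From mathcomp Require Import all_boot all_order all_algebra.
From mathcomp Require Import Rstruct.
Set Implicit Arguments. Unset Strict Implicit. Unset Printing Implicit Defensive.
Import Order.TTheory GRing.Theory Num.Theory.
Local Open Scope ring_scope.

Notation R := Rdefinitions.R.

(* Finite models of tropical curves.                                  *)
(* A model with L legs: vertices 'I_nv, (finite) edges 'I_ne with two  *)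
(* endpoints (loops and multiple edges allowed), a genus weight on     *)
(* vertices, and L labelled legs (half-lines) attached at vertices.    *)
(* Edge lengths are given separately as functions 'I_ne -> R.          *)
Record graph (L : nat) := Graph {
  nv : nat;
  ne : nat;
  esrc : 'I_ne -> 'I_nv;
  etgt : 'I_ne -> 'I_nv;
  gw : 'I_nv -> nat;
  legv : 'I_L -> 'I_nv }.

(* flags = tangent directions at vertices: edge ends (e,false) = source
   end, (e,true) = target end; and legs *)
Definition flag L (G : graph L) : finType := (('I_(ne G) * bool) + 'I_L)%type.

Definition fl_vert L (G : graph L) (h : flag G) : 'I_(nv G) :=
  match h with
  | inl (e, b) => if b then etgt e else esrc e
  | inr i => legv G i
  end.

(* valence (loops count twice) and Euler characteristic chi = 2-2g-val *)
Definition val L (G : graph L) (v : 'I_(nv G)) : nat :=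
  #|[pred h : flag G | fl_vert h == v]|.
Definition chi L (G : graph L) (v : 'I_(nv G)) : int :=
  2 - 2 * (gw v)%:Z - (val v)%:Z.

Definition adj L (G : graph L) : rel 'I_(nv G) := fun u w =>
  [exists e : 'I_(ne G),
     ((esrc e == u) && (etgt e == w)) || ((esrc e == w) && (etgt e == u))].

Definition connected L (G : graph L) : Prop :=
  (0 < nv G)%N /\ forall u w, connect (@adj L G) u w.

(* genus = b_1 + sum of vertex genera (for a connected model) *)
Definition genus L (G : graph L) : int :=
  (ne G)%:Z - (nv G)%:Z + 1 + \sum_(v : 'I_(nv G)) (gw v)%:Z.

Definition stable_type (g n : nat) (G : graph n) : Prop :=
  connected G /\ genus G = g%:Z /\ forall v : 'I_(nv G), (3 <= 2 * gw v + val v)%N.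

(* Edge contraction: the point of the cone R_{>=0}^{E(G)} with lengths *)
(* l is the tropical curve with model H (positive lengths lam) obtained *)
(* by contracting the edges of length 0.                              *)
Definition zadj L (G : graph L) (l : 'I_(ne G) -> R) : rel 'I_(nv G) :=
  fun u w => [exists e : 'I_(ne G), (l e == 0) &&
     (((esrc e == u) && (etgt e == w)) || ((esrc e == w) && (etgt e == u)))].

Definition Contract n (G : graph n) (l : 'I_(ne G) -> R)
    (H : graph n) (lam : 'I_(ne H) -> R) : Prop :=
  exists (phi : 'I_(nv G) -> 'I_(nv H)) (psi : 'I_(ne H) -> 'I_(ne G)),
    (((forall w, exists v, phi v = w)) /\
   (injective psi) /\
   ((forall e, l e <> 0 <-> exists f, psi f = e)) /\
   ((forall f, lam f = l (psi f))) /\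
   ((forall f, esrc f = phi (esrc (psi f)) /\ etgt f = phi (etgt (psi f)))) /\
   ((forall i, legv H i = phi (legv G i))) /\
   ((forall u w, phi u = phi w <-> connect (zadj l) u w)) /\ (
        (* genus of a contracted vertex: sum of genera + b_1 of the fibre *)
        (forall w, (gw w + #|[pred v | phi v == w]| =
                    \sum_(v | phi v == w) gw v
                    + #|[pred e | (l e == 0%R) && (phi (esrc e) == w)]| + 1)%N))).

(* Points of the metric realisation of (G,l), l > 0:                  *)
(*  GV v = vertex v; GE e t = point at distance t in (0,l e) from the  *)
(*  source of e; GL i t = point at distance t > 0 on leg i.           *)
Inductive gpoint n (G : graph n) : Type :=
  | GV of 'I_(nv G)
  | GE of 'I_(ne G) & R
  | GL of 'I_n & R.

(* location of an edge of a refined model: the segment [a,b] of edge e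
   (LE e a b), or of leg i (LL i a b) *)
Inductive eloc n (G : graph n) : Type :=
  | LE of 'I_(ne G) & R & R
  | LL of 'I_n & R & R.

Definition valid_point n (G : graph n) (l : 'I_(ne G) -> R) (p : gpoint G) :=
  match p with
  | GV _ => True
  | GE e t => 0 < t < l e
  | GL _ t => 0 < t
  end.

Definition ptE n (G : graph n) (l : 'I_(ne G) -> R) (e : 'I_(ne G)) (t : R)
  : gpoint G :=
  if t == 0 then @GV _ G (esrc e) else if t == l e then @GV _ G (etgt e) else @GE _ G e t.

Definition ptL n (G : graph n) (i : 'I_n) (t : R) : gpoint G :=
  if t == 0 then @GV _ G (legv G i) else @GL _ G i t.

Definition onE n (G : graph n) (e : 'I_(ne G)) (x : option (eloc G)) : bool :=
  if x is Some (LE e0 _ _) then e0 == e else false.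
Definition onL n (G : graph n) (i : 'I_n) (x : option (eloc G)) : bool :=
  if x is Some (LL i0 _ _) then i0 == i else false.

(* ModifGen trees G l G' l' : (G',l') is a model of a tropical curve
   obtained from the curve (G,l) (l > 0) by subdividing edges and legs and,
   if trees = true, attaching finitely many finite genus-0 trees at points.
   pos u = Some p : vertex u of G' lies on the point p of the original
   curve ("core" vertex); pos u = None : u is a vertex of an attached tree.
   loc e' = Some _ : e' is a segment of an edge/leg of the original curve;
   loc e' = None : e' is an edge of an attached tree.
   The core edges on edge e tile [0, l e]; those on leg i tile [0, c i] and
   the leg i of G' starts at distance c i on leg i.  The attached part
   consists of trees attached at single points: G' is connected and has
   the same first Betti number as its core. *)
Definition ModifGen (trees : bool) n (G : graph n) (l : 'I_(ne G) -> R)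
    (G' : graph n) (l' : 'I_(ne G') -> R) : Prop :=
  exists (pos : 'I_(nv G') -> option (gpoint G))
         (loc : 'I_(ne G') -> option (eloc G)) (c : 'I_n -> R),
  (((forall e', 0 < l' e')) /\
   ((forall u p, pos u = Some p -> valid_point l p)) /\
   ((forall u w p, pos u = Some p -> pos w = Some p -> u = w)) /\
   ((forall v, exists u, pos u = Some (@GV _ G v))) /\
   ((forall u, gw u = match pos u with Some (GV v) => gw v | _ => 0%N end)) /\
   ((forall e' e a b, loc e' = Some (LE e a b) ->
         ((0 <= a) /\
   (a < b) /\
   (b <= l e) /\
   (l' e' = b - a) /\ (
             (pos (esrc e') = Some (ptE l e a) /\ pos (etgt e') = Some (ptE l e b))
          \/ (pos (esrc e') = Some (ptE l e b) /\ pos (etgt e') = Some (ptE l e a)))))) /\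
   ((forall e' i a b, loc e' = Some (@LL _ G i a b) ->
         ((0 <= a) /\
   (a < b) /\
   (b <= c i) /\
   (l' e' = b - a) /\ (
             (pos (esrc e') = Some (ptL G i a) /\ pos (etgt e') = Some (ptL G i b))
          \/ (pos (esrc e') = Some (ptL G i b) /\ pos (etgt e') = Some (ptL G i a)))))) /\
   ((forall e e1 e2 a1 b1 a2 b2, e1 <> e2 ->
         loc e1 = Some (LE e a1 b1) -> loc e2 = Some (LE e a2 b2) ->
         b1 <= a2 \/ b2 <= a1)) /\ (
  (((forall i e1 e2 a1 b1 a2 b2, e1 <> e2 ->
         loc e1 = Some (@LL _ G i a1 b1) -> loc e2 = Some (@LL _ G i a2 b2) ->
         b1 <= a2 \/ b2 <= a1)) /\
   ((forall e, \sum_(e' | onE e (loc e')) l' e' = l e)) /\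
   ((forall i, 0 <= c i /\ \sum_(e' | onL i (loc e')) l' e' = c i)) /\
   ((forall u e t, pos u = Some (@GE _ G e t) ->
         exists e' a b, loc e' = Some (LE e a b) /\ (a = t \/ b = t))) /\
   ((forall u i t, pos u = Some (@GL _ G i t) ->
         exists e' a b, loc e' = Some (@LL _ G i a b) /\ (a = t \/ b = t))) /\
   ((forall i, pos (legv G' i) = Some (ptL G i (c i)))) /\
   (connected G') /\
   ((ne G' + #|[pred u | isSome (pos u)]| =
         nv G' + #|[pred e | isSome (loc e)]|)%N) /\ (
      (trees || [forall u, isSome (pos u)]))))).

Definition TropModif := ModifGen true.
Definition Subdiv := ModifGen false.

(* Finite harmonic morphisms, given on models in which vertices map to *)
(* vertices, edges map linearly onto edges with slope s e >= 1, and    *)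
(* legs map linearly onto legs with slope sl i >= 1.                   *)
Definition tflag n (G' : graph n) (D : graph 2)
  (te : 'I_(ne G') -> 'I_(ne D)) (fl : 'I_(ne G') -> bool) (tl : 'I_n -> 'I_2)
  (h : flag G') : flag D :=
  match h with
  | inl (e, b) => inl (te e, b (+) fl e)
  | inr i => inr (tl i)
  end.

Definition fslope n (G' : graph n) (s : 'I_(ne G') -> nat) (sl : 'I_n -> nat)
  (h : flag G') : nat :=
  match h with inl (e, _) => s e | inr i => sl i end.

(* a finite effective harmonic morphism tau : (G',l') -> (D,dl) mapping
   leg p_i to leg 0 (= ord0) with degree a_i if a_i > 0 and to leg
   infinity (= 1) with degree -a_i if a_i < 0 *)
Definition DR_morphism n (a : 'I_n -> int) (G' : graph n) (l' : 'I_(ne G') -> R)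
    (D : graph 2) (dl : 'I_(ne D) -> R) : Prop :=
  exists (tv : 'I_(nv G') -> 'I_(nv D)) (te : 'I_(ne G') -> 'I_(ne D))
         (fl : 'I_(ne G') -> bool) (s : 'I_(ne G') -> nat)
         (tl : 'I_n -> 'I_2) (sl : 'I_n -> nat),
  (((forall e, 0 < s e)%N) /\
   ((forall i, 0 < sl i)%N) /\
   ((forall e, tv (esrc e) = (if fl e then etgt (te e) else esrc (te e)) /\
                 tv (etgt e) = (if fl e then esrc (te e) else etgt (te e)))) /\
   ((forall e, dl (te e) = (s e)%:R * l' e)) /\
   ((forall i, tv (legv G' i) = legv D (tl i))) /\
   (
      (forall v, exists dv : nat,
          (forall h : flag D, fl_vert h == tv v ->
             (\sum_(h' : flag G' | (fl_vert h' == v) && (tflag te fl tl h' == h))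
                 fslope s sl h')%N = dv)
          /\ 0 <= dv%:Z * chi (tv v) - chi v)) /\ (
      (forall i, (0 < a i -> tl i = ord0 /\ (sl i)%:Z = a i) /\
                 (a i < 0 -> tl i = 1 /\ (sl i)%:Z = - a i)))).

Definition genus0_two_legs (D : graph 2) (dl : 'I_(ne D) -> R) : Prop :=
  ((connected D) /\
   ((ne D + 1 = nv D)%N) /\
   ((forall v : 'I_(nv D), gw v = 0%N)) /\ (
      (forall e, 0 < dl e))).

(* the double ramification locus, on curves given by a model with positive
   lengths *)
Definition DR n (a : 'I_n -> int) (H : graph n) (lam : 'I_(ne H) -> R) : Prop :=
  exists (G' : graph n) (l' : 'I_(ne G') -> R) (D : graph 2) (dl : 'I_(ne D) -> R),
    ((TropModif lam l') /\
   (genus0_two_legs dl) /\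
   (DR_morphism a l' dl)).

Definition PD n (a : 'I_n -> int) (H : graph n) (lam : 'I_(ne H) -> R) : Prop :=
  exists (G'' : graph n) (l'' : 'I_(ne G'') -> R),
    Subdiv lam l'' /\
    exists (f : 'I_(nv G'') -> R) (m : 'I_(ne G'') -> int),
      (forall e, f (etgt e) - f (esrc e) = (m e)%:~R * l'' e) /\
      (forall v, \sum_(e | esrc e == v) m e - \sum_(e | etgt e == v) m e
                 - \sum_(i | legv G'' i == v) a i = 0).

(* Subsets of M_{g,n}^trop, described by their preimages in the cones  *)
(* R_{>=0}^{E(G)}, G a stable type.                                    *)
Definition trop_set n := forall G : graph n, ('I_(ne G) -> R) -> Prop.

Definition cone_preimage n (X : forall H : graph n, ('I_(ne H) -> R) -> Prop)
  : trop_set n :=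
  fun G l => (forall e, 0 <= l e) /\
             exists (H : graph n) (lam : 'I_(ne H) -> R), Contract l lam /\ X H lam.

Definition DR_set n (a : 'I_n -> int) : trop_set n := cone_preimage (DR a).
Definition PD_set n (a : 'I_n -> int) : trop_set n := cone_preimage (PD a).

(* finite union of sets cut out by finitely many homogeneous Z-linear
   non-strict inequalities (each piece padded to p inequalities) *)
Definition semilinear m (S : ('I_m -> R) -> Prop) : Prop :=
  exists (k p : nat) (A : 'I_k -> 'I_p -> 'I_m -> int),
    forall x, S x <-> exists j, forall q, 0 <= \sum_i (A j q i)%:~R * x i.

Definition has_ball m (S : ('I_m -> R) -> Prop) (k : nat) : Prop :=
  exists (x0 : 'I_m -> R) (v : 'I_k -> 'I_m -> R),
    (forall c : 'I_k -> R, (forall i, \sum_j c j * v j i = 0) -> forall j, c j = 0)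
    /\ exists r : R, 0 < r /\
       forall y : 'I_k -> R, (forall j, `|y j| < r) ->
         S (fun i => x0 i + \sum_j y j * v j i).

Definition Mtrop_semilinear g n (X : trop_set n) : Prop :=
  forall G : graph n, stable_type g G -> semilinear (X G).

Definition Mtrop_subset g n (X Y : trop_set n) : Prop :=
  forall G : graph n, stable_type g G -> forall l, X G l -> Y G l.

Definition Mtrop_dim g n (X : trop_set n) (d : nat) : Prop :=
  (exists G : graph n, stable_type g G /\ has_ball (X G) d) /\
  (forall G : graph n, stable_type g G -> forall k, has_ball (X G) k -> (k <= d)%N).

(* Main.v *)
Require Import Defs.
From mathcomp Require Import all_boot all_order all_algebra.
From mathcomp Require Import boolp Rstruct zify ring lra.
Import Order.TTheory GRing.Theory Num.Theory.
Set Implicit Arguments. Unset Strict Implicit. Unset Printing Implicit Defensive.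
Local Open Scope ring_scope.

(* Fix a stable type G. A cover of a curve in the cone of G writes the edge
   lengths of the curve as M x, where x > 0 are the edge lengths of the target
   tree and M is a nonnegative matrix; the degree bounds the entries of d! M, so
   only finitely many M occur. Contracting edges of the target turns the cover
   into a cover for M y, for every y >= 0, because Euler characteristics add up
   under contraction and effectivity is therefore preserved. Hence DR is a finite
   union of cones M(R_{>=0}^k), and these are semilinear by Fourier-Motzkin.

   If M has a kernel, moving x along it until a coordinate vanishes gives a
   smaller target (Caratheodory), so the columns of M may be assumed independent.
   By Riemann-Hurwitz the total ramification is at most r = 2g - 2 + n; independence
   forces ram(w) + val(w) - 2 >= 1 at every vertex w of the target, and these
   numbers sum to at most r, so the target has at most r - 1 edges.

   The bound is attained by a caterpillar with g double edges mapping to a path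
   with r vertices: positive legs are merged one by one, g cycles are opened and
   closed, and negative legs are split off one by one.

   Composing a cover with the retraction of the target onto the line joining its
   legs gives a harmonic function; it is constant on the attached trees, so it
   restricts to the original curve, whence DR is contained in PD. *)

(** * Linear systems and incidence matrices *)

(** The trees of a modification are never built or traversed: its definition supplies only
    connectedness and one count of vertices against edges. Both are read through an incidence
    matrix. Connectedness makes it injective on functions vanishing at a chosen set of grounded
    vertices, and the count makes it square. Hence prescribed differences can be integrated and
    conserved flows vanish, which replaces every induction on leaves; injectivity alone still bounds
    vertices by edges.

    The delicate point is that a contracted cover is again a cover of a modification: no genus may
    appear outside the vertices of the contracted curve, and the count must hold again. Grounding
    gives inequalities, at each vertex and in total, and comparing total genera turns them into
    equalities.

    The assumption [d >= 2] enters in the lower bound: the two strands of a double edge need slope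
    at least one each. Effectivity is cheap there, since every vertex of a path with a leg at each
    end has [chi = 0]. *)

Section LinearSystems.
Variables (F : fieldType) (P Q : finType) (f : Q -> P -> F).
Hypothesis f_inj :
  forall x : P -> F, (forall q, \sum_p f q p * x p = 0) -> forall p, x p = 0.

Let A : 'M[F]_(#|P|, #|Q|) := \matrix_(i, j) f (enum_val j) (enum_val i).

Lemma linsys_mulE (x : 'rV[F]_#|P|) j :
  (x *m A) 0 j = \sum_p f (enum_val j) p * x 0 (enum_rank p).
Proof.
rewrite mxE (reindex (@enum_rank P)) /=; last exact: onW_bij (enum_rank_bij P).
by apply: eq_bigr => p _; rewrite mxE enum_rankK mulrC.
Qed.

Lemma linsys_row_free : row_free A.
Proof.
apply/row_freeP; apply/row_freeP/inj_row_free => x xA0.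
apply/rowP => i; rewrite mxE.
have := f_inj (x := fun p => x 0 (enum_rank p)).
move/(_ _ (enum_val i)); rewrite enum_valK; apply=> q.
by rewrite -(enum_rankK q) -linsys_mulE xA0 mxE.
Qed.

Lemma linsys_inj_card : (#|P| <= #|Q|)%N.
Proof. by have /eqP <- := linsys_row_free; apply: rank_leq_col. Qed.

Hypothesis cardPQ : #|P| = #|Q|.

Lemma linsys_row_full : row_full A.
Proof. by rewrite /row_full; have /eqP -> := linsys_row_free; rewrite cardPQ. Qed.

Lemma linsys_surj (b : Q -> F) : exists x : P -> F, forall q, \sum_p f q p * x p = b q.
Proof.
have [B BA] := row_fullP linsys_row_full.
pose x := (\row_j b (enum_val j)) *m B.
exists (fun p => x 0 (enum_rank p)) => q.
by rewrite -(enum_rankK q) -linsys_mulE -mulmxA BA mulmx1 mxE.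
Qed.

(** Pair [z] with a solution of the system whose right-hand side is the indicator of [q]. *)
Lemma linsys_tr_inj (z : Q -> F) :
  (forall p, \sum_q z q * f q p = 0) -> forall q, z q = 0.
Proof.
move=> zf q; have [x xP] := linsys_surj (fun q' => (q' == q)%:R).
have <- : \sum_q' z q' * \sum_p f q' p * x p = z q.
  rewrite (bigD1 q) //= xP eqxx mulr1 big1 ?addr0 // => q' ne.
  by rewrite xP (negbTE ne) mulr0.
under eq_bigr do rewrite mulr_sumr.
rewrite exchange_big big1 //= => p _.
by under eq_bigr do rewrite mulrA; rewrite -mulr_suml zf mul0r.
Qed.

End LinearSystems.

Section Incidence.
Variables (F : fieldType) (V E : finType) (src tgt : E -> V) (A : {pred V}) (S : {pred E}).

Definition incidence (e : {e | e \in S}) (v : {v | v \in A}) : F :=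
  (tgt (\val e) == \val v)%:R - (src (\val e) == \val v)%:R.

Definition extend0 (x : {v | v \in A} -> F) (v : V) : F :=
  if insub v is Some u then x u else 0.

Lemma sum_extend0 (x : {v | v \in A} -> F) v :
  \sum_(u : {v | v \in A}) (v == \val u)%:R * x u = extend0 x v.
Proof.
rewrite /extend0; case: insubP => [u Au vu|nA].
  rewrite (bigD1 u) //= vu eqxx mul1r big1 ?addr0 // => u' ne.
  by rewrite -vu (inj_eq val_inj) eq_sym (negbTE ne) mul0r.
rewrite big1 // => u _; case: eqP => [vu|]; last by rewrite mul0r.
by move: (valP u) nA; rewrite vu => ->.
Qed.

Lemma incidenceE e x :
  \sum_v incidence e v * x v = extend0 x (tgt (\val e)) - extend0 x (src (\val e)).
Proof.
by rewrite -!sum_extend0 -sumrB; apply: eq_bigr => v _; rewrite mulrBl.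
Qed.

Hypothesis pot_inj : forall phi : V -> F,
  (forall v, v \notin A -> phi v = 0) ->
  (forall e, e \in S -> phi (src e) = phi (tgt e)) -> forall v, phi v = 0.

Lemma incidence_inj (x : {v | v \in A} -> F) :
  (forall e, \sum_v incidence e v * x v = 0) -> forall v, x v = 0.
Proof.
move=> x0 v; have <- : extend0 x (\val v) = x v by rewrite /extend0 valK.
apply: pot_inj (\val v).
  by move=> u nA; rewrite /extend0 insubN.
by move=> e Se; have /eqP := x0 (Sub e Se); rewrite incidenceE subr_eq0 => /eqP ->.
Qed.

(** Vertices outside [A] are grounded. Lower bounds on cycle ranks enter the development in this
    form: if grounded potentials vanish, there are at least as many edges as free vertices. *)
Lemma potential_inj_card : (#|A| <= #|S|)%N.
Proof. by have := linsys_inj_card incidence_inj; rewrite !card_sig. Qed.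

Hypothesis cardAS : #|A| = #|S|.

Let cardAS' : #|{: {v | v \in A}}| = #|{: {e | e \in S}}|.
Proof. by rewrite !card_sig. Qed.

Lemma potential_exists (b : E -> F) : exists phi : V -> F,
  (forall v, v \notin A -> phi v = 0) /\
  (forall e, e \in S -> phi (tgt e) - phi (src e) = b e).
Proof.
have [x xP] := linsys_surj incidence_inj cardAS' (fun e => b (\val e)).
exists (extend0 x); split=> [v nA|e Se]; first by rewrite /extend0 insubN.
by have := xP (Sub e Se); rewrite incidenceE.
Qed.

(** The transpose of [potential_exists]: a square injective incidence matrix leaves no room for a
    conserved flow. *)
Lemma flow_inj (z : E -> F) :
  (forall v, v \in A -> \sum_(e in S | (tgt e == v)) z e =
                    \sum_(e in S | (src e == v)) z e) ->
  forall e, e \in S -> z e = 0.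
Proof.
move=> zdiv e Se.
have := @linsys_tr_inj _ _ _ _ incidence_inj cardAS' (fun e => z (\val e)).
move=> /(_ _ (Sub e Se)); apply=> -[v Av].
have aux (h : E -> V) :
    \sum_(e : {e | e \in S}) z (\val e) * (h (\val e) == v)%:R =
    \sum_(e in S | (h e == v)) z e.
  rewrite big_mkcondr (big_sub S); apply: eq_bigr => i _.
  by case: eqP; rewrite ?mulr1 ?mulr0.
under eq_bigr do rewrite /incidence /= mulrBr.
by rewrite sumrB !aux zdiv // subrr.
Qed.

End Incidence.

(** * Tilings of an interval *)

Section Packing.
Variables (F : realFieldType) (I : finType) (a b : I -> F).

Definition packed (P : pred I) :=
  (forall p, P p -> a p < b p) /\
  (forall p q, P p -> P q -> p <> q -> b p <= a q \/ b q <= a p).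

Lemma packed_before P p q : packed P -> P p -> P q -> p <> q -> b p <= b q -> b p <= a q.
Proof.
move=> [ab dj] Pp Pq pq le; case: (dj _ _ Pp Pq pq) => // h.
by have := ab _ Pp; lra.
Qed.

(** The interval [p] ending last leaves all the others below its left end, so the induction on their
    number continues with the bound [a p]. *)
Lemma packed_mass_below P (t : F) : packed P -> 0 <= t -> (forall p, P p -> 0 <= a p) ->
  \sum_(p | P p && (b p <= t)) (b p - a p) <= t.
Proof.
move=> pk; have [N] := ubnP #|[pred p | P p && (b p <= t)]|.
elim: N t => // N IH t ltN t0 a0.
case: (pickP [pred p | P p && (b p <= t)]) => [p0 Pp0|none]; last first.
  by rewrite big_pred0.
pose p := [arg max_(p > p0 | P p && (b p <= t)) b p]%O.
have [Pp bpt pmax] : [/\ P p, b p <= t & forall q, P q -> b q <= t -> b q <= b p].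
  rewrite /p; case: arg_maxP => // q /andP[Pq bq] qm; split=> // q' Pq' bq'.
  by apply: qm; rewrite Pq'.
have eqp : [pred q | P q && (b q <= a p)] =1 [pred q | (P q && (b q <= t)) && (q != p)].
  move=> q /=; case Pq: (P q) => //=; apply/idP/andP.
    move=> h; have := pk.1 _ Pp => h2; split; first lra.
    by apply/eqP => qp; move: h h2; rewrite qp; lra.
  case=> h /eqP qp; exact: (packed_before pk) (pmax _ Pq h).
rewrite (bigD1 p) /= ?Pp // -(eq_bigl _ _ eqp).
have := IH (a p) _ (a0 _ Pp) a0.
have ltc : (#|[pred q | P q && (b q <= a p)%R]| < N)%N.
  rewrite (eq_card eqp) -ltnS; apply: leq_trans ltN.
  rewrite ltnS [X in (_ < X)%N](cardD1 p) inE /= Pp bpt /= add1n ltnS.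
  by apply: subset_leq_card; apply/subsetP => q; rewrite !inE /= andbC.
by move/(_ ltc); lra.
Qed.

End Packing.

Definition tiling (F : realFieldType) (I : finType) (a b : I -> F) (P : pred I) (L : F) : Prop :=
  [/\ packed a b P, forall p, P p -> 0 <= a p, forall p, P p -> b p <= L &
      \sum_(p | P p) (b p - a p) = L].

Section Tiling.
Variables (F : realFieldType) (I : finType) (P : pred I) (L : F).

(** Reflection yields the statements on previous and last tiles from those on next and first
    ones. *)
Lemma tiling_rev (a b : I -> F) : tiling a b P L ->
  tiling (fun p => L - b p) (fun p => L - a p) P L.
Proof.
move=> [[ab dj] a0 bL tot]; split; first split.
- by move=> p /ab; lra.
- by move=> p q Pp Pq /(dj _ _ Pp Pq); lra.
- by move=> p /bL; lra.
- by move=> p /a0; lra.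
- by rewrite -[RHS]tot; apply: eq_bigr => p _; lra.
Qed.

(** If [t] were uncovered, the tiles to its right would all start beyond some [t' > t]; the masses
    below [t] and above [t'] would then add up to less than [L]. *)
Lemma tiling_cover (a b : I -> F) t : tiling a b P L -> 0 <= t -> t < L ->
  exists2 p, P p & a p <= t < b p.
Proof.
move=> tl t0 tL; have [pk a_ge0 b_leL total] := tl.
case: (pickP [pred p | P p && (a p <= t < b p)]) => [p /andP[]|none]; first by exists p.
exfalso.
have nc p : P p -> (b p <= t) = ~~ (t < a p).
  move=> Pp; have /= := none p; rewrite Pp /= => /negbT; rewrite negb_and -leNgt -ltNge.
  by have := pk.1 _ Pp => h /orP[h2|h2]; apply/idP/idP; lra.
have [t' [t't t'L h]] : exists t', [/\ t < t', t' <= L & forall p, P p -> t < a p -> t' <= a p].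
  case: (pickP [pred p | P p && (t < a p)]) => [p0 Pp0|no].
    pose p := [arg min_(p < p0 | P p && (t < a p)) a p]%O.
    exists (a p); rewrite /p; case: arg_minP => // q /andP[Pq tq] qm; split=> //.
      by have := b_leL _ Pq; have := pk.1 _ Pq; lra.
    by move=> q' Pq' tq'; apply: qm; rewrite Pq'.
  by exists L; split=> // p Pp tp; have := no p; rewrite /= Pp tp.
have lo := packed_mass_below pk t0 a_ge0.
have [pk' a0' _ _] := tiling_rev tl; have t'0 : 0 <= L - t' by lra.
have hi := packed_mass_below pk' t'0 a0'.
suff : L <= t + (L - t') by lra.
rewrite -[X in X <= _]total (bigID (fun p => b p <= t)) /= lerD //.
apply: le_trans hi; rewrite le_eqVlt; apply/orP; left; apply/eqP.
apply: eq_big => [p|p _]; last by lra.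
case Pp: (P p) => //=; rewrite nc // negbK.
by apply/idP/idP => [/(h _ Pp)|]; lra.
Qed.

Lemma tiling_next (a b : I -> F) p : tiling a b P L -> P p -> b p < L -> exists2 q, P q & a q = b p.
Proof.
move=> tl Pp bL; have [pk a_ge0 _ _] := tl.
have bp0 : 0 <= b p by have := a_ge0 _ Pp; have := pk.1 _ Pp; lra.
have [q Pq /andP[aq bq]] := tiling_cover tl bp0 bL.
exists q => //; have pq : p <> q by move=> pq; move: bq; rewrite pq; lra.
by have := packed_before pk Pp Pq pq; lra.
Qed.

Lemma tiling_first (a b : I -> F) : tiling a b P L -> 0 < L -> exists2 q, P q & a q = 0.
Proof.
move=> tl L0; have [q Pq /andP[aq bq]] := tiling_cover tl (lexx 0) L0.
by have [_ a_ge0 _ _] := tl; exists q => //; have := a_ge0 _ Pq; lra.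
Qed.

Lemma tiling_prev (a b : I -> F) p : tiling a b P L -> P p -> 0 < a p -> exists2 q, P q & b q = a p.
Proof.
move=> tl Pp ap; have [|q Pq eq] := tiling_next (tiling_rev tl) Pp; first by lra.
by exists q => //; lra.
Qed.

Lemma tiling_last (a b : I -> F) : tiling a b P L -> 0 < L -> exists2 q, P q & b q = L.
Proof.
move=> tl L0; have [q Pq eq] := tiling_first (tiling_rev tl) L0.
by exists q => //; lra.
Qed.

End Tiling.

(** * Connectivity tested by functions constant along edges *)

Section Adjacency.
Variables (L : nat) (G : graph L).

Definition cadj (Z : pred 'I_(ne G)) : rel 'I_(nv G) := fun u w =>
  [exists e : 'I_(ne G), Z e &&
     (((esrc e == u) && (etgt e == w)) || ((esrc e == w) && (etgt e == u)))].

Lemma cadj_sym Z : symmetric (cadj Z).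
Proof. by move=> u w; apply: eq_existsb => e; rewrite orbC. Qed.

Lemma connect_cadj_sym Z : connect_sym (cadj Z).
Proof. exact/sym_connect_sym/cadj_sym. Qed.

(** Paths are unfolded here once; later arguments only name a function constant along edges. The
    codomain is arbitrary, since it will be a field, a set of points, or even [Prop]. *)
Lemma connect_cadj_const (X : Type) (Z : pred 'I_(ne G)) (f : 'I_(nv G) -> X) :
  (forall e, Z e -> f (esrc e) = f (etgt e)) ->
  forall u w, connect (cadj Z) u w -> f u = f w.
Proof.
move=> fc u w /connectP[p]; elim: p u => [|v p IH] u /=; first by move=> _ ->.
move=> /andP[/existsP[e /andP[Ze He]] pth] lst; rewrite -(IH _ pth lst).
by case/orP: He => /andP[/eqP <- /eqP <-]; rewrite fc.
Qed.

Lemma cadj_edge (Z : pred 'I_(ne G)) e : Z e -> connect (cadj Z) (esrc e) (etgt e).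
Proof. by move=> Ze; apply: connect1; apply/existsP; exists e; rewrite Ze !eqxx. Qed.

Lemma connect_adjE u w : connect (@adj L G) u w = connect (cadj predT) u w.
Proof. exact: eq_connect. Qed.

Lemma connected_const (X : Type) (f : 'I_(nv G) -> X) : connected G ->
  (forall e, f (esrc e) = f (etgt e)) -> forall u w, f u = f w.
Proof.
move=> [_ cG] fc u w; exact: (@connect_cadj_const X predT).
Qed.

(** Boolean test functions suffice: one of them is the indicator of the component of [u]. *)
Lemma connected_const_test :
  (0 < nv G)%N ->
  (forall f : 'I_(nv G) -> bool, (forall e, f (esrc e) = f (etgt e)) -> forall u w, f u = f w) ->
  connected G.
Proof.
move=> nv0 h; split=> // u w; rewrite connect_adjE.
have := h (connect (cadj predT) u) _ u w; rewrite connect0 => <- // e.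
exact/(same_connect_r (connect_cadj_sym predT))/cadj_edge.
Qed.

Lemma cadj_const_connect (Z : pred 'I_(ne G)) u w :
  (forall f : 'I_(nv G) -> bool, (forall e, Z e -> f (esrc e) = f (etgt e)) -> f u = f w) ->
  connect (cadj Z) u w.
Proof.
move=> h; have := h (connect (cadj Z) u); rewrite connect0 => <- // e Ze.
exact/(same_connect_r (connect_cadj_sym Z))/cadj_edge.
Qed.

(** A vertex without edge ends would be a component by itself, hence the whole graph, and would then
    carry the leg [i]. *)
Lemma vertex_has_flag (i : 'I_L) v : connected G -> exists h : flag G, fl_vert h = v.
Proof.
move=> cG; case: (pickP (fun h : flag G => fl_vert h == v)) => [h /eqP|none]; first by exists h.
have := connected_const (f := fun w => w == v) cG.
have edge e b : (fl_vert (inl (e, b) : flag G) == v) = false by exact: none.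
move=> /(_ _ v (legv G i)); rewrite eqxx => H.
have /esym/eqP iv : true = (legv G i == v); last by exists (inr i).
by apply: H => e; rewrite (edge e false) (edge e true).
Qed.

End Adjacency.

(** * Edge contraction *)

(** The edge set [Z] is arbitrary, rather than the zero set of given lengths, because the source and
    the target of a cover are contracted as well. *)
Record contraction L (G H : graph L) (Z : pred 'I_(ne G))
    (phi : 'I_(nv G) -> 'I_(nv H)) (psi : 'I_(ne H) -> 'I_(ne G)) : Prop := {
  ct_surj : forall w, exists v, phi v = w;
  ct_inj : injective psi;
  ct_im : forall e, ~~ Z e <-> exists f, psi f = e;
  ct_src : forall f, esrc f = phi (esrc (psi f));
  ct_tgt : forall f, etgt f = phi (etgt (psi f));
  ct_leg : forall i, legv H i = phi (legv G i);
  ct_fib : forall u w, phi u = phi w <-> connect (cadj Z) u w;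
  ct_gw : forall w, (gw w + #|[pred v | phi v == w]| =
            \sum_(v | phi v == w) gw v + #|[pred e | Z e && (phi (esrc e) == w)]| + 1)%N }.

Lemma ContractP n (G : graph n) (l : 'I_(ne G) -> R) (H : graph n) (lam : 'I_(ne H) -> R) :
  Contract l lam <-> exists phi psi,
    @contraction n G H (fun e => l e == 0) phi psi /\ forall f, lam f = l (psi f).
Proof.
split=> [[phi [psi [h1 [h2 [h3 [h4 [h5 [h6 [h7 h8]]]]]]]]]|[phi [psi [[h1 h2 h3 s t h6 h7 h8] h4]]]].
  exists phi, psi; split=> //; split=> //.
  - by move=> e; rewrite -h3; split => /eqP.
  - by move=> f; case: (h5 f).
  - by move=> f; case: (h5 f).
exists phi, psi; split=> //; split=> //; split.
  by move=> e; rewrite -h3; split => /eqP.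
by do !split=> //; move/h7.
Qed.

(** Ground [v0]: a potential constant along the edges of a connected fibre then vanishes on it. This
    says that the first Betti number of the fibre is nonnegative. *)
Lemma connected_fiber_card L (G : graph L) (Z : pred 'I_(ne G)) (B : pred 'I_(nv G)) v0 :
  B v0 -> (forall v, B v -> connect (cadj Z) v0 v) ->
  (forall e, Z e -> B (esrc e) = B (etgt e)) ->
  (#|B| <= #|[pred e | Z e && B (esrc e)]| + 1)%N.
Proof.
move=> B0 Bc Be; rewrite (cardD1 v0) unfold_in B0 addnC leq_add2r.
apply: (@potential_inj_card rat _ _ (@esrc _ G) (@etgt _ G)) => f f0 fc v.
case: (boolP (v \in [predD1 B & v0])) => [|/f0 //]; rewrite !inE => /andP[_ Bv].
rewrite -(connect_cadj_const (Z := Z) (f := f) _ (Bc _ Bv)).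
  by apply: f0; rewrite !inE eqxx.
move=> e Ze; case Bs: (B (esrc e)); first by apply: fc; rewrite !inE Ze.
by rewrite !f0 // !inE unfold_in -?Be // Bs andbF.
Qed.

Section ContractionExists.
Variables (L : nat) (G : graph L) (Z : pred 'I_(ne G)).

Let r := cadj Z.
Let rt v := fingraph.root r v.
Let rt_in v : rt v \in [pred v | fingraph.roots r v].
Proof. by rewrite inE; apply: roots_root; exact: connect_cadj_sym. Qed.
Let phi v : 'I_#|[pred v | fingraph.roots r v]| := enum_rank_in (rt_in v) (rt v).
Let psi : 'I_#|[pred e | ~~ Z e]| -> 'I_(ne G) := fun f => enum_val f.

Let phiK v : enum_val (phi v) = rt v.
Proof. exact: enum_rankK_in. Qed.

Let phi_eq u w : (phi u == phi w) = connect r u w.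
Proof. by rewrite -(inj_eq enum_val_inj) !phiK root_connect //; exact: connect_cadj_sym. Qed.

(** Total genus of the fibre plus its first Betti number; fibres are connected, so the truncated
    subtraction is exact. *)
Let gwH w : nat :=
  (\sum_(v | phi v == w) gw v + #|[pred e | Z e && (phi (esrc e) == w)]| + 1
    - #|[pred v | phi v == w]|)%N.

Let H : graph L := {| nv := #|[pred v | fingraph.roots r v]|; ne := #|[pred e | ~~ Z e]|;
  esrc f := phi (esrc (psi f)); etgt f := phi (etgt (psi f));
  gw := gwH; legv i := phi (legv G i) |}.

Lemma contraction_exists : exists H phi psi, @contraction L G H Z phi psi.
Proof.
exists H, phi, psi.
have surj w : exists v, phi v = w.
  exists (enum_val w); apply: enum_val_inj; rewrite phiK.
  by have := enum_valP w; rewrite inE => /eqP.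
split=> //.
- exact: enum_val_inj.
- move=> e; split=> [nZ|[f <-]]; last by have := enum_valP f; rewrite inE.
  by have nZ' : e \in [pred e | ~~ Z e] by []; exists (enum_rank_in nZ' e); exact: enum_rankK_in.
- by move=> u w; rewrite -[connect _ _ _]phi_eq; split=> /eqP.
- move=> w /=; rewrite /gwH subnK //.
  have [v0 v0w] := surj w.
  apply: (@leq_trans (#|[pred e | Z e && (phi (esrc e) == w)]| + 1)%N); last first.
    by rewrite -addnA leq_addl.
  apply: (connected_fiber_card (v0 := v0)) => /= [|v /eqP vw|e Ze].
  + by rewrite v0w.
  + by rewrite -/r -phi_eq v0w vw.
  + congr (_ == _); apply/eqP; rewrite phi_eq; exact: cadj_edge.
Qed.

End ContractionExists.

Lemma Posz_sum (I : Type) (r : seq I) (P : pred I) (F : I -> nat) :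
  (\sum_(i <- r | P i) F i)%N%:Z = \sum_(i <- r | P i) (F i)%:Z.
Proof. exact: (big_morph Posz PoszD erefl). Qed.

Lemma card_Posz (T : finType) (P : pred T) : #|[pred x | P x]|%:Z = \sum_(x | P x) 1.
Proof. by rewrite -sum1_card Posz_sum; apply: eq_bigl => x; rewrite inE. Qed.

Section ContractionTheory.
Variables (L : nat) (G H : graph L) (Z : pred 'I_(ne G)).
Variables (phi : 'I_(nv G) -> 'I_(nv H)) (psi : 'I_(ne H) -> 'I_(ne G)).
Hypothesis ct : contraction Z phi psi.

Lemma ct_edge e : Z e -> phi (esrc e) = phi (etgt e).
Proof. by move=> Ze; apply/(ct_fib ct)/cadj_edge. Qed.

Lemma ct_psiZ f : ~~ Z (psi f).
Proof. by apply/(ct_im ct); exists f. Qed.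

Definition lift_flag (h : flag H) : flag G :=
  match h with inl (f, b) => inl (psi f, b) | inr i => inr i end.

Lemma fl_vert_lift h : fl_vert h = phi (fl_vert (lift_flag h)).
Proof.
case: h => [[f []]|i] /=; [exact: ct_tgt ct _|exact: ct_src ct _|exact: ct_leg ct _].
Qed.

Lemma lift_flag_inj : injective lift_flag.
Proof. by move=> [[f b]|i] [[f' b']|i'] //= [] => [/(ct_inj ct) -> ->|->]. Qed.

Lemma sum_edges_split (V : nmodType) (F : 'I_(ne G) -> V) (Q : pred 'I_(ne G)) :
  \sum_(e | Q e) F e = \sum_(f | Q (psi f)) F (psi f) + \sum_(e | Z e && Q e) F e.
Proof.
rewrite (bigID Z) /= addrC; congr (_ + _); last by apply: eq_bigl => e; rewrite andbC.
pose g e := [pick f | psi f == e].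
rewrite (reindex_omap psi g) /=; last first.
  move=> e /andP[_ /(ct_im ct)[f fe]]; rewrite /g; case: pickP => [f' /= /eqP -> //|/(_ f)].
  by rewrite fe eqxx.
apply: eq_bigl => f; rewrite ct_psiZ andbT; case: (Q _) => //=.
rewrite /g; case: pickP => [f' /eqP /(ct_inj ct) -> |/(_ f)]; first by rewrite eqxx.
by rewrite eqxx.
Qed.

Lemma sum_flags_G (L0 : nat) (G0 : graph L0) (V : nmodType) (F : flag G0 -> V) (Q : pred (flag G0)) :
  \sum_(h | Q h) F h =
  \sum_(e | Q (inl (e, false))) F (inl (e, false)) +
  \sum_(e | Q (inl (e, true))) F (inl (e, true)) + \sum_(i | Q (inr i)) F (inr i).
Proof.
rewrite big_sumType /=; congr (_ + _).
pose FQ e b := if Q (inl (e, b)) then F (inl (e, b)) else 0.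
transitivity (\sum_(p : 'I_(ne G0) * bool) FQ p.1 p.2).
  by rewrite big_mkcond; apply: eq_bigr => -[].
rewrite -(pair_bigA _ FQ) /= [in RHS]big_mkcond [X in _ = _ + X]big_mkcond -big_split /=.
by apply: eq_bigr => e _; rewrite big_bool addrC.
Qed.

Lemma sum_flags_fiber (V : nmodType) (F : flag G -> V) (Q : pred (flag G)) w :
  \sum_(h : flag G | (phi (fl_vert h) == w) && Q h) F h =
  \sum_(h : flag H | (fl_vert h == w) && Q (lift_flag h)) F (lift_flag h) +
  (\sum_(e | Z e && ((phi (esrc e) == w) && Q (inl (e, false)))) F (inl (e, false)) +
   \sum_(e | Z e && ((phi (esrc e) == w) && Q (inl (e, true)))) F (inl (e, true))).
Proof.
rewrite !sum_flags_G /=.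
rewrite (sum_edges_split _ (fun e => (phi (esrc e) == w) && _)).
rewrite (sum_edges_split _ (fun e => (phi (etgt e) == w) && _)).
have -> : \sum_(e | Z e && ((phi (etgt e) == w) && Q (inl (e, true)))) F (inl (e, true)) =
   \sum_(e | Z e && ((phi (esrc e) == w) && Q (inl (e, true)))) F (inl (e, true)).
  by apply: eq_bigl => e; case Ze: (Z e) => //=; rewrite ct_edge.
under [in RHS]eq_bigl do rewrite (ct_src ct).
under [X in _ = _ + X + _ + _]eq_bigl do rewrite (ct_tgt ct).
under [X in _ = _ + X + _]eq_bigl do rewrite (ct_leg ct).
by rewrite [in LHS]addrACA [LHS]addrAC.
Qed.

Lemma val_sum (L0 : nat) (G0 : graph L0) (v : 'I_(nv G0)) :
  (Defs.val v)%:Z = \sum_(h : flag G0 | fl_vert h == v) 1.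
Proof. by rewrite /Defs.val -sum1_card -natz natr_sum; apply: eq_bigl => h; rewrite inE. Qed.

(** A contracted edge adds 2 to the valences in its fibre and a fibre vertex contributes 2 to the
    sum; [ct_gw] moves exactly this difference into the genus of [w]. *)
Lemma ct_chi w : chi w = \sum_(v | phi v == w) chi v.
Proof.
rewrite /chi !sumrB -mulr_sumr.
have -> : \sum_(v | phi v == w) (Defs.val v)%:Z =
   \sum_(h : flag G | (phi (fl_vert h) == w) && true) 1.
  rewrite (partition_big (fun h : flag G => fl_vert h) (fun v => phi v == w)) /=; last first.
    by move=> h; rewrite andbT.
  apply: eq_bigr => v /eqP vw; rewrite val_sum; apply: eq_bigl => h.
  by rewrite andbT; case: eqP => [->|]; rewrite ?vw ?eqxx ?andbF.
rewrite (sum_flags_fiber (fun=> 1) xpredT) /=.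
have -> : \sum_(h : flag H | (fl_vert h == w) && true) 1 = (Defs.val w)%:Z.
  by rewrite val_sum; apply: eq_bigl => h; rewrite andbT.
have := congr1 (fun x : nat => x%:Z) (ct_gw ct w).
rewrite !PoszD Posz_sum !card_Posz.
under [\sum_(e | Z e && ((phi (esrc e) == w) && true)) 1]eq_bigl do rewrite andbT.
have -> : \sum_(v | phi v == w) 2 = 2 * \sum_(v | phi v == w) 1 :> int.
  by rewrite mulr_sumr; apply: eq_bigr => v _; rewrite mulr1.
set A1 := \sum_(i | _) (gw i)%:Z; set A2 := \sum_(x | Z x && _) _; set A3 := \sum_(v | phi v == w) _; move=> hh; lia.
Qed.

Lemma ct_sum_fibers (V : nmodType) (F : 'I_(nv G) -> V) :
  \sum_w \sum_(v | phi v == w) F v = \sum_v F v.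
Proof. by rewrite [RHS](partition_big phi xpredT). Qed.

Lemma ct_ne : (ne H + #|[pred e | Z e]| = ne G)%N.
Proof.
have card1 m : (\sum_(i < m) 1 = m)%N by rewrite sum1_card card_ord.
have := sum_edges_split (fun=> 1%N) xpredT; rewrite /= !card1 => h; apply: etrans (esym h).
by congr addn; rewrite -sum1_card; apply: eq_bigl => e; rewrite inE andbT.
Qed.

Lemma ct_genus :
  (\sum_(w : 'I_(nv H)) gw w + nv G = \sum_(v : 'I_(nv G)) gw v + #|[pred e | Z e]| + nv H)%N.
Proof.
have : (\sum_w (gw w + #|[pred v | phi v == w]|) = \sum_w
    (\sum_(v | phi v == w) gw v + #|[pred e | Z e && (phi (esrc e) == w)]| + 1))%N.
  by apply: eq_bigr => w _; exact: ct_gw ct w.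
rewrite !big_split /= sum_nat_const card_ord muln1.
have -> : \sum_(w < nv H) \sum_(v | phi v == w) gw v = (\sum_(v : 'I_(nv G)) gw v)%N.
  exact: ct_sum_fibers.
have -> : (\sum_(w < nv H) #|[pred v | phi v == w]| = nv G)%N.
  under eq_bigr do rewrite -sum1_card.
  by rewrite ct_sum_fibers sum1_card card_ord.
suff -> : (\sum_(w < nv H) #|[pred e | Z e & phi (esrc e) == w]| = #|[pred e | Z e]|)%N by [].
rewrite -[RHS]sum1_card (partition_big (fun e => phi (esrc e)) xpredT) //=.
by apply: eq_bigr => w _; rewrite -sum1_card; apply: eq_bigl => e; rewrite inE.
Qed.

Lemma ct_connected : connected G -> connected H.
Proof.
move=> cG; apply: connected_const_test.
  by have [+ _] := cG; case: (nv G) phi => // m p _; case: (nv H) (p ord0) => // -[].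
move=> f fc u w; have [u' <-] := ct_surj ct u; have [w' <-] := ct_surj ct w.
apply: (connected_const (f := f \o phi) cG) => e /=.
case Ze: (Z e); first by rewrite ct_edge.
have [f' <-] := (ct_im ct e).1 (negbT Ze).
by rewrite -(ct_src ct) -(ct_tgt ct).
Qed.

End ContractionTheory.

Lemma card_sum1 (T : finType) (P : pred T) : #|[pred x | P x]| = (\sum_(x | P x) 1)%N.
Proof. by rewrite -sum1_card; apply: eq_bigl => x; rewrite inE. Qed.

Section ContractionComp.
Variables (L : nat) (G H K : graph L).
Variables (Z1 : pred 'I_(ne G)) (phi1 : 'I_(nv G) -> 'I_(nv H)) (psi1 : 'I_(ne H) -> 'I_(ne G)).
Variables (Z2 : pred 'I_(ne H)) (phi2 : 'I_(nv H) -> 'I_(nv K)) (psi2 : 'I_(ne K) -> 'I_(ne H)).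
Hypothesis ct1 : contraction Z1 phi1 psi1.
Hypothesis ct2 : contraction Z2 phi2 psi2.
Variable Z : pred 'I_(ne G).
Hypothesis Z_sub : forall e, Z1 e -> Z e.
Hypothesis Z_psi : forall f, Z (psi1 f) = Z2 f.

Lemma ct_comp : contraction Z (phi2 \o phi1) (psi1 \o psi2).
Proof.
split.
- by move=> w; have [u <-] := ct_surj ct2 w; have [v <-] := ct_surj ct1 u; exists v.
- exact: inj_comp (ct_inj ct1) (ct_inj ct2).
- move=> e; split=> [nZ|[f <-]] /=; last by rewrite Z_psi; exact: ct_psiZ ct2 f.
  have [f fe] : exists f, psi1 f = e by apply/(ct_im ct1); apply: contra nZ => /Z_sub.
  have [k kf] : exists k, psi2 k = f by apply/(ct_im ct2); rewrite -Z_psi fe.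
  by exists k; rewrite /= kf.
- by move=> f; rewrite (ct_src ct2) (ct_src ct1).
- by move=> f; rewrite (ct_tgt ct2) (ct_tgt ct1).
- by move=> i; rewrite (ct_leg ct2) (ct_leg ct1).
- move=> u w /=; split=> [/(ct_fib ct2) c2|].
    apply: cadj_const_connect => f fc.
    have f1 x y : phi1 x = phi1 y -> f x = f y.
      by move/(ct_fib ct1); apply: connect_cadj_const => e /Z_sub; exact: fc.
    (* A test function constant along [Z] is constant on the fibres of [phi1]; a section of [phi1]
       carries it to [H], where connectivity along [Z2] is known. *)
    have [s sP] := fin_all_exists (ct_surj ct1).
    have fs x : f (s (phi1 x)) = f x by apply: f1.
    rewrite -(fs u) -(fs w).
    apply: (connect_cadj_const (f := f \o s) _ c2) => e Z2e /=.
    by rewrite (ct_src ct1) (ct_tgt ct1) !fs; apply: fc; rewrite Z_psi.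
  apply: (connect_cadj_const (f := phi2 \o phi1)) => e Ze /=; case Z1e: (Z1 e); first by rewrite (ct_edge ct1).
  have [f fe] := (ct_im ct1 e).1 (negbT Z1e); rewrite -fe -(ct_src ct1) -(ct_tgt ct1).
  by apply: (ct_edge ct2); rewrite -Z_psi fe.
- move=> w /=.
  have pb (T : finType) (p : T -> 'I_(nv H)) (F : T -> nat) (Q : pred T) :
    (\sum_(x | Q x && (phi2 (p x) == w)) F x =
     \sum_(u | phi2 u == w) \sum_(x | Q x && (p x == u)) F x)%N.
    rewrite (partition_big p (fun u => phi2 u == w)) => [|x /andP[] //].
    apply: eq_bigr => u /eqP uw; apply: eq_bigl => x.
    by case: (Q x) => //=; case: (p x =P u) => [->|]; rewrite ?uw ?eqxx ?andbF.
  have := ct_gw ct2 w.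
  have : (\sum_(u | phi2 u == w) (gw u + #|[pred v | phi1 v == u]|) =
     \sum_(u | phi2 u == w) (\sum_(v | phi1 v == u) gw v +
       #|[pred e | Z1 e && (phi1 (esrc e) == u)]| + 1))%N.
    by apply: eq_bigr => u _; exact: ct_gw ct1 u.
  rewrite !big_split /= !card_sum1.
  have -> : (\sum_(e | Z e && (phi2 (phi1 (esrc e)) == w)) 1 =
     \sum_(f | Z2 f && (phi2 (esrc f) == w)) 1 +
     \sum_(u | phi2 u == w) \sum_(e | Z1 e && (phi1 (esrc e) == u)) 1)%N.
    rewrite -(pb _ (fun e => phi1 (esrc e))).
    rewrite (sum_edges_split ct1 (fun=> 1%N) (fun e => Z e && _)); congr (_ + _)%N.
      by apply: eq_bigl => f; rewrite Z_psi (ct_src ct1).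
    by apply: eq_bigl => e; case Z1e: (Z1 e); rewrite //= Z_sub.
  have -> := pb _ phi1 (fun=> 1%N) xpredT; have -> := pb _ phi1 (@gw _ G) xpredT.
  rewrite /= (eq_bigr _ (fun u _ => card_sum1 (fun v => phi1 v == u))).
  rewrite (eq_bigr _ (fun u _ => card_sum1 (fun e => Z1 e && (phi1 (esrc e) == u)))).
  have arith (a b c d e f x : nat) : (a + b = c + d + e -> x + e = a + f + 1 ->
    x + b = c + (f + d) + 1)%N by lia.
  exact: arith.
Qed.

End ContractionComp.

Section StableContraction.
Variables (n g : nat) (G H : graph n) (Z : pred 'I_(ne G)).
Variables (phi : 'I_(nv G) -> 'I_(nv H)) (psi : 'I_(ne H) -> 'I_(ne G)).
Hypothesis ct : contraction Z phi psi.
Hypothesis stG : stable_type g G.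

Lemma sum_chi (L : nat) (K : graph L) :
  \sum_(v : 'I_(nv K)) chi v =
  (nv K)%:Z *+ 2 - (\sum_(v : 'I_(nv K)) (gw v)%:Z) *+ 2 - (ne K)%:Z *+ 2 - L%:Z.
Proof.
rewrite /chi !sumrB -mulr_sumr sumr_const card_ord.
have -> : \sum_(v : 'I_(nv K)) (Defs.val v)%:Z = \sum_(h : flag K) 1.
  rewrite (partition_big (fun h : flag K => fl_vert h) xpredT) //=.
  by apply: eq_bigr => v _; rewrite val_sum.
rewrite sumr_const card_sum card_prod card_bool !card_ord.
set s := \sum_v _; lia.
Qed.

Lemma stable_sum_chi : \sum_(v : 'I_(nv H)) chi v = 2 - g%:Z *+ 2 - n%:Z.
Proof.
transitivity (\sum_(v : 'I_(nv G)) chi v).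
  by under eq_bigr do rewrite (ct_chi ct); rewrite (ct_sum_fibers phi).
rewrite sum_chi; have [_ [+ _]] := stG; rewrite /genus.
set s := \sum_v _; lia.
Qed.

(** Stability at a vertex means [chi <= -1], and [chi] adds up over a nonempty fibre. *)
Lemma stable_contracted (w : 'I_(nv H)) : (3 <= 2 * gw w + Defs.val w)%N.
Proof.
have [_ [_ st]] := stG; have [v vw] := ct_surj ct w.
suff : chi w <= -1 by rewrite /chi; lia.
rewrite (ct_chi ct) (bigD1 v) /= ?vw //.
have : chi v <= -1 by have := st v; rewrite /chi; lia.
suff : \sum_(i | (phi i == w) && (i != v)) chi i <= 0 by set s := \sum_(i | _) _; lia.
by apply: sumr_le0 => u _; have := st u; rewrite /chi; lia.
Qed.

End StableContraction.

(** * Modifications as tilings of tracks *)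

Section Tracks.
Variables (n : nat) (H : graph n) (lam : 'I_(ne H) -> R).

(* Edges and legs of a curve are treated alike: both are tracks carrying a tiling. *)
Definition track : finType := ('I_(ne H) + 'I_n)%type.

Definition tpt (k : track) (t : R) : gpoint H :=
  match k with inl e => ptE lam e t | inr i => ptL H i t end.

(** Unlike [tpt], this does not turn end coordinates into vertices, so it is injective in the track
    and the coordinate. *)
Definition tint (k : track) (t : R) : gpoint H :=
  match k with inl e => @GE _ H e t | inr i => @GL _ H i t end.

(** A leg is tiled only up to [c i], where the leg of the modification starts. *)
Definition tlen (c : 'I_n -> R) (k : track) : R :=
  match k with inl e => lam e | inr i => c i end.

Definition tstart (k : track) : 'I_(nv H) :=
  match k with inl e => esrc e | inr i => legv H i end.

Lemma tpt0 k : tpt k 0 = @GV _ H (tstart k).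
Proof. by case: k => [e|i] /=; rewrite /ptE /ptL eqxx. Qed.

Lemma tpt_tint c k t : 0 < t < tlen c k -> tpt k t = tint k t.
Proof.
case: k => [e|i] /= /andP[t0 tL]; rewrite /ptE /ptL gt_eqF //.
by rewrite lt_eqF.
Qed.

Variables (G' : graph n) (l' : 'I_(ne G') -> R).
Variables (pos : 'I_(nv G') -> option (gpoint H)).
Variables (trk : 'I_(ne G') -> option track) (ta tb : 'I_(ne G') -> R) (c : 'I_n -> R).

Record modif : Prop := {
  md_len : forall e', 0 < l' e';
  md_valid : forall u p, pos u = Some p -> valid_point lam p;
  md_inj : forall u w p, pos u = Some p -> pos w = Some p -> u = w;
  md_vert : forall v, exists u, pos u = Some (@GV _ H v);
  md_gw : forall u, gw u = match pos u with Some (GV v) => gw v | _ => 0%N end;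
  md_tile : forall e' k, trk e' = Some k ->
    [/\ 0 <= ta e', ta e' < tb e', tb e' <= tlen c k, l' e' = tb e' - ta e' &
     (pos (esrc e') = Some (tpt k (ta e')) /\ pos (etgt e') = Some (tpt k (tb e')))
     \/ (pos (esrc e') = Some (tpt k (tb e')) /\ pos (etgt e') = Some (tpt k (ta e')))];
  md_disj : forall k e1 e2, e1 <> e2 -> trk e1 = Some k -> trk e2 = Some k ->
    tb e1 <= ta e2 \/ tb e2 <= ta e1;
  md_sum : forall k, \sum_(e' | trk e' == Some k) l' e' = tlen c k;
  md_c : forall i, 0 <= c i;
  md_on : forall u k t, pos u = Some (tint k t) ->
    exists2 e', trk e' = Some k & ta e' = t \/ tb e' = t;
  md_leg : forall i, pos (legv G' i) = Some (ptL H i (c i));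
  md_conn : connected G';
  md_count : (ne G' + #|[pred u | isSome (pos u)]| = nv G' + #|[pred e | isSome (trk e)]|)%N }.

End Tracks.

Section ModifGenP.
Variables (b : bool) (n : nat) (H : graph n) (lam : 'I_(ne H) -> R).
Variables (G' : graph n) (l' : 'I_(ne G') -> R).

Lemma modif_ModifGen pos trk ta tb c : modif lam l' pos trk ta tb c ->
  b || [forall u, isSome (pos u)] -> ModifGen b lam l'.
Proof.
case=> h1 h2 h3 h4 h5 h6 h7 h8 h9 h10 h11 h12 h13 hb.
pose loc e' : option (eloc H) := match trk e' with
  | Some (inl e) => Some (LE e (ta e') (tb e'))
  | Some (inr i) => Some (@LL _ H i (ta e') (tb e'))
  | None => None end.
have locE e' e x y : loc e' = Some (LE e x y) -> [/\ trk e' = Some (inl e), x = ta e' & y = tb e'].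
  by rewrite /loc; case: (trk e') => // -[] // e0 [-> -> ->].
have locL e' i x y : loc e' = Some (@LL _ H i x y) -> [/\ trk e' = Some (inr i), x = ta e' & y = tb e'].
  by rewrite /loc; case: (trk e') => // -[] // e0 [-> -> ->].
exists pos, loc, c; do 5 (split=> //).
split.
  by move=> e' e x y /locE[/h6[? ? ? ? ?] -> ->]; do !split.
split.
  by move=> e' e x y /locL[/h6[? ? ? ? ?] -> ->]; do !split.
split.
  by move=> e e1 e2 a1 b1 a2 b2 ne12 /locE[k1 -> ->] /locE[k2 -> ->]; exact: h7 k1 k2.
split.
  by move=> e e1 e2 a1 b1 a2 b2 ne12 /locL[k1 -> ->] /locL[k2 -> ->]; exact: h7 k1 k2.
split.
  move=> e; rewrite -[RHS](h8 (inl e)); apply: eq_bigl => e'.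
  by rewrite /loc; case: (trk e') => // -[].
split.
  move=> i; split=> //; rewrite -[RHS](h8 (inr i)); apply: eq_bigl => e'.
  by rewrite /loc; case: (trk e') => // -[].
split.
  move=> u e t /(h10 u (inl e) t)[e' ke' ab]; exists e', (ta e'), (tb e').
  by rewrite /loc ke'.
split.
  move=> u i t /(h10 u (inr i) t)[e' ke' ab]; exists e', (ta e'), (tb e').
  by rewrite /loc ke'.
do 2 split=> //; split=> //.
rewrite h13; congr addn; apply: eq_card => e'; rewrite !inE /loc.
by case: (trk e') => // -[].
Qed.

Lemma ModifGen_modif : ModifGen b lam l' -> exists pos trk ta tb c,
  modif lam l' pos trk ta tb c /\ b || [forall u, isSome (pos u)].
Proof.
case=> pos [loc [c [h1 [h2 [h3 [h4 [h5 [h6 [h7 [h8 [h9 [h10 [h11 [h12 [h13 [h14 [h15 [h16 h17]]]]]]]]]]]]]]]]]].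
pose trk e' : option (track H) := match loc e' with
  | Some (LE e _ _) => Some (inl e) | Some (LL i _ _) => Some (inr i) | None => None end.
pose ta e' := match loc e' with Some (LE _ a _) => a | Some (LL _ a _) => a | _ => 0 end.
pose tb e' := match loc e' with Some (LE _ _ b) => b | Some (LL _ _ b) => b | _ => 0 end.
exists pos, trk, ta, tb, c; split=> //; split=> //.
- move=> e' k; rewrite /trk /ta /tb.
  case E: (loc e') => [[e x y|i x y]|] // [<-]; first by have [? [? [? [? ?]]]] := h6 _ _ _ _ E.
  by have [? [? [? [? ?]]]] := h7 _ _ _ _ E.
- move=> k e1 e2 ne12; rewrite /trk /ta /tb.
  case E1: (loc e1) => [[e x y|i x y]|] // [<-]; case E2: (loc e2) => [[e0 x0 y0|i0 x0 y0]|] // [ee].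
    by move: E2; rewrite ee => E2; exact: h8 E1 E2.
  by move: E2; rewrite ee => E2; exact: h9 E1 E2.
- case=> [e|i] /=; [rewrite -h10|rewrite -(h11 i).2]; apply: eq_bigl => e'; rewrite /trk;
  by case: (loc e') => [[]|].
- by move=> i; case: (h11 i).
- move=> u [e|i] t /= pu.
    have [e' [x [y [E xy]]]] := h12 _ _ _ pu; exists e'; by rewrite /trk /ta /tb E.
  have [e' [x [y [E xy]]]] := h13 _ _ _ pu; exists e'; by rewrite /trk /ta /tb E.
- rewrite h16; congr addn; apply: eq_card => e'; rewrite !inE /trk.
  by case: (loc e') => // -[].
Qed.

End ModifGenP.

Section ModifTheory.
Variables (n : nat) (H : graph n) (lam : 'I_(ne H) -> R).
Variables (G' : graph n) (l' : 'I_(ne G') -> R).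
Variables (pos : 'I_(nv G') -> option (gpoint H)).
Variables (trk : 'I_(ne G') -> option (track H)) (ta tb : 'I_(ne G') -> R) (c : 'I_n -> R).
Hypothesis md : modif lam l' pos trk ta tb c.
Hypothesis lam_gt0 : forall e, 0 < lam e.

Local Notation tlen := (tlen lam c).
Local Notation tpt := (tpt lam).

Definition core (u : 'I_(nv G')) : bool := isSome (pos u).
Definition core_edge (e : 'I_(ne G')) : bool := isSome (trk e).

Lemma core_edge_ends e : core_edge e -> core (esrc e) /\ core (etgt e).
Proof.
rewrite /core_edge /core; case E: (trk e) => [k|] // _.
by have [_ _ _ _ [[-> ->]|[-> ->]]] := md_tile md E.
Qed.

Lemma tlen_ge0 k : 0 <= tlen k.
Proof. by case: k => [e|i] /=; [exact: ltW|exact: md_c md i]. Qed.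

Lemma track_packed k : packed ta tb (fun e => trk e == Some k).
Proof.
split=> [e /eqP/(md_tile md)[] //|p q /eqP kp /eqP kq pq]; exact: md_disj md _ _ _ pq kp kq.
Qed.

Lemma track_tiling k : tiling ta tb (fun e => trk e == Some k) (tlen k).
Proof.
split; first exact: track_packed.
- by move=> e /eqP/(md_tile md)[].
- by move=> e /eqP/(md_tile md)[].
- by rewrite -(md_sum md); apply: eq_bigr => e /eqP/(md_tile md)[].
Qed.

Definition stop (k : track H) (t : R) : Prop :=
  0 <= t <= tlen k /\ exists u, pos u = Some (tpt k t).

Lemma tile_stops e k : trk e = Some k -> stop k (ta e) /\ stop k (tb e).
Proof.
case/(md_tile md) => a0 ab bL _ ends; split; split; try lra.
  by case: ends => -[h1 h2]; eexists; eassumption.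
by case: ends => -[h1 h2]; eexists; eassumption.
Qed.

Lemma stop_endpoint k t : stop k t -> 0 < t < tlen k ->
  exists2 e, trk e = Some k & ta e = t \/ tb e = t.
Proof.
by move=> [_ [u pu]] tin; move: pu; rewrite (tpt_tint tin); exact: (md_on md).
Qed.

Lemma stop_tile_end k t : stop k t -> 0 < t -> exists2 e, trk e = Some k & tb e = t.
Proof.
move=> st t0; have [/andP[_ tL] _] := st.
have [tL'|tL'] := ltP t (tlen k); last first.
  have [|e /eqP ke be] := tiling_last (track_tiling k); first by lra.
  by exists e => //; lra.
have [|e ke [ae|be]] := stop_endpoint st; first by rewrite t0.
  have /eqP ke' := ke; have [|q /eqP kq bq] := tiling_prev (track_tiling k) ke'; first by rewrite ae.
  by exists q => //; rewrite bq.
by exists e.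
Qed.

Lemma stop_tile_begin k t : stop k t -> t < tlen k -> exists2 e, trk e = Some k & ta e = t.
Proof.
move=> st tL; have [/andP[t0 _] _] := st.
have [t0'|t0'] := ltP 0 t; last first.
  have [|e /eqP ke be] := tiling_first (track_tiling k); first by lra.
  by exists e => //; lra.
have [|e ke [ae|be]] := stop_endpoint st; first by rewrite t0'.
  by exists e.
have /eqP ke' := ke; have [|q /eqP kq bq] := tiling_next (track_tiling k) ke'; first by rewrite be.
by exists q => //; rewrite bq.
Qed.

Lemma stop_outside_tile k t e : stop k t -> trk e = Some k -> t <= ta e \/ tb e <= t.
Proof.
move=> st ke; have [/andP[t0 tL] _] := st.
have [? ab ? ? _] := md_tile md ke.
have [t00|t00] := ltP 0 t; last by left; lra.
have [q kq bq] := stop_tile_end st t00.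
case: (e =P q) => [->|eq]; first by right; lra.
by have [_ ? _ _ _] := md_tile md kq; have [] := md_disj md eq ke kq; lra.
Qed.

(** Walks back from [t2] one tile at a time. It serves both for potentials on a track and for
    quotient maps contracting parts of it. *)
Lemma track_chain (X : Type) (f : 'I_(nv G') -> X) k t1 t2 u1 u2 :
  stop k t1 -> stop k t2 -> t1 <= t2 ->
  pos u1 = Some (tpt k t1) -> pos u2 = Some (tpt k t2) ->
  (forall e, trk e = Some k -> t1 <= ta e -> tb e <= t2 -> f (esrc e) = f (etgt e)) ->
  f u1 = f u2.
Proof.
move=> s1.
have [N] := ubnP #|[pred e | (trk e == Some k) && (tb e <= t2)%R]|.
elim: N t2 u2 => // N IH t2 u2 ltN s2 le12 p1 p2 fc.
have [lt12|ge12] := ltP t1 t2; last first.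
  have e12 : t1 = t2 by apply/eqP; rewrite eq_le le12.
  by move: p1; rewrite e12 => p1; rewrite (md_inj md p1 p2).
have [e ke be] : exists2 e, trk e = Some k & tb e = t2.
  by apply: stop_tile_end s2 _; have [/andP[]] := s1; lra.
have [a0 ab bL _ ends] := md_tile md ke.
have t1a : t1 <= ta e by have := stop_outside_tile s1 ke; lra.
have fe : f (esrc e) = f (etgt e) by apply: fc => //; lra.
have [ua [pa fa]] : exists ua, pos ua = Some (tpt k (ta e)) /\ f ua = f u2.
  rewrite -be in p2.
  case: ends => -[ps pt].
    by exists (esrc e); rewrite ps fe (md_inj md pt p2).
  by exists (etgt e); rewrite pt -fe (md_inj md ps p2).
rewrite -fa; apply: (IH (ta e)) => //; last 2 first.
- by have [] := tile_stops ke.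
- by move=> e' ke' h1 h2; apply: fc => //; lra.
rewrite -ltnS; apply: leq_trans ltN; rewrite ltnS.
apply: proper_card; apply/properP; split.
  by apply/subsetP => x; rewrite !inE => /andP[-> h] /=; lra.
by exists e; rewrite !inE ke eqxx /= ?be //; rewrite be in ab; lra.
Qed.

Lemma stop0 k : stop k 0.
Proof.
split; first by rewrite lexx tlen_ge0.
by have [u pu] := md_vert md (tstart k); exists u; rewrite tpt0.
Qed.

Lemma tpt_edge_end e : tpt (inl e) (lam e) = @GV _ H (etgt e).
Proof. by rewrite /= /ptE gt_eqF // eqxx. Qed.

Lemma stop_edge_end e : stop (inl e) (lam e).
Proof.
split; first by rewrite /= lexx ltW.
by have [u pu] := md_vert md (etgt e); exists u; rewrite tpt_edge_end.
Qed.

Lemma core_cases u p : pos u = Some p ->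
  (exists v, p = @GV _ H v) \/ (exists k t, [/\ p = tint k t, p = tpt k t, 0 < t <= tlen k & stop k t]).
Proof.
move=> pu; have := md_valid md pu.
case: p pu => [v|e t|i t] pu /= vp; first by left; exists v.
  right; exists (inl e), t; have e1 := tpt_tint (c := c) (k := inl e) vp; split=> //=; first by lra.
  by split; [rewrite /=; lra|exists u; rewrite e1].
have [e ke ab] := md_on md (k := inr i) pu.
have [a0 ab0 bL _ _] := md_tile md ke; rewrite /= in ab bL *.
have e1 : tpt (inr i) t = @GL _ H i t by rewrite /= /ptL gt_eqF.
right; exists (inr i), t; split=> //=; first by case: ab => ab; lra.
by split; [rewrite /=; case: ab => ab; lra|exists u; rewrite e1].
Qed.

Variable v0 : 'I_(nv H).

Lemma noncore_inj (F : fieldType) (f : 'I_(nv G') -> F) :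
  (forall v, v \notin [pred u | ~~ core u] -> f v = 0) ->
  (forall e, e \in [pred e | ~~ core_edge e] -> f (esrc e) = f (etgt e)) ->
  forall v, f v = 0.
Proof.
move=> f0 fc v; have [u0 pu0] := md_vert md v0.
have cu0 : core u0 by rewrite /core pu0.
rewrite (connected_const (f := f) (md_conn md) _ v u0).
  by apply: f0; rewrite inE cu0.
move=> e; case ce: (core_edge e); last by apply: fc; rewrite inE ce.
by have [cs ct] := core_edge_ends ce; rewrite !f0 // inE ?cs ?ct.
Qed.

(* This is how the count [md_count] encodes that the attached part is a forest of
   trees, each attached at one point: its incidence matrix is square and, by
   connectedness, injective. *)
Lemma noncore_card : #|[pred u | ~~ core u]| = #|[pred e | ~~ core_edge e]|.
Proof.
have arith (a b x y E V : nat) : (x + b = E -> y + a = V -> E + y = V + x -> a = b)%N by lia.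
apply: (arith _ _ #|[pred e | isSome (trk e)]| #|[pred u | isSome (pos u)]|); last exact: md_count md.
  by rewrite -[RHS]card_ord -[RHS](cardC [pred e | isSome (trk e)]).
by rewrite -[RHS]card_ord -[RHS](cardC [pred u | isSome (pos u)]).
Qed.

(** Attached trees have neither cycles nor legs, so they carry no conserved flow; harmonic functions
    are therefore constant on them. *)
Lemma noncore_flow_eq0 (F : fieldType) (z : 'I_(ne G') -> F) :
  (forall v, ~~ core v -> \sum_(e | etgt e == v) z e = \sum_(e | esrc e == v) z e) ->
  forall e, ~~ core_edge e -> z e = 0.
Proof.
move=> zd e nce; apply: (flow_inj (noncore_inj (F := F)) noncore_card) => // v /[!inE] ncv.
have aux (h : 'I_(ne G') -> 'I_(nv G')) : (forall e, core_edge e -> core (h e)) ->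
    \sum_(i in [pred e0 | ~~ core_edge e0] | h i == v) z i = \sum_(i | h i == v) z i.
  move=> hc; apply: eq_bigl => i; rewrite inE; case: eqP => [hi|]; rewrite ?andbF ?andbT //.
  by apply: contra ncv => /hc; rewrite hi.
by rewrite !aux ?zd // => i /(core_edge_ends)[].
Qed.

(* Trees are attached at single points, so the modification retracts onto its core. *)
Lemma core_retraction : exists rho : 'I_(nv G') -> 'I_(nv G'),
  [/\ forall u, core u -> rho u = u, forall u, core (rho u) &
      forall e, ~~ core_edge e -> rho (esrc e) = rho (etgt e)].
Proof.
(* The potential [psi] vanishes on the core and makes [f = psi + num] constant along each attached
   tree. As [num] separates core vertices, the value of [f] names the point where the tree is
   attached. *)
pose num (u : 'I_(nv G')) : rat := if core u then (u : nat)%:R else 0.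
have [psi [psi0 psie]] := potential_exists (noncore_inj (F := rat)) noncore_card
  (fun e => num (esrc e) - num (etgt e)).
pose f u := psi u + num u.
have fcore u : core u -> f u = (u : nat)%:R.
  by move=> cu; rewrite /f psi0 ?inE ?cu // add0r /num cu.
have fe e : ~~ core_edge e -> f (esrc e) = f (etgt e).
  by move=> nce; have := psie e; rewrite inE nce => /(_ isT); rewrite /f; lra.
pose P u := [exists w, core w && (f u == f w)].
have [u0 pu0] := md_vert md v0.
have cu0 : core u0 by rewrite /core pu0.
have Pall u : P u.
  rewrite (connected_const (f := P) (md_conn md) _ u u0).
    by apply/existsP; exists u0; rewrite cu0 /=.
  move=> e; case ce: (core_edge e); last by rewrite /P fe // ce.
  have [cs ct] := core_edge_ends ce.
  by transitivity true; [|apply/esym]; apply/existsP; [exists (esrc e)|exists (etgt e)]; rewrite ?cs ?ct /=.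
have [rho rhoP] := fin_all_exists (fun u => existsP (Pall u)).
have rho_eq u w : core w -> f u = f w -> rho u = w.
  move=> cw fuw; have /andP[cr /eqP fr] := rhoP u; apply/val_inj/eqP.
  by rewrite -(eqr_nat rat) -fcore // -fr fuw fcore.
exists rho; split.
- by move=> u cu; apply: rho_eq.
- by move=> u; have /andP[] := rhoP u.
- move=> e /fe fst; apply: rho_eq; first by have /andP[] := rhoP (etgt e).
  by have /andP[_ /eqP <-] := rhoP (etgt e).
Qed.

Lemma core_const (X : Type) (f : 'I_(nv G') -> X) :
  (forall e, core_edge e -> f (esrc e) = f (etgt e)) ->
  forall u w, core u -> core w -> f u = f w.
Proof.
move=> fc u w cu cw; have [rho [rc _ re]] := core_retraction.
rewrite -(rc u cu) -(rc w cw).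
apply: (connected_const (f := f \o rho) (md_conn md)) => e /=.
case ce: (core_edge e); last by rewrite re // ce.
by have [cs ct] := core_edge_ends ce; rewrite !rc //; exact: fc.
Qed.

Definition gvert (u : 'I_(nv G')) : option 'I_(nv H) :=
  if pos u is Some (GV v) then Some v else None.

Lemma gvertP u v : gvert u = Some v <-> pos u = Some (@GV _ H v).
Proof.
rewrite /gvert; split; last by move=> ->.
by case: (pos u) => // -[] // ? [->].
Qed.

Lemma vat_exists : exists vat : 'I_(nv H) -> 'I_(nv G'), forall v, pos (vat v) = Some (@GV _ H v).
Proof. exact: fin_all_exists (md_vert md). Qed.

(** A tile may be oriented against its track; [side] records which of its ends lies at [ta]. *)
Lemma side_exists : exists side : 'I_(ne G') -> bool, forall e k, trk e = Some k ->
  pos (fl_vert (inl (e, side e) : flag G')) = Some (tpt k (ta e)) /\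
  pos (fl_vert (inl (e, ~~ side e) : flag G')) = Some (tpt k (tb e)).
Proof.
suff h e : exists s, forall k, trk e = Some k ->
    pos (fl_vert (inl (e, s) : flag G')) = Some (tpt k (ta e)) /\
    pos (fl_vert (inl (e, ~~ s) : flag G')) = Some (tpt k (tb e)).
  exact: fin_all_exists h.
case E: (trk e) => [k|]; last by exists true.
by have [_ _ _ _ [[ps pt]|[ps pt]]] := md_tile md E; [exists false|exists true] => _ [<-].
Qed.

Lemma sum_gw_modif : (\sum_(u : 'I_(nv G')) gw u = \sum_(v : 'I_(nv H)) gw v)%N.
Proof.
have [vat vatP] := vat_exists.
rewrite (bigID (fun u => isSome (gvert u))) /= [X in (_ + X)%N]big1 ?addn0; last first.
  by move=> u; rewrite (md_gw md) /gvert; case: (pos u) => // -[].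
rewrite (reindex_omap vat gvert) /=.
  apply: eq_big => [v|v _]; rewrite ?(md_gw md) ?vatP //.
  by rewrite /gvert vatP eqxx.
move=> u; case E: (gvert u) => [v|] // _ /=.
by rewrite (md_inj md (vatP v) ((gvertP u v).1 E)).
Qed.

Lemma card_gvert : #|[pred u | isSome (gvert u)]| = nv H.
Proof.
have [vat vatP] := vat_exists.
rewrite card_sum1 (reindex_omap vat gvert) /=.
  rewrite -[RHS]card_ord -sum1_card; apply: eq_bigl => v.
  by rewrite /gvert vatP eqxx.
move=> u; case E: (gvert u) => [v|] // _ /=.
by rewrite (md_inj md (vatP v) ((gvertP u v).1 E)).
Qed.

Lemma tint_inj k t k' t' : tint (H := H) k t = tint k' t' -> k = k' /\ t = t'.
Proof. by case: k k' => [e|i] [e'|i'] //= [-> ->]. Qed.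

Lemma tile_b_inj e1 e2 k : trk e1 = Some k -> trk e2 = Some k -> tb e1 = tb e2 -> e1 = e2.
Proof.
move=> k1 k2 bb; case: (e1 =P e2) => // ne12.
have [_ ? _ _ _] := md_tile md k1; have [_ ? _ _ _] := md_tile md k2.
by exfalso; have := md_disj md ne12 k1 k2; lra.
Qed.

Lemma core_edges_bound :
  (#|[pred e | core_edge e]| + nv H <= #|[pred u | core u]| + ne H)%N.
Proof.
have [side sideP] := side_exists.
pose intr := [pred u | core u && ~~ isSome (gvert u)].
have -> : (#|[pred u | core u]| = nv H + #|intr|)%N.
  rewrite -card_gvert !card_sum1 (bigID (fun u => isSome (gvert u))) /=; congr addn.
  by apply: eq_bigl => u; rewrite /core /gvert; case: (pos u) => // -[].
rewrite addnC -addnA leq_add2l.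
pose bend e := fl_vert (inl (e, ~~ side e) : flag G').
(* Charge a tile to the vertex at its far end, or to its edge of [H] when it is the last tile there;
   tiles of one track have distinct far ends, so the charge is injective. *)
pose g e : 'I_(nv G') + 'I_(ne H) := match trk e with
  | Some (inl e0) => if tb e == lam e0 then inr e0 else inl (bend e)
  | _ => inl (bend e) end.
have gP e k : trk e = Some k -> (exists2 e0, g e = inr e0 & k = inl e0 /\ tb e = lam e0) \/
    (g e = inl (bend e) /\ pos (bend e) = Some (tint k (tb e))).
  move=> ke; have [a0 ab bL _ _] := md_tile md ke; have [_ pb] := sideP _ _ ke.
  rewrite /g /bend pb ke; case: k {ke pb} bL => [e0|i] /= bL.
    case: eqP => [be|/eqP be]; first by left; exists e0.
    by right; split=> //; rewrite /ptE (negbTE be) gt_eqF //; lra.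
  by right; rewrite /ptL gt_eqF //; lra.
have ginj : {in [pred e | core_edge e] &, injective g}.
  move=> e1 e2; rewrite !inE /core_edge.
  case k1: (trk e1) => [t1|] // _; case k2: (trk e2) => [t2|] // _.
  case: (gP _ _ k1) => [[e01 -> [h1 h1']]|[-> p1]]; case: (gP _ _ k2) => [[e02 -> [h2 h2']]|[-> p2]] // [ee].
    by apply: (tile_b_inj k1); rewrite ?k2 ?h1 ?h2 ?ee // h1' h2' ee.
  move: p1; rewrite ee p2 => -[/esym/tint_inj[kk bb]].
  by apply: (tile_b_inj k1) => //; rewrite kk.
rewrite -(card_in_imset ginj).
have -> : (#|intr| + ne H)%N = #|[set x : 'I_(nv G') + 'I_(ne H) | if x is inl u then intr u else true]|.
  rewrite cardsE -[RHS]sum1_card big_sumType /= card_sum1; congr addn.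
  by rewrite -[LHS](card_ord (ne H)) -sum1_card; apply: eq_bigl.
apply: subset_leq_card; apply/subsetP => x /imsetP[e]; rewrite !inE /core_edge.
case ke: (trk e) => [k|] // _ ->.
case: (gP _ _ ke) => [[e0 -> _]|[-> p]] //.
by rewrite /intr /= /core /gvert p; case: (k).
Qed.

(** A modification does not increase the genus; Riemann-Hurwitz and the comparison of genera after
    contraction both call for this direction. *)
Lemma modif_genus_le :
  (ne G' + nv H + \sum_(u : 'I_(nv G')) gw u <= nv G' + ne H + \sum_(v : 'I_(nv H)) gw v)%N.
Proof.
rewrite sum_gw_modif leq_add2r.
have := core_edges_bound; have := md_count md; rewrite /core /core_edge; lia.
Qed.

(** The leg [i] of [G'] counts as part of its track, so that the last subdivision point of that leg
    also has two flags on it. *)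
Definition ftrk (h : flag G') : option (track H) :=
  match h with inl (e, _) => trk e | inr i => Some (inr i) end.

Lemma two_flags u k t : pos u = Some (tint k t) ->
  exists h1 h2 : flag G', [/\ h1 != h2, fl_vert h1 = u, fl_vert h2 = u,
    ftrk h1 = Some k & ftrk h2 = Some k].
Proof.
have [side sideP] := side_exists.
move=> pu; case: (core_cases pu) => [[v]|[k' [t' [/tint_inj[<- <-] pt tin st]]]].
  by case: (k).
rewrite pt in pu.
have [e1 k1 b1] : exists2 e, trk e = Some k & tb e = t.
  by apply: (stop_tile_end st); lra.
have [_ p1] := sideP _ _ k1; rewrite b1 in p1.
have [tL|tL] := ltP t (tlen k).
  have [e2 k2 a2] := stop_tile_begin st tL.
  have [p2 _] := sideP _ _ k2; rewrite a2 in p2.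
  exists (inl (e1, ~~ side e1)), (inl (e2, side e2)); split=> //=.
  - apply/eqP => -[e12 _]; have [_ + _ _ _] := md_tile md k1.
    by rewrite {1}e12 a2 b1 ltxx.
  - exact: (md_inj md p1 pu).
  - exact: (md_inj md p2 pu).
case: k pt st k1 p1 tL tin pu => [e|i] pt st k1 p1 tL tin pu.
  have te : t = lam e by rewrite /= in tL tin; lra.
  by move: pt; rewrite te tpt_edge_end.
exists (inl (e1, ~~ side e1)), (inr i); split=> //=.
  exact: (md_inj md p1 pu).
apply: (md_inj md (md_leg md i)); rewrite pu /=.
by have -> : t = c i by rewrite /= in tL tin; lra.
Qed.

(** Send each flag at [v] to the first tile along it, or to the leg of [G'] itself when no part of
    the leg is tiled; different flags have different initial pieces. *)
Lemma val_modif_ge u v : pos u = Some (@GV _ H v) -> (Defs.val v <= Defs.val u)%N.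
Proof.
move=> pu; have [side sideP] := side_exists.
have fexist (h : flag H) : exists h' : flag G',
    match h with
    | inl (e, b) => exists2 e', h' = inl (e', b (+) side e') &
        trk e' = Some (inl e) /\ (if b then tb e' = lam e else ta e' = 0)
    | inr i => h' = inr i \/ exists2 e', h' = inl (e', side e') & trk e' = Some (inr i) /\ ta e' = 0
    end /\ (fl_vert h = v -> fl_vert h' = u).
  have first k : 0 < tlen k -> exists e', trk e' = Some k /\ ta e' = 0.
    by move=> /(tiling_first (track_tiling k))[e' /eqP]; exists e'.
  case: h => [[e []]|i].
  - have [|e' /eqP ke' be'] := tiling_last (track_tiling (inl e)); first exact: lam_gt0.
    exists (inl (e', ~~ side e')); split; first by exists e'.
    move=> vv; have [_ pb] := sideP _ _ ke'; apply: (md_inj md pb).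
    by rewrite be' tpt_edge_end // pu -vv.
  - have [|e' [ke' ae']] := first (inl e); first exact: lam_gt0.
    exists (inl (e', side e')); split; first by exists e'.
    move=> vv; have [pa _] := sideP _ _ ke'; apply: (md_inj md pa).
    by rewrite ae' tpt0 pu -vv.
  have [c0|c0] := ltP 0 (c i); last first.
    exists (inr i); split; first by left.
    move=> vv; apply: (md_inj md (md_leg md i)).
    have -> : c i = 0 by have := md_c md i; lra.
    by rewrite -[ptL H i 0]/(tpt (inr i) 0) tpt0 pu -vv.
  have [e' [ke' ae']] := first (inr i) c0.
  exists (inl (e', side e')); split; first by right; exists e'.
  move=> vv; have [pa _] := sideP _ _ ke'; apply: (md_inj md pa).
  by rewrite ae' tpt0 pu -vv.
have [th thP] := fin_all_exists fexist.
have th_inj : injective th.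
  move=> h1 h2 h12; move: (thP h1) (thP h2) => [+ _] [+ _]; rewrite -h12.
  case: h1 {h12} => [[e1 b1]|i1]; case: h2 => [[e2 b2]|i2].
  - move=> [x1 -> [k1 q1]] [x2 [xx] ]; rewrite -xx => bb [k2 q2].
    by move: k2; rewrite k1 => -[->]; have -> : b1 = b2 by move: bb; case: (b1) (b2) (side x1) => [] [] [].
  - move=> [x1 -> [k1 q1]] [//|[x2 [xx _] [k2 q2]]].
    by move: k2; rewrite -xx k1.
  - move=> [q1|[x1 q1 [k1 _]]] [x2 q2 [k2 _]]; move: q2; rewrite q1 => // -[xx _].
    by move: k2; rewrite -xx k1.
  - move=> [q1|[x1 q1 [k1 _]]] [q2|[x2 q2 [k2 _]]]; move: q2; rewrite q1 => // -[]; first by move=> ->.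
    by move=> xx; move: k2; rewrite -xx k1 => -[->].
rewrite /Defs.val -(card_image th_inj); apply: subset_leq_card.
apply/subsetP => h' /imageP[h]; rewrite !inE => /eqP hv ->.
by have [_ ->] := thP h.
Qed.

Hypothesis stH : forall v : 'I_(nv H), (3 <= 2 * gw v + Defs.val v)%N.

(** Points inside a track have two flags and vertices of genus 0 of a stable curve have at least
    three: a leaf of genus 0 can only lie on an attached tree. *)
Lemma core_val1 u : core u -> Defs.val u = 1%N -> (0 < gw u)%N.
Proof.
rewrite /core; case pu: (pos u) => [p|] // _ val1.
case: (core_cases pu) => [[v pv]|[k [t [pk _ _ _]]]].
  by rewrite (md_gw md) pu pv; rewrite pv in pu; have := val_modif_ge pu; have := stH v; lia.
rewrite pk in pu; have [h1 [h2 [h12 e1 e2 _ _]]] := two_flags pu.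
suff : (2 <= Defs.val u)%N by rewrite val1.
rewrite /Defs.val (cardD1 h1) inE e1 eqxx (cardD1 h2) !inE e2 eqxx.
by rewrite eq_sym h12.
Qed.

(** Stability keeps [u] away from the vertices of [H], so it lies inside a track, and its two flags
    are the two directions of that track. *)
Lemma val2_ftrk u (h1 h2 : flag G') k : gw u = 0%N -> Defs.val u = 2%N -> core u ->
  fl_vert h1 = u -> fl_vert h2 = u -> ftrk h1 = Some k -> ftrk h2 = Some k.
Proof.
move=> gw0 val2; rewrite /core; case pu: (pos u) => [p|] // _ hu1 hu2.
case: (core_cases pu) => [[v pv]|[k0 [t [pk _ _ _]]]].
  move: gw0; rewrite (md_gw md) pu pv; rewrite pv in pu; have := val_modif_ge pu; have := stH v; lia.
rewrite pk in pu; have [h3 [h4 [h34 e3 e4 t3 t4]]] := two_flags pu.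
have all34 h : fl_vert h = u -> ftrk h = Some k0.
  move=> hu; case: (h =P h3) => [-> //|/eqP h3']; case: (h =P h4) => [-> //|/eqP h4'].
  suff : (3 <= Defs.val u)%N by rewrite val2.
  rewrite /Defs.val (cardD1 h3) inE e3 eqxx (cardD1 h4) !inE e4 eqxx (cardD1 h) !inE hu eqxx.
  by rewrite eq_sym h34 h3' h4'.
by move: (all34 _ hu1) (all34 _ hu2) => -> -> [->].
Qed.

End ModifTheory.

(** * Harmonic morphisms and harmonic functions *)

Record hmor n (a : 'I_n -> int) (G' : graph n) (l' : 'I_(ne G') -> R)
    (D : graph 2) (dl : 'I_(ne D) -> R)
    (tv : 'I_(nv G') -> 'I_(nv D)) (te : 'I_(ne G') -> 'I_(ne D))
    (fl : 'I_(ne G') -> bool) (s : 'I_(ne G') -> nat)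
    (tl : 'I_n -> 'I_2) (sl : 'I_n -> nat) (dg : 'I_(nv G') -> nat) : Prop := {
  hm_s : forall e, (0 < s e)%N;
  hm_sl : forall i, (0 < sl i)%N;
  hm_ends : forall e, tv (esrc e) = (if fl e then etgt (te e) else esrc (te e)) /\
                 tv (etgt e) = (if fl e then esrc (te e) else etgt (te e));
  hm_len : forall e, dl (te e) = (s e)%:R * l' e;
  hm_leg : forall i, tv (legv G' i) = legv D (tl i);
  hm_deg : forall v (h : flag D), fl_vert h = tv v ->
    (\sum_(h' : flag G' | (fl_vert h' == v) && (tflag te fl tl h' == h)) fslope s sl h')%N = dg v;
  hm_eff : forall v, 0 <= (dg v)%:Z * chi (tv v) - chi v;
  hm_a : forall i, (0 < a i -> tl i = ord0 /\ (sl i)%:Z = a i) /\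
                   (a i < 0 -> tl i = 1 /\ (sl i)%:Z = - a i) }.

Lemma DR_morphismP n (a : 'I_n -> int) (G' : graph n) (l' : 'I_(ne G') -> R)
    (D : graph 2) (dl : 'I_(ne D) -> R) :
  DR_morphism a l' dl <-> exists tv te fl s tl sl dg, hmor a l' dl tv te fl s tl sl dg.
Proof.
split.
  case=> tv [te [fl [s [tl [sl [h1 [h2 [h3 [h4 [h5 [h6 h7]]]]]]]]]]].
  have [dg dgP] := fin_all_exists h6.
  exists tv, te, fl, s, tl, sl, dg; split=> //.
    by move=> v h /eqP; have [+ _] := dgP v; exact.
  by move=> v; have [_] := dgP v.
case=> tv [te [fl [s [tl [sl [dg [h1 h2 h3 h4 h5 h6 h7 h8]]]]]]].
exists tv, te, fl, s, tl, sl; do 5 (split=> //); split=> // v.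
by exists (dg v); split=> // h /eqP; exact: h6.
Qed.

Section UnitFlow.
Variables (L : nat) (G : graph L).

Definition div_out (V : zmodType) (m : 'I_(ne G) -> V) (v : 'I_(nv G)) : V :=
  \sum_(e | esrc e == v) m e - \sum_(e | etgt e == v) m e.

(** Adding or removing one unit on an edge moves the sink across it, so the existence of a flow is a
    [Prop]-valued function of [w] constant along edges. *)
Lemma unit_flow u w : connected G -> exists m : 'I_(ne G) -> int,
  forall v, div_out m v = (v == u)%:R - (v == w)%:R.
Proof.
move=> cG; pose P w := exists m : 'I_(ne G) -> int,
  forall v, div_out m v = (v == u)%:R - (v == w)%:R.
suff : P u = P w.
  move=> PE; change (P w); rewrite -PE; exists (fun=> 0) => v.
  by rewrite /div_out !big1 // subrr addrN.
have add m e0 (x : int) v : div_out (fun e => m e + x *+ (e == e0)) v =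
    div_out m v + x * ((v == esrc e0)%:R - (v == etgt e0)%:R).
  have aux (h : 'I_(ne G) -> 'I_(nv G)) :
      \sum_(e | h e == v) (x *+ (e == e0)) = x * (v == h e0)%:R.
    rewrite big_mkcond (bigD1 e0) //= eqxx mulr1n big1 ?addr0 => [|e /negbTE ->].
      by rewrite eq_sym; case: eqP; rewrite ?mulr1 ?mulr0.
    by rewrite mulr0n; case: ifP.
  by rewrite /div_out !big_split /= !aux; ring.
apply: (connected_const cG) => e; apply/propext; split=> -[m mP].
  exists (fun e' => m e' + 1 *+ (e' == e)) => v; rewrite add mP; ring.
exists (fun e' => m e' + (-1) *+ (e' == e)) => v; rewrite add mP; ring.
Qed.

Lemma tree_potential (F : fieldType) (b : 'I_(ne G) -> F) : connected G -> (ne G + 1 = nv G)%N ->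
  exists f : 'I_(nv G) -> F, forall e, f (etgt e) - f (esrc e) = b e.
Proof.
move=> cG tree; have [nv0 _] := cG; pose r0 : 'I_(nv G) := Ordinal nv0.
have inj (f : 'I_(nv G) -> F) : (forall v, v \notin [pred v | v != r0] -> f v = 0) ->
    (forall e, e \in predT -> f (esrc e) = f (etgt e)) -> forall v, f v = 0.
  move=> f0 fe v; rewrite (connected_const (f := f) cG _ v r0) => [|e]; last exact: fe.
  by apply: f0; rewrite inE eqxx.
have card_eq : #|[pred v | v != r0]| = #|{: 'I_(ne G)}|.
  have h : #|predC1 r0| = (nv G).-1 by rewrite cardC1 card_ord.
  by rewrite card_ord; apply: etrans h _; rewrite -tree addn1.
have [f [_ fP]] := potential_exists inj card_eq b.
by exists f => e; apply: fP.
Qed.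

End UnitFlow.

Section HarmonicMorphism.
Variables (n : nat) (a : 'I_n -> int) (G' : graph n) (l' : 'I_(ne G') -> R).
Variables (D : graph 2) (dl : 'I_(ne D) -> R).
Variables (tv : 'I_(nv G') -> 'I_(nv D)) (te : 'I_(ne G') -> 'I_(ne D)).
Variables (fl : 'I_(ne G') -> bool) (s : 'I_(ne G') -> nat).
Variables (tl : 'I_n -> 'I_2) (sl : 'I_n -> nat) (dg : 'I_(nv G') -> nat).
Hypothesis hm : hmor a l' dl tv te fl s tl sl dg.

Local Notation tflag := (@tflag n G' D te fl tl).
Local Notation fslope := (@fslope n G' s sl).

Lemma fl_vert_tflag (h : flag G') : fl_vert (tflag h) = tv (fl_vert h).
Proof.
case: h => [[e b]|i] /=; last by rewrite (hm_leg hm).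
by have [e1 e2] := hm_ends hm e; case: b; rewrite ?e1 ?e2; case: (fl e).
Qed.

Lemma sum_fslope (Rg : comNzRingType) (f : flag D -> Rg) v :
  \sum_(h' : flag G' | fl_vert h' == v) (fslope h')%:R * f (tflag h') =
  (dg v)%:R * \sum_(h : flag D | fl_vert h == tv v) f h.
Proof.
rewrite (partition_big tflag (fun h => fl_vert h == tv v)) /=; last first.
  by move=> h' /eqP <-; rewrite fl_vert_tflag.
rewrite mulr_sumr; apply: eq_bigr => h /eqP hv.
rewrite -(hm_deg hm hv) natr_sum mulr_suml; apply: eq_bigr => h' /andP[_ /eqP ->].
by [].
Qed.

Hypothesis a_neq0 : forall i, a i != 0.

Lemma pullback_flow (m : 'I_(ne D) -> int) :
  (forall w, div_out m w = (w == legv D ord0)%:R - (w == legv D 1)%:R) ->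
  forall v, div_out (fun e => (if fl e then - 1 else 1) * (s e)%:Z * m (te e)) v =
    \sum_(i | legv G' i == v) a i.
Proof.
move=> mP v.
(* Outgoing slopes on all flags: with the legs carrying -1 and 1, the sum vanishes at every vertex,
   including those where the legs are attached. *)
pose mu (h : flag D) : int := match h with
  | inl (e, b) => if b then - m e else m e
  | inr i => if i == ord0 then -1 else 1 end.
have mu0 w : \sum_(h : flag D | fl_vert h == w) mu h = 0.
  rewrite sum_flags_G /= sumrN; have := mP w; rewrite /div_out => ->.
  rewrite big_mkcond big_ord_recl big_ord1 /=.
  have -> : lift ord0 ord0 = 1 :> 'I_2 by apply: val_inj.
  by rewrite ![legv D _ == _]eq_sym; do 2 case: eqP => _ //=.
have := sum_fslope mu v; rewrite mu0 mulr0 sum_flags_G /=.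
rewrite /div_out => E; apply/eqP; rewrite -subr_eq0 -[X in _ == X]E; apply/eqP.
have sg i : (sl i)%:R * (if tl i == ord0 then -1 else 1) = - a i.
  rewrite natz; have [pos neg] := hm_a hm i; have := a_neq0 i.
  case: (ltgtP (a i) 0) => // ai _.
    by have [-> ->] := neg ai; rewrite /= mulr1.
  by have [-> ->] := pos ai; rewrite /= mulrN1.
congr (_ + _ + _).
- by apply: eq_bigr => e _; rewrite natz; case: (fl e) => /=; ring.
- by rewrite -sumrN; apply: eq_bigr => e _; rewrite natz; case: (fl e) => /=; ring.
- by rewrite -sumrN; apply: eq_bigr => i _; rewrite sg.
Qed.

End HarmonicMorphism.

Section CoreGraph.
Variables (n : nat) (H : graph n) (lam : 'I_(ne H) -> R).
Variables (G' : graph n) (l' : 'I_(ne G') -> R).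
Variables (pos : 'I_(nv G') -> option (gpoint H)).
Variables (trk : 'I_(ne G') -> option (track H)) (ta tb : 'I_(ne G') -> R) (c : 'I_n -> R).
Hypothesis md : modif lam l' pos trk ta tb c.
Variable v0 : 'I_(nv H).

Let VC := [pred u | core pos u].
Let EC := [pred e | core_edge trk e].
Variable u0 : 'I_(nv G').
Hypothesis u0C : u0 \in VC.

Let rk u : 'I_#|VC| := enum_rank_in u0C u.
Let rkK u : core pos u -> enum_val (rk u) = u.
Proof. by move=> cu; apply: enum_rankK_in; rewrite inE. Qed.

(** Deleting the attached trees turns the modification into the subdivision that [PD] asks for. *)
Definition core_graph : graph n := {| nv := #|VC|; ne := #|EC|;
  esrc e := rk (esrc (enum_val e)); etgt e := rk (etgt (enum_val e));
  gw u := gw (enum_val u); legv i := rk (legv G' i) |}.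

Let eC (e : 'I_#|EC|) : core_edge trk (enum_val e).
Proof. by have := enum_valP e; rewrite inE. Qed.

Let srcK (e : 'I_#|EC|) : enum_val (rk (esrc (enum_val e))) = esrc (enum_val e).
Proof. by rewrite rkK //; have [] := core_edge_ends md (eC e). Qed.
Let tgtK (e : 'I_#|EC|) : enum_val (rk (etgt (enum_val e))) = etgt (enum_val e).
Proof. by rewrite rkK //; have [] := core_edge_ends md (eC e). Qed.
Let legK i : enum_val (rk (legv G' i)) = legv G' i.
Proof. by rewrite rkK // /core (md_leg md). Qed.

Lemma core_graph_modif : @modif n H lam core_graph (fun e => l' (enum_val e))
  (fun u => pos (enum_val u)) (fun e => trk (enum_val e))
  (fun e => ta (enum_val e)) (fun e => tb (enum_val e)) c.
Proof.
split.
- by move=> e; exact: (md_len md _).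
- by move=> u p pu; exact: (md_valid md pu).
- by move=> u w p pu pw; apply: enum_val_inj; exact: (md_inj md pu pw).
- move=> v; have [u pu] := md_vert md v; exists (rk u).
  by rewrite rkK // /core pu.
- by move=> u; exact: (md_gw md _).
- by move=> e k ke /=; rewrite srcK tgtK; exact: (md_tile md ke).
- move=> k e1 e2 ne12; apply: (md_disj md) => /enum_val_inj; exact: ne12.
- move=> k; rewrite -(md_sum md k) -(big_enum_val_cond (A := EC) (fun e => trk e == Some k) l').
  by apply: eq_bigl => e; rewrite inE /core_edge; case: eqP => [->|]; rewrite ?andbF.
- exact: md_c md.
- move=> u k t /(md_on md)[e ke ab].
  have eE : e \in EC by rewrite inE /core_edge ke.
  by exists (enum_rank_in eE e); rewrite enum_rankK_in.
- by move=> i /=; rewrite legK; exact: (md_leg md i).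
- apply: connected_const_test; first by apply/card_gt0P; exists u0.
  move=> f fc u w.
  have := @core_const _ _ _ _ _ _ _ _ _ _ md v0 _ (fun x => f (rk x)).
  move=> /(_ _ (enum_val u) (enum_val w)).
  have rk_val x : rk (enum_val x) = x by rewrite /rk enum_valK_in.
  rewrite !rk_val; apply; [|by have := enum_valP u; rewrite inE|by have := enum_valP w; rewrite inE].
  move=> e ce; have eE : e \in EC by rewrite inE.
  by have := fc (enum_rank_in eE e); rewrite /= enum_rankK_in.
- rewrite /= addnC; congr addn.
    rewrite -[RHS]card_ord; apply: eq_card => u; rewrite !inE.
    by have := enum_valP u; rewrite inE.
  rewrite -[LHS]card_ord; apply: eq_card => e; rewrite !inE; exact/esym/eC.
Qed.

Lemma core_graph_subdiv : Subdiv (G' := core_graph) lam (fun e => l' (enum_val e)).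
Proof.
apply: modif_ModifGen core_graph_modif _; apply/forallP => u.
by have := enum_valP u; rewrite inE.
Qed.

Lemma core_graph_div (m : 'I_(ne G') -> int) (u : 'I_(nv core_graph)) :
  (forall e, ~~ core_edge trk e -> m e = 0) ->
  div_out (G := core_graph) (fun e => m (enum_val e)) u = div_out m (enum_val u).
Proof.
move=> m0.
have aux (h : 'I_(ne G') -> 'I_(nv G')) : (forall e : 'I_#|EC|, core pos (h (enum_val e))) ->
  \sum_(e : 'I_#|EC| | rk (h (enum_val e)) == u) m (enum_val e) =
  \sum_(e | h e == enum_val u) m e.
  move=> hc; rewrite [RHS](bigID EC) /= [X in _ = _ + X]big1 ?addr0; last first.
    by move=> e /andP[_ /m0].
  under [RHS]eq_bigl do rewrite andbC.
  rewrite (big_enum_val_cond (A := EC) (fun e => h e == enum_val u) m).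
  apply: eq_bigl => e; rewrite -(inj_eq enum_val_inj) rkK //.
rewrite /div_out !aux // => e; by have [] := core_edge_ends md (eC e).
Qed.

Lemma core_graph_legs (a : 'I_n -> int) (u : 'I_(nv core_graph)) :
  \sum_(i | legv core_graph i == u) a i = \sum_(i | legv G' i == enum_val u) a i.
Proof. by apply: eq_bigl => i; rewrite -(inj_eq enum_val_inj) /= legK. Qed.

End CoreGraph.

Lemma DR_PD n (i0 : 'I_n) (a : 'I_n -> int) (H : graph n) (lam : 'I_(ne H) -> R) :
  (forall i, a i != 0) -> DR a lam -> PD a lam.
Proof.
move=> a_neq0 [G' [l' [D [dl [/ModifGen_modif [pos [trk [ta [tb [c [md _]]]]]] [g0 /DR_morphismP]]]]]].
case=> tv [te [fl [s [tl [sl [dg hm]]]]]].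
have [cD [tD [_ dl0]]] := g0; pose v0 := legv H i0.
(* On a tree this flow is 1 or -1 on the path between the two legs and 0 elsewhere, so its potential
   [F] is the coordinate of the retraction onto the line. *)
have [m mP] := unit_flow (legv D ord0) (legv D 1) cD.
have [F FP] := tree_potential (fun e => (m e)%:~R * dl e) cD tD.
pose m' e : int := (if fl e then - 1 else 1) * (s e)%:Z * m (te e).
have m'P := pullback_flow hm a_neq0 mP; rewrite -/m' in m'P.
(* The vanishing of flows is a statement over a field, so the integer slopes are read in [rat]. *)
have m'0 e : ~~ core_edge trk e -> m' e = 0.
  move=> nce; apply/eqP; rewrite -(intr_eq0 rat); apply/eqP.
  apply: (noncore_flow_eq0 md v0 (z := fun e => (m' e)%:~R) _ nce) => v ncv.
  rewrite -!rmorph_sum /=; congr (_%:~R); apply/esym/eqP; rewrite -subr_eq0.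
  have := m'P v; rewrite /div_out => ->; rewrite big1 // => i /eqP iv.
  by move: ncv; rewrite -iv /core (md_leg md).
have [u0 pu0] := md_vert md v0.
have u0C : u0 \in [pred u | core pos u] by rewrite inE /core pu0.
exists (core_graph trk u0C), (fun e => l' (enum_val e)); split.
  exact: (core_graph_subdiv md v0 u0C).
exists (fun u => F (tv (enum_val u))), (fun e => m' (enum_val e)); split=> [e|v]; last first.
  have := core_graph_div md v m'0; rewrite /div_out => ->.
  by have := m'P (enum_val v); rewrite (core_graph_legs md) /div_out => ->; rewrite subrr.
have ce : core_edge trk (enum_val e) by have := enum_valP e; rewrite inE.
have [cs ct] := core_edge_ends md ce.
rewrite /= !enum_rankK_in ?inE //.
have [-> ->] := hm_ends hm (enum_val e); have := FP (te (enum_val e)).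
rewrite (hm_len hm) /m' !rmorphM /=; case: (fl _) => /= E.
  by rewrite rmorphN1 -opprB E; rewrite -pmulrn; ring.
by rewrite E -pmulrn; ring.
Qed.

(** * Contracting a modification *)

Lemma card_predID (T : finType) (P Q : pred T) :
  #|[pred x | P x]| = (#|[pred x | P x && Q x]| + #|[pred x | P x && ~~ Q x]|)%N.
Proof. by rewrite !card_sum1 (bigID Q). Qed.

Lemma card_inj_le (T U : finType) (P : pred T) (Q : pred U) (f : T -> U) :
  (forall x x', P x -> P x' -> f x = f x' -> x = x') -> (forall x, P x -> Q (f x)) ->
  (#|[pred x | P x]| <= #|[pred x | Q x]|)%N.
Proof.
move=> finj fPQ; have finj' : {in [pred x | P x] &, injective f}.
  by move=> x x'; rewrite !inE; exact: finj.
rewrite -(card_in_imset finj'); apply: subset_leq_card; apply/subsetP => z.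
by case/imsetP => x; rewrite !inE => Px ->; exact: fPQ.
Qed.

Section ModifContract.
Variables (n : nat) (H : graph n) (lam : 'I_(ne H) -> R).
Variables (G' : graph n) (l' : 'I_(ne G') -> R).
Variables (pos : 'I_(nv G') -> option (gpoint H)).
Variables (trk : 'I_(ne G') -> option (track H)) (ta tb : 'I_(ne G') -> R) (c : 'I_n -> R).
Hypothesis md : modif lam l' pos trk ta tb c.
Hypothesis lam_gt0 : forall e, 0 < lam e.
Variable v0 : 'I_(nv H).
Variable y : 'I_(ne G') -> R.
Hypothesis y_ge0 : forall e, 0 <= y e.

Definition newlen (k : track H) : R := \sum_(e | trk e == Some k) y e.

Variables (Hy : graph n) (phi : 'I_(nv H) -> 'I_(nv Hy)) (psi : 'I_(ne Hy) -> 'I_(ne H)).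
Hypothesis ctH : contraction (fun f => newlen (inl f) == 0) phi psi.
Variables (Gy : graph n) (phi' : 'I_(nv G') -> 'I_(nv Gy)) (psi' : 'I_(ne Gy) -> 'I_(ne G')).
Hypothesis ctG : contraction (fun e => y e == 0) phi' psi'.

Local Notation core := (core pos).
Local Notation core_edge := (core_edge trk).
Local Notation hlen := (tlen lam c).
Local Notation stop := (stop lam pos c).

Definition lamy (f : 'I_(ne Hy)) : R := newlen (inl (psi f)).
Definition ly (e : 'I_(ne Gy)) : R := y (psi' e).
Definition cy (i : 'I_n) : R := newlen (inr i).

Local Notation tpty := (tpt lamy).

(* The coordinate along track [k] once its tiles are given the new lengths [y]. *)
Definition newpos (k : track H) (t : R) : R := \sum_(e | (trk e == Some k) && (tb e <= t)) y e.

Lemma newpos_mono k t t' : t <= t' -> newpos k t <= newpos k t'.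
Proof.
move=> tt; rewrite /newpos [X in _ <= X](bigID (fun e => tb e <= t)) /=.
rewrite [X in X <= _](_ : _ = \sum_(e | (trk e == Some k) && (tb e <= t') && (tb e <= t)) y e).
  by rewrite lerDl sumr_ge0.
apply: eq_bigl => e; case: eqP => //= _; apply/idP/andP => [h|[]//].
by split=> //; apply: le_trans tt.
Qed.

Lemma newpos_ge0 k t : 0 <= newpos k t. Proof. exact: sumr_ge0. Qed.

Lemma newpos0 k : newpos k 0 = 0.
Proof.
apply: big1 => e /andP[/eqP/(md_tile md)[a0 ab _ _ _] b0]; exfalso; lra.
Qed.

Lemma newpos_end k t : hlen k <= t -> newpos k t = newlen k.
Proof.
move=> kt; apply: eq_bigl => e; case: eqP => //= /(md_tile md)[_ _ bL _ _]; lra.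
Qed.

Lemma newpos_le k t : newpos k t <= newlen k.
Proof.
case: (lerP t (hlen k)) => h; last by rewrite newpos_end // ltW.
by rewrite -(@newpos_end k (hlen k)) // newpos_mono.
Qed.

Lemma newpos_tile e k : trk e = Some k -> newpos k (tb e) = newpos k (ta e) + y e.
Proof.
move=> ke; have [_ ab _ _ _] := md_tile md ke.
rewrite /newpos (bigD1 e) /= ?ke ?eqxx ?lexx // addrC; congr (_ + _).
apply: eq_bigl => q; case: eqP => //= kq; apply/andP/idP.
  case=> h /eqP qe; have ke' : trk e == Some k by apply/eqP.
  by apply: (packed_before (track_packed md k)) => //; apply/eqP.
move=> h; split; first by lra.
by apply/eqP => qe; move: h; rewrite qe; lra.
Qed.

Lemma newlen_ge0 k : 0 <= newlen k. Proof. exact: sumr_ge0. Qed.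

Definition untrk (k : track Hy) : track H :=
  match k with inl f => inl (psi f) | inr i => inr i end.

Lemma untrk_tlen k : newlen (untrk k) = tlen lamy cy k.
Proof. by case: k. Qed.

(** Only edges can disappear: a leg remains a track even when its tiled part gets new length 0. *)
Definition retrk (k : track H) : option (track Hy) :=
  match k with
  | inl f => if [pick f' | psi f' == f] is Some f' then Some (inl f') else None
  | inr i => Some (inr i)
  end.

Lemma retrkP k k' : retrk k = Some k' <-> k = untrk k'.
Proof.
case: k => [f|i]; case: k' => [f'|i'] /=; split=> //; try by case: pickP.
- by case: pickP => // x /eqP <- [->].
- by move=> [->]; case: pickP => [x /eqP/(ct_inj ctH) -> //|/(_ f')]; rewrite eqxx.
- by move=> [->].
- by move=> [->].
Qed.

Lemma retrk_None k : retrk k = None -> exists2 f, k = inl f & newlen k = 0.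
Proof.
case: k => [f|i] //=; case: pickP => // none _; exists f => //.
apply/eqP; rewrite -[_ == _]negbK; apply/negP => /(ct_im ctH)[f' ff].
by have := none f'; rewrite ff eqxx.
Qed.

Definition npt (k : track H) (t : R) : gpoint Hy :=
  if retrk k is Some k' then tpty k' t else @GV _ Hy (phi (tstart k)).

Lemma npt_untrk k t : npt (untrk k) t = tpty k t.
Proof. by rewrite /npt ((retrkP _ _).2 (erefl _)). Qed.

Lemma tstart_untrk k : tstart k = phi (tstart (untrk k)).
Proof. by case: k => [f|i] /=; [exact: (ct_src ctH)|exact: (ct_leg ctH)]. Qed.

Lemma npt0 k : npt k 0 = @GV _ Hy (phi (tstart k)).
Proof.
rewrite /npt; case E: (retrk k) => [k'|] //.
by rewrite tpt0 tstart_untrk; have -> := (retrkP _ _).1 E.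
Qed.

Lemma lamy_gt0 f : 0 < lamy f.
Proof. by rewrite lt_neqAle newlen_ge0 andbT eq_sym; exact: (ct_psiZ ctH). Qed.

Lemma npt_edge_end f : npt (inl f) (newlen (inl f)) = @GV _ Hy (phi (etgt f)).
Proof.
case E: (retrk (inl f)) => [k'|].
  have kE := (retrkP _ _).1 E; rewrite kE npt_untrk.
  case: k' kE {E} => // f' [fE]; rewrite [newlen _]/(lamy f') tpt_edge_end //.
    by rewrite (ct_tgt ctH) fE.
  exact: lamy_gt0.
rewrite /npt E; congr GV; apply: (ct_edge ctH) => /=.
by have [_ _ ->] := retrk_None E.
Qed.

Lemma npt_valid k t : 0 <= t <= newlen k -> valid_point lamy (npt k t).
Proof.
move=> tin; rewrite /npt; case E: (retrk k) => [[f|i]|] //=; move: tin; rewrite ((retrkP _ _).1 E) /=.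
  rewrite -/(lamy f) /ptE => tin; case: eqP => // t0; case: eqP => //= t1.
  case/andP: tin => ta0 tb0; apply/andP; rewrite !lt_neqAle ta0 tb0 !andbT.
  by split; apply/eqP => // /esym.
by rewrite /ptL => /andP[t0 _]; case: eqP => //= t1; rewrite lt_neqAle t0 andbT; apply/eqP => /esym.
Qed.

Lemma npt_GV k t w : 0 <= t <= newlen k -> npt k t = @GV _ Hy w ->
  (t = 0 /\ w = phi (tstart k)) \/
  (exists f, [/\ k = inl f, t = newlen k & w = phi (etgt f)]).
Proof.
move=> tin; case E: (retrk k) => [k'|]; last first.
  have [f kf k0] := retrk_None E; rewrite k0 in tin.
  have -> : t = 0 by lra.
  by rewrite npt0 => -[<-]; left.
have kE := (retrkP _ _).1 E; rewrite /npt E; case: k' kE E => [f|i] /= kE E.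
  rewrite /ptE; case: eqP => [-> [<-]|t0]; first by left; rewrite kE /= (ct_src ctH).
  case: eqP => // -> [<-]; right; exists (psi f).
  by rewrite kE /= (ct_tgt ctH).
by rewrite /ptL; case: eqP => // -> [<-]; left; rewrite kE /= (ct_leg ctH).
Qed.

Lemma npt_tint k t k' t' : npt k t = tint k' t' -> k = untrk k' /\ t = t'.
Proof.
rewrite /npt; case E: (retrk k) => [k1|]; last by case: k'.
move=> h; have kE := (retrkP _ _).1 E; rewrite kE.
case: k1 {kE E} h => [f|i] /=.
  by rewrite /ptE; do 2 (case: eqP => [_|_]; first by case: k'); case: k' => // f' [-> ->].
by rewrite /ptL; case: eqP => [_|_]; case: k' => // f' [-> ->].
Qed.

Lemma npt_cases k t : (exists w, npt k t = @GV _ Hy w) \/ (exists k', npt k t = tint k' t).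
Proof.
rewrite /npt; case E: (retrk k) => [[f|i]|] /=.
- rewrite /ptE; do 2 (case: eqP => [_|_]; first by left; eexists).
  by right; exists (inl f).
- by rewrite /ptL; case: eqP => [_|_]; [left; eexists|right; exists (inr i)].
- by left; eexists.
Qed.

(** The value on tree vertices is a placeholder; wherever a tree may be crossed, [posf] is composed
    with the retraction onto the core. *)
Definition posf (u : 'I_(nv G')) : gpoint Hy :=
  match pos u with
  | Some (GV v) => @GV _ Hy (phi v)
  | Some (GE e t) => npt (inl e) (newpos (inl e) t)
  | Some (GL i t) => npt (inr i) (newpos (inr i) t)
  | None => @GV _ Hy (phi v0)
  end.

Lemma posf_GV u v : pos u = Some (@GV _ H v) -> posf u = @GV _ Hy (phi v).
Proof. by rewrite /posf => ->. Qed.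

Lemma posf_tpt u k t : 0 <= t <= hlen k -> pos u = Some (tpt lam k t) ->
  posf u = npt k (newpos k t).
Proof.
move=> tin; case: (t =P 0) => [->|t0]; first by rewrite tpt0 newpos0 npt0 => /posf_GV.
case: k tin => [e|i] /= tin.
  rewrite /posf /ptE; case: eqP => //= _; case: eqP => [tE|_] -> //.
  by rewrite newpos_end ?tE //= npt_edge_end.
by rewrite /posf /ptL; case: eqP => //= _ ->.
Qed.

Lemma posf_stop u k t : stop k t -> pos u = Some (tpt lam k t) -> posf u = npt k (newpos k t).
Proof. by move=> [tin _]; exact: posf_tpt. Qed.

Lemma newpos_in k t : 0 <= newpos k t <= newlen k.
Proof. by rewrite newpos_ge0 newpos_le. Qed.

Lemma tile_y0 e k t1 t2 : trk e = Some k -> t1 <= ta e -> tb e <= t2 ->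
  newpos k t1 = newpos k t2 -> y e = 0.
Proof.
move=> ke h1 h2 eqN; have := newpos_tile ke.
have := newpos_mono k h1; have := newpos_mono k h2; have := y_ge0 e; lra.
Qed.

(** New coordinates are monotone along a track, so equal values at two stops force every tile
    between them to be contracted. *)
Lemma chain_y0 k t1 t2 u1 u2 : stop k t1 -> stop k t2 -> t1 <= t2 ->
  pos u1 = Some (tpt lam k t1) -> pos u2 = Some (tpt lam k t2) ->
  newpos k t1 = newpos k t2 -> phi' u1 = phi' u2.
Proof.
move=> s1 s2 le12 p1 p2 eqN; apply: (track_chain md s1 s2 le12 p1 p2) => e ke h1 h2.
by apply: (ct_edge ctG); apply/eqP; exact: tile_y0 ke h1 h2 eqN.
Qed.

Variable vat : 'I_(nv H) -> 'I_(nv G').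
Hypothesis vatP : forall v, pos (vat v) = Some (@GV _ H v).

Lemma vat_start k : pos (vat (tstart k)) = Some (tpt lam k 0).
Proof. by rewrite vatP tpt0. Qed.

Lemma vat_end f : pos (vat (etgt f)) = Some (tpt lam (inl f) (lam f)).
Proof. by rewrite vatP tpt_edge_end. Qed.

Lemma vat_phi v v' : phi v = phi v' -> phi' (vat v) = phi' (vat v').
Proof.
move/(ct_fib ctH); apply: (connect_cadj_const (f := phi' \o vat)) => f /eqP f0 /=.
have := chain_y0 (stop0 md lam_gt0 (inl f)) (stop_edge_end md lam_gt0 f) (ltW (lam_gt0 f))
  (vat_start (inl f)) (vat_end f).
by apply; rewrite newpos0 newpos_end.
Qed.

Lemma posf_GV_inv u v p : pos u = Some p -> posf u = @GV _ Hy (phi v) -> phi' u = phi' (vat v).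
Proof.
move=> pu; case: (core_cases md pu) => [[v' pv]|[k [t [_ pk tin st]]]].
  rewrite pv in pu; rewrite (posf_GV pu) => -[vv].
  by rewrite (md_inj md pu (vatP v')); exact: vat_phi.
rewrite pk in pu; rewrite (posf_stop st pu) => /(npt_GV (newpos_in k t)).
have t0 : 0 <= t by lra.
case=> [[N0 vv]|[f [kf NL vv]]].
  rewrite (vat_phi vv); apply/esym.
  by apply: (chain_y0 (stop0 md lam_gt0 k) st t0 (vat_start k) pu); rewrite newpos0.
rewrite (vat_phi vv); move: st pu NL tin; rewrite kf => st pu NL tin.
apply: (chain_y0 st (stop_edge_end md lam_gt0 f) _ pu (vat_end f)).
  by rewrite /= in tin; lra.
by rewrite NL newpos_end.
Qed.

Lemma posf_inj u1 u2 : core u1 -> core u2 -> posf u1 = posf u2 -> phi' u1 = phi' u2.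
Proof.
rewrite /core; case p1: (pos u1) => [q1|] // _; case p2: (pos u2) => [q2|] // _ eqp.
have GVcase w : posf u1 = @GV _ Hy w -> phi' u1 = phi' u2.
  have [v vw] := ct_surj ctH w; rewrite -vw => h.
  by rewrite (posf_GV_inv p1 h); rewrite eqp in h; rewrite (posf_GV_inv p2 h).
case: (core_cases md p1) => [[v pv]|[k1 [t1 [_ pk1 _ st1]]]].
  by apply: (GVcase (phi v)); apply: posf_GV; rewrite p1 pv.
case: (core_cases md p2) => [[v pv]|[k2 [t2 [_ pk2 _ st2]]]].
  by apply: (GVcase (phi v)); rewrite eqp; apply: posf_GV; rewrite p2 pv.
rewrite pk1 in p1; rewrite pk2 in p2.
move: eqp; rewrite (posf_stop st1 p1) (posf_stop st2 p2) => eqp.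
case: (npt_cases k1 (newpos k1 t1)) => [[w hw]|[k' hk']].
  by apply: (GVcase w); rewrite (posf_stop st1 p1).
have [e1 _] := npt_tint hk'; rewrite eqp in hk'; have [e2 e3] := npt_tint hk'.
move: st2 p2 e3; rewrite e2 -e1 => st2 p2 e3.
case: (lerP t1 t2) => h.
  exact: (chain_y0 st1 st2 h p1 p2).
by apply/esym; apply: (chain_y0 st2 st1 (ltW h) p2 p1).
Qed.

(** A contracted path may run through attached trees. The retraction brings it back to the core,
    where tiles of new length 0 leave the new coordinate unchanged. *)
Lemma posf_fiber u1 u2 : core u1 -> core u2 -> phi' u1 = phi' u2 -> posf u1 = posf u2.
Proof.
move=> c1 c2 /(ct_fib ctG) cc; have [rho [rc _ re]] := core_retraction md v0.
rewrite -(rc _ c1) -(rc _ c2).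
apply: (connect_cadj_const (f := posf \o rho) _ cc) => e /eqP y0 /=.
case ce: (core_edge e); last by rewrite re // ce.
have [cs ct] := core_edge_ends md ce; rewrite !rc //.
move: ce; rewrite /core_edge; case ke: (trk e) => [k|] // _.
have [sa sb] := tile_stops md ke; have := newpos_tile ke; rewrite y0 addr0 => eqN.
have [_ _ _ _ ends] := md_tile md ke.
by case: ends => -[ps pt]; rewrite ?(posf_stop sa ps) ?(posf_stop sb pt) ?(posf_stop sb ps) ?(posf_stop sa pt) eqN.
Qed.

(** A contracted class lies on the new core as soon as one member is a core vertex, and [posf_fiber]
    makes the choice of that member harmless. *)
Definition posy (C : 'I_(nv Gy)) : option (gpoint Hy) :=
  if [pick u | core u && (phi' u == C)] is Some u then Some (posf u) else None.

Lemma posyE u : core u -> posy (phi' u) = Some (posf u).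
Proof.
move=> cu; rewrite /posy; case: pickP => [u' /andP[cu' /eqP uu]|/(_ u)].
  by rewrite (posf_fiber cu' cu uu).
by rewrite cu eqxx.
Qed.

Lemma posyP C p : posy C = Some p -> exists u, [/\ core u, phi' u = C & p = posf u].
Proof. by rewrite /posy; case: pickP => // u /andP[cu /eqP uC] [<-]; exists u. Qed.

Definition trky (e : 'I_(ne Gy)) : option (track Hy) := obind retrk (trk (psi' e)).

Lemma trkyP e k : trky e = Some k <-> trk (psi' e) = Some (untrk k).
Proof.
rewrite /trky; case: (trk (psi' e)) => [k0|] //=; rewrite retrkP.
by split=> [->|[]].
Qed.

Definition tay (e : 'I_(ne Gy)) : R :=
  if trk (psi' e) is Some k then newpos k (ta (psi' e)) else 0.
Definition tby (e : 'I_(ne Gy)) : R :=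
  if trk (psi' e) is Some k then newpos k (tb (psi' e)) else 0.

Lemma core_legv i : core (legv G' i).
Proof. by rewrite /core (md_leg md). Qed.

Lemma ly_gt0 e : 0 < ly e.
Proof. by rewrite lt_neqAle y_ge0 andbT eq_sym; exact: (ct_psiZ ctG). Qed.

(** A surviving tile has positive new length, so the track that contains it cannot vanish. *)
Lemma trky_core e : isSome (trky e) = core_edge (psi' e).
Proof.
rewrite /trky /core_edge; case ke: (trk (psi' e)) => [k|] //=.
case E: (retrk k) => [k'|] //; exfalso.
have [f _] := retrk_None E; rewrite /newlen (bigD1 (psi' e)) /= ?ke //.
have := ly_gt0 e; rewrite /ly.
suff : 0 <= \sum_(i | (trk i == Some k) && (i != psi' e)) y i by lra.
exact: sumr_ge0.
Qed.

Lemma modif_contract_tile e k : trky e = Some k ->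
  [/\ 0 <= tay e, tay e < tby e, tby e <= tlen lamy cy k, ly e = tby e - tay e &
   (posy (esrc e) = Some (tpty k (tay e)) /\ posy (etgt e) = Some (tpty k (tby e)))
   \/ (posy (esrc e) = Some (tpty k (tby e)) /\ posy (etgt e) = Some (tpty k (tay e)))].
Proof.
move=> /trkyP ke; have Nt := newpos_tile ke; have lp := ly_gt0 e.
rewrite /tay /tby ke -untrk_tlen -!npt_untrk newpos_ge0 newpos_le; split=> //.
- by move: lp; rewrite /ly; lra.
- by rewrite /ly; lra.
have ce : core_edge (psi' e) by rewrite /core_edge ke.
have [cs ct] := core_edge_ends md ce.
rewrite (ct_src ctG) (ct_tgt ctG) !posyE //.
have [sa sb] := tile_stops md ke.
have [_ _ _ _ [[ps pt]|[ps pt]]] := md_tile md ke; [left|right].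
  by rewrite (posf_stop sa ps) (posf_stop sb pt).
by rewrite (posf_stop sb ps) (posf_stop sa pt).
Qed.

Lemma modif_contract_on C k t : posy C = Some (tint k t) ->
  exists2 e, trky e = Some k & tay e = t \/ tby e = t.
Proof.
move=> pC; have [u [cu _ pu]] := posyP pC.
move: cu; rewrite /core; case q: (pos u) => [p|] // _.
case: (core_cases md q) => [[v pv]|[k0 [s [_ pk _ st]]]].
  by rewrite pv in q; move: pu; rewrite (posf_GV q); case: (k).
rewrite pk in q; move: (pu); rewrite (posf_stop st q) => /esym/npt_tint[k0E Ns].
have t0 : 0 < t.
  have := npt_valid (newpos_in k0 s); rewrite -(posf_stop st q) -pu.
  by case: (k) => //= f /andP[].
(* The required tile is the last one before [s] with positive new length: the tiles between it and
   [s] do not move the new coordinate. *)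
pose Q e0 := (trk e0 == Some k0) && (tb e0 <= s) && (0 < y e0).
have [e0 e0P] : exists e0, Q e0.
  case: (pickP Q) => [e0|none]; first by exists e0.
  move: t0; rewrite -Ns /newpos big1 ?ltxx // => e /andP[h1 h2].
  by have := none e; rewrite /Q h1 h2 /= => /negbT; have := y_ge0 e; lra.
case: (@arg_maxP _ _ _ e0 Q tb e0P) => e /andP[/andP[/eqP ke bs] ye] emax.
have nZ : ~~ (y e == 0) by rewrite gt_eqF.
have [e' eE] := (ct_im ctG e).1 nZ.
exists e'; first by apply/trkyP; rewrite eE -k0E.
right; rewrite /tby eE ke -Ns /newpos.
rewrite [RHS](bigID (fun q => tb q <= tb e)) /= [X in _ = _ + X]big1 ?addr0.
  apply: eq_bigl => x; case: (trk x == Some k0) => //=; apply/idP/andP => [h|[]//].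
  by split=> //; apply: le_trans bs.
move=> x /andP[/andP[h1 h2] h3]; have := y_ge0 x.
case: (ltP 0 (y x)) => [h|]; last by lra.
by have := emax x; rewrite /Q h1 h2 h => /(_ isT) /= h4; rewrite h4 in h3.
Qed.

Lemma core_vat v : core (vat v).
Proof. by rewrite /core vatP. Qed.

Lemma posy_vat v : posy (phi' (vat v)) = Some (@GV _ Hy (phi v)).
Proof. by rewrite posyE ?core_vat // (posf_GV (vatP v)). Qed.

Lemma posy_inj C1 C2 p : posy C1 = Some p -> posy C2 = Some p -> C1 = C2.
Proof.
by move=> /posyP[u1 [c1 <- ->]] /posyP[u2 [c2 <- pp]]; apply: posf_inj.
Qed.

Lemma gvert_vat u v : gvert pos u = Some v -> u = vat v.
Proof. by move=> /gvertP pu; exact: (md_inj md pu (vatP v)). Qed.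

(** One tile chosen on each edge of [H]; deleting it opens the edge, so that no cycle of [H] is
    counted in the bounds below. *)
Lemma tile_on_edge : exists kap : 'I_(ne H) -> 'I_(ne G'), forall f, trk (kap f) = Some (inl f).
Proof.
suff h f : exists e, trk e = Some (inl f) by exact: (fin_all_exists h).
by have [e /eqP ke _] := tiling_first (track_tiling md (inl f)) (lam_gt0 f); exists e.
Qed.

Section LocalGenus.
Variable v1 : 'I_(nv H).
Let w := phi v1.
Let C := phi' (vat v1).
Variable kap : 'I_(ne H) -> 'I_(ne G').
Hypothesis kapP : forall f, trk (kap f) = Some (inl f).

Let kap_inj : injective kap.
Proof. by move=> f f' ff; have := kapP f; rewrite ff kapP => -[]. Qed.

Let Zw f := (newlen (inl f) == 0) && (phi (esrc f) == w).
(* Removing one tile from each contracted edge leaves every point of the fiber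
   joined to a vertex of [H], which bounds the cycle rank of the fiber from below. *)
Let removed e := [exists f, Zw f && (kap f == e)].
Let A := [pred u | (phi' u == C) && ~~ isSome (gvert pos u)].
Let S := [pred e | ((y e == 0) && (phi' (esrc e) == C)) && ~~ removed e].

Let tile_src_fiber e k : trk e = Some k -> y e = 0 -> forall t u, stop k t ->
  pos u = Some (tpt lam k t) -> newpos k t = newpos k (ta e) -> phi' (esrc e) = phi' u.
Proof.
move=> ke y0 t u st pu Nt; have [sa sb] := tile_stops md ke.
have Nb := newpos_tile ke; rewrite y0 addr0 in Nb.
have same t1 u1 : stop k t1 -> pos u1 = Some (tpt lam k t1) -> newpos k t1 = newpos k t -> phi' u1 = phi' u.
  move=> s1 p1 N1; case: (lerP t1 t) => h; first exact: (chain_y0 s1 st h p1 pu).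
  by apply/esym; apply: (chain_y0 st s1 (ltW h) pu p1).
have [_ _ _ _ [[ps _]|[ps _]]] := md_tile md ke; first by apply: (same _ _ sa ps).
by apply: (same _ _ sb ps); rewrite Nb.
Qed.

Let local_inj (F : fieldType) (f : 'I_(nv G') -> F) :
  (forall u, u \notin A -> f u = 0) -> (forall e, e \in S -> f (esrc e) = f (etgt e)) ->
  forall u, f u = 0.
Proof.
move=> f0 fS.
have fvat v : f (vat v) = 0 by apply: f0; rewrite !inE /gvert vatP andbF.
have core0 u : core u -> f u = 0.
  rewrite /core; case pu: (pos u) => [p|] // _.
  case: (boolP (u \in A)) => [|/f0 //]; rewrite !inE => /andP[/eqP uC ngv].
  case: (core_cases md pu) => [[v pv]|[k [t [_ pk tin st]]]].
    by move: ngv; rewrite /gvert pu pv.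
  rewrite pk in pu; clear pk.
  have cu : core u by rewrite /core pu.
  (* As [u] is contracted together with a vertex of [H], its new coordinate is 0 or the full new
     length of the track; all tiles up to that end have new length 0. *)
  have := posf_fiber cu (core_vat v1) uC; rewrite (posf_stop st pu) (posf_GV (vatP v1)) => /(npt_GV (newpos_in k t)) cases.
  have t0 : 0 <= t by lra.
  have inS t1 t2 e : trk e = Some k -> t1 <= ta e -> tb e <= t2 -> newpos k t1 = newpos k t2 ->
      newpos k t1 = newpos k t -> ~~ removed e -> f (esrc e) = f (etgt e).
    move=> ke h1 h2 N12 N1 nr; apply: fS; rewrite !inE nr andbT.
    have ye := tile_y0 ke h1 h2 N12; rewrite ye eqxx /= -uC; apply/eqP.
    apply: (tile_src_fiber ke ye st pu).
    have := newpos_mono k h1; have := newpos_mono k h2; have := newpos_tile ke.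
    by lra.
  have forward : newpos k t = 0 -> (forall e, trk e = Some k -> tb e <= t -> ~~ removed e) -> f u = 0.
    move=> N0 nr; rewrite -(fvat (tstart k)); apply/esym.
    apply: (track_chain md (stop0 md lam_gt0 k) st t0 (vat_start k) pu) => e ke h1 h2.
    by apply: (inS 0 t) => //; rewrite ?newpos0 ?N0 //; exact: nr.
  have backward fe : k = inl fe -> newpos k t = newlen k ->
      (forall e, trk e = Some k -> t <= ta e -> ~~ removed e) -> f u = 0.
    move=> kf NL nr; rewrite -(fvat (etgt fe)); move: (vat_end fe); rewrite -kf => pe.
    have tL : t <= lam fe by have [/andP[_ +] _] := st; rewrite kf.
    have se : stop k (lam fe) by rewrite kf; exact: (stop_edge_end md lam_gt0).
    have Ne : newpos k (lam fe) = newlen k by rewrite newpos_end // kf.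
    apply: (track_chain md st se tL pu pe) => e ke h1 h2.
    by apply: (inS t (lam fe)) => //; rewrite ?NL ?Ne //; exact: nr.
  have nrm_leg i e : k = inr i -> trk e = Some k -> ~~ removed e.
    by move=> -> ke; apply/existsP => -[f' /andP[_ /eqP fe]]; move: ke; rewrite -fe kapP.
  have nrm_edge fe e : k = inl fe -> newlen k != 0 -> trk e = Some k -> ~~ removed e.
    move=> kf nz ke; apply/existsP => -[f' /andP[/andP[/eqP z _] /eqP fE]].
    by move: ke; rewrite -fE kapP => -[kE]; move: nz; rewrite -kE z eqxx.
  case kE: k => [fe|i]; last first.
    case: cases => [[N0 _]|[fe [kf _ _]]]; last by move: kf; rewrite kE.
    by apply: forward => // e ke _; exact: nrm_leg kE ke.
  case: (eqVneq (newlen k) 0) => [z|nz]; last first.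
    case: cases => [[N0 _]|[fe' [kf NL _]]].
      by apply: forward => // e ke _; exact: nrm_edge kE nz ke.
    by apply: (backward fe') => // e ke _; exact: nrm_edge kE nz ke.
  have N0 : newpos k t = 0 by have := newpos_in k t; rewrite z => h; lra.
  have nrm e : trk e = Some k -> e <> kap fe -> ~~ removed e.
    move=> ke ne; apply/existsP => -[f' /andP[_ /eqP fE]].
    by move: ke; rewrite -fE kapP kE => -[ff]; apply: ne; rewrite -fE ff.
  (* The contracted edge has lost the tile [kap fe], so [u] is joined to the endpoint on its own
     side of that tile. *)
  have kk : trk (kap fe) = Some k by rewrite kapP kE.
  have [_ abk _ _ _] := md_tile md kk.
  case: (stop_outside_tile md st kk) => h.
    apply: forward => // e ke be; apply: nrm => // eE.
    by rewrite eE in be; have := lt_le_trans (le_lt_trans h abk) be; rewrite ltxx.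
  apply: (backward fe) => //; first by rewrite N0.
  move=> e ke be; apply: nrm => // eE.
  by rewrite eE in be; have := le_lt_trans (le_trans h be) abk; rewrite ltxx.
move=> u; case: (boolP (u \in A)) => [|/f0 //]; rewrite !inE => /andP[/eqP uC _].
rewrite -(fvat v1); apply: (connect_cadj_const (f := f) _ ((ct_fib ctG _ _).1 uC)) => e y0.
case ce: (core_edge e).
  by have [cs ct] := core_edge_ends md ce; rewrite !core0.
case sC: (phi' (esrc e) == C).
  apply: fS; rewrite !inE y0 sC /=; apply/existsP => -[f' /andP[_ /eqP fE]].
  by move: ce; rewrite /core_edge -fE kapP.
by rewrite !f0 // !inE -?(ct_edge ctG y0) sC.
Qed.

(** By [ct_gw] a genus is a fibre genus plus edges minus vertices plus 1. The other fibre vertices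
    are bounded by the unremoved edges, the vertices of [H] in the fibre lie over [w], and the
    removed edges represent all edges of [H] contracted to [w]. *)
Lemma local_genus_le : (gw w <= gw C)%N.
Proof.
have cAS := potential_inj_card (local_inj (F := rat)).
have gC := ct_gw ctG C; have gW := ct_gw ctH w.
have c1 := card_predID (fun u => phi' u == C) (fun u => isSome (gvert pos u)).
have c2 := card_predID (fun e => (y e == 0) && (phi' (esrc e) == C)) removed.
have c3 : (#|[pred u | (phi' u == C) && isSome (gvert pos u)]| <= #|[pred v | phi v == w]|)%N.
  have [g gP] : exists g : 'I_(nv G') -> 'I_(nv H), forall u v, gvert pos u = Some v -> g u = v.
    by exists (fun u => odflt v1 (gvert pos u)) => u v ->.
  apply: (card_inj_le (f := g)) => [u u'|u].
    case E: (gvert pos u) => [v|]; rewrite ?andbF // => _.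
    case E': (gvert pos u') => [v'|]; rewrite ?andbF // => _.
    by rewrite (gP _ _ E) (gP _ _ E') (gvert_vat E) (gvert_vat E') => ->.
  case E: (gvert pos u) => [v|]; rewrite ?andbF // (gP _ _ E) => /andP[/eqP uC _].
  move: uC; rewrite (gvert_vat E) => uC; apply/eqP.
  by have := posy_vat v; rewrite uC posy_vat => -[].
have c4 : (#|[pred f | Zw f]| <= #|[pred e | ((y e == 0%R) && (phi' (esrc e) == C)) && removed e]|)%N.
  apply: (card_inj_le (f := kap)) => [f f' _ _|f Zf]; first exact: kap_inj.
  apply/andP; split; last by apply/existsP; exists f; rewrite Zf eqxx.
  have /andP[/eqP z /eqP pw] := Zf.
  have [a0 ab bL _ _] := md_tile md (kapP f).
  have ye : y (kap f) = 0.
    apply: (tile_y0 (kapP f) a0 bL).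
    by rewrite newpos0 newpos_end.
  rewrite ye eqxx /=; apply/eqP.
  rewrite (tile_src_fiber (kapP f) ye (stop0 md lam_gt0 (inl f)) (vat_start (inl f))).
    exact: vat_phi.
  have := newpos_in (inl f) (ta (kap f)); rewrite z newpos0 => h; lra.
have c5 : (\sum_(v | phi v == w) gw v <= \sum_(u | phi' u == C) gw u)%N.
  have -> : (\sum_(v | phi v == w) gw v = \sum_(u | (phi' u == C) && isSome (gvert pos u)) gw u)%N.
    rewrite [RHS](reindex_omap vat (gvert pos)) /=.
      apply: eq_big => v; last by rewrite (md_gw md) vatP.
      rewrite /gvert vatP eqxx !andbT; apply/eqP/eqP => [vw|uC]; first exact: vat_phi.
      by have := posy_vat v; rewrite uC posy_vat => -[].
    move=> u /andP[_]; case E: (gvert pos u) => [v|] // _ /=.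
    by rewrite (gvert_vat E).
  by rewrite [X in (_ <= X)%N](bigID (fun u => isSome (gvert pos u))) /= leq_addr.
have arith (gw' gC' a a1 a2 s sg e e1 e2 vw f : nat) :
  (a2 <= e2 -> gC' + a = sg + e + 1 -> gw' + vw = s + f + 1 -> a = a1 + a2 -> e = e1 + e2 ->
   a1 <= vw -> f <= e1 -> s <= sg -> gw' <= gC')%N by lia.
exact: (arith _ _ _ _ _ _ _ _ _ _ _ _ cAS gC gW c1 c2 c3 c4 c5).
Qed.

End LocalGenus.

Lemma new_tile_on_edge : exists kapy : 'I_(ne Hy) -> 'I_(ne Gy), forall f, trky (kapy f) = Some (inl f).
Proof.
suff h f : exists e, trky e = Some (inl f) by exact: (fin_all_exists h).
case: (pickP (fun e => (trk e == Some (inl (psi f))) && (y e != 0))) => [e /andP[/eqP ke ye]|none].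
  by have [e' eE] := (ct_im ctG e).1 ye; exists e'; apply/trkyP; rewrite eE.
have := lamy_gt0 f; rewrite /lamy /newlen big1 ?ltxx // => e ke.
by have := none e; rewrite ke /= => /negbFE/eqP.
Qed.

Lemma trky_ends e : isSome (trky e) -> isSome (posy (esrc e)) /\ isSome (posy (etgt e)).
Proof.
rewrite trky_core => ce; have [cs ct] := core_edge_ends md ce.
by rewrite (ct_src ctG) (ct_tgt ctG) !posyE.
Qed.

Lemma Gy_connected : connected Gy.
Proof. exact: (ct_connected ctG (md_conn md)). Qed.

(** Grounding the new core gives one half of the count required of a modification;
    [core_card_le_new] gives the half inside the core. *)
Lemma noncore_card_le_new : (#|[pred C | ~~ isSome (posy C)]| <= #|[pred e | ~~ isSome (trky e)]|)%N.
Proof.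
apply: (@potential_inj_card rat _ _ (@esrc _ Gy) (@etgt _ Gy)) => f f0 fS C.
rewrite (connected_const (f := f) Gy_connected _ C (phi' (vat v0))).
  by apply: f0; rewrite inE posy_vat.
move=> e; case ce: (isSome (trky e)); last by apply: fS; rewrite inE ce.
by have [cs ct] := trky_ends ce; rewrite !f0 // inE ?cs ?ct.
Qed.

(** The vertices of [Hy] are grounded and one surviving tile is deleted on each edge of [Hy]; every
    other core vertex stays joined to a grounded one. *)
Lemma core_card_le_new :
  (#|[pred C | isSome (posy C)]| + ne Hy <= #|[pred e | isSome (trky e)]| + nv Hy)%N.
Proof.
have [kapy kapyP] := new_tile_on_edge.
pose removed e := [exists f, kapy f == e].
have c1 := card_predID (fun C => isSome (posy C)) (fun C => isSome (gvert posy C)).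
have c2 := card_predID (fun e => isSome (trky e)) removed.
have c3 : (#|[pred C | isSome (posy C) && isSome (gvert posy C)]| <= nv Hy)%N.
  rewrite -[X in (_ <= X)%N]card_ord.
  pose g C := odflt (phi v0) (gvert posy C).
  apply: (card_inj_le (f := g) (Q := predT)) => // C C' /andP[_ h] /andP[_ h'].
  rewrite /g; case E: (gvert posy C) h => [v|] // _; case E': (gvert posy C') h' => [v'|] // _ /= vv.
  move: E E' => /gvertP E /gvertP E'; rewrite -vv in E'; exact: posy_inj E E'.
have c4 : (ne Hy <= #|[pred e | isSome (trky e) && removed e]|)%N.
  rewrite -[X in (X <= _)%N]card_ord.
  apply: (card_inj_le (f := kapy) (P := predT)) => [f f' _ _ ff|f _].
    by have := kapyP f; rewrite ff kapyP => -[].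
  by rewrite kapyP; apply/existsP; exists f.
suff c5 : (#|[pred C | isSome (posy C) && ~~ isSome (gvert posy C)]| <=
    #|[pred e | isSome (trky e) && ~~ removed e]|)%N.
  have arith (cv cv1 cv2 ce ce1 ce2 he hv : nat) : (cv = cv1 + cv2 -> ce = ce1 + ce2 ->
    cv1 <= hv -> he <= ce1 -> cv2 <= ce2 -> cv + he <= ce + hv)%N by lia.
  exact: (arith _ _ _ _ _ _ _ _ c1 c2 c3 c4 c5).
apply: (@potential_inj_card rat _ _ (@esrc _ Gy) (@etgt _ Gy)) => f f0 fS C.
have fvat v : f (phi' (vat v)) = 0 by apply: f0; rewrite !inE /gvert posy_vat.
case: (boolP (C \in [pred C | isSome (posy C) && ~~ isSome (gvert posy C)])) => [|/f0 //].
rewrite !inE => /andP[pC ngv].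
have {pC}[p pC] : exists p, posy C = Some p by case: (posy C) pC => // p _; exists p.
have [u [cu uC pE]] := posyP pC; rewrite -uC.
move: cu; rewrite /core; case pu: (pos u) => [q|] // _.
case: (core_cases md pu) => [[v pv]|[k [t [_ pk tin st]]]].
  by rewrite pv in pu; move: ngv; rewrite /gvert pC pE (posf_GV pu).
rewrite pk in pu; clear pk.
have [k' kE] : exists k', k = untrk k'.
  move: ngv; rewrite /gvert pC pE (posf_stop st pu).
  case: (npt_cases k (newpos k t)) => [[w ->] //|[k' hk] _].
  by exists k'; have [] := npt_tint hk.
have t0 : 0 <= t by lra.
have step e : trk e = Some k -> (forall f', k' = inl f' -> e <> psi' (kapy f')) ->
    f (phi' (esrc e)) = f (phi' (etgt e)).
  move=> ke nk; case: (eqVneq (y e) 0) => [y0|ny].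
    by rewrite (ct_edge ctG) // y0.
  have [e' eE] := (ct_im ctG e).1 ny; rewrite -eE -(ct_src ctG) -(ct_tgt ctG).
  have ke' : trky e' = Some k' by apply/trkyP; rewrite eE ke kE.
  apply: fS; rewrite !inE ke' /=; apply/existsP => -[f' /eqP fE].
  have kf : k' = inl f' by have := kapyP f'; rewrite fE ke' => -[].
  by apply: (nk f' kf); rewrite fE.
have forward : (forall e f', trk e = Some k -> tb e <= t -> k' = inl f' -> e <> psi' (kapy f')) ->
    f (phi' u) = 0.
  move=> nr; rewrite -(fvat (tstart k)); apply/esym.
  apply: (track_chain md (f := f \o phi') (stop0 md lam_gt0 k) st t0 (vat_start k) pu) => e ke h1 h2 /=.
  by apply: step => // f' kf; apply: nr.
case k'E: k' => [f'|i]; last by apply: forward => e f' _ _; rewrite k'E.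
have kf : k = inl (psi f') by rewrite kE k'E.
have kk : trk (psi' (kapy f')) = Some k by rewrite kE k'E; apply/trkyP; exact: kapyP.
have [_ abk _ _ _] := md_tile md kk.
case: (stop_outside_tile md st kk) => h.
  apply: forward => e f1 ke be; rewrite k'E => -[<-] eE.
  by rewrite eE in be; have := lt_le_trans (le_lt_trans h abk) be; rewrite ltxx.
rewrite -(fvat (etgt (psi f'))).
move: (vat_end (psi f')); rewrite -kf => pe.
have tL : t <= lam (psi f') by have [/andP[_ +] _] := st; rewrite kf.
have se : stop k (lam (psi f')) by rewrite kf; exact: (stop_edge_end md lam_gt0).
apply: (track_chain md (f := f \o phi') st se tL pu pe) => e ke be _ /=.
apply: step => // f1; rewrite k'E => -[<-] eE.
by rewrite eE in be; have := le_lt_trans (le_trans h be) abk; rewrite ltxx.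
Qed.

(* The local genus bounds are equalities because both curves keep their total genus. *)
Lemma new_gw_count :
  (forall C, gw C = match posy C with Some (GV w) => gw w | _ => 0%N end) /\
  (ne Gy + #|[pred C | isSome (posy C)]| = nv Gy + #|[pred e | isSome (trky e)]|)%N.
Proof.
pose ex C : nat := match posy C with Some (GV w) => gw w | _ => 0%N end.
have [kap kapP] := tile_on_edge.
have exle C : (ex C <= gw C)%N.
  rewrite /ex; case pC: (posy C) => [[w|? ?|? ?]|] //.
  have [v vw] := ct_surj ctH w; rewrite -vw in pC *.
  by rewrite -(posy_inj (posy_vat v) pC); exact: local_genus_le kapP.
have [sec secP] := fin_all_exists (ct_surj ctH).
have exsum : (\sum_C ex C = \sum_(w : 'I_(nv Hy)) gw w)%N.
  rewrite (bigID (fun C => isSome (gvert posy C))) /= [X in (_ + X)%N]big1 ?addn0; last first.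
    by move=> C; rewrite /ex /gvert; case: (posy C) => // -[].
  rewrite (reindex_omap (fun w => phi' (vat (sec w))) (gvert posy)) /=.
    apply: eq_big => [w|w _]; rewrite /ex /gvert posy_vat secP ?eqxx //.
  move=> C; case E: (gvert posy C) => [w|] // _ /=; congr Some.
  by apply: (posy_inj (posy_vat (sec w))); rewrite secP; exact/gvertP.
have sumle : (\sum_C ex C <= \sum_(C : 'I_(nv Gy)) gw C)%N.
  by apply: leq_sum => i _; exact: exle.
have nc := noncore_card_le_new; have cc := core_card_le_new.
have g1 := ct_genus ctG; have g2 := ct_ne ctG; have g3 := ct_genus ctH; have g4 := ct_ne ctH.
have g5 := modif_genus_le md.
have cV := card_predID xpredT (fun C => isSome (posy C)).
have cE := card_predID xpredT (fun e => isSome (trky e)).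
have cV' : #|[pred x : 'I_(nv Gy) | xpredT x]| = nv Gy by rewrite -[RHS]card_ord; apply: eq_card.
have cE' : #|[pred x : 'I_(ne Gy) | xpredT x]| = ne Gy by rewrite -[RHS]card_ord; apply: eq_card.
have arith (sx sg sgH sg0 sgH0 ncV ncE cVn cEn NV NE hv he nv' ne' nvH neH Z Z' NV' NE' : nat) :
  (sx = sgH -> sx <= sg -> ncV <= ncE -> cVn + he <= cEn + hv ->
   sg + nv' = sg0 + Z' + NV -> NE + Z' = ne' -> sgH + nvH = sgH0 + Z + hv -> he + Z = neH ->
   ne' + nvH + sg0 <= nv' + neH + sgH0 -> NV' = cVn + ncV -> NE' = cEn + ncE -> NV' = NV -> NE' = NE ->
   sg <= sx /\ NE + cVn = NV + cEn)%N by lia.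
have [sgle count] := arith _ _ _ _ _ _ _ _ _ _ _ _ _ _ _ _ _ _ _ _ _
  exsum sumle nc cc g1 g2 g3 g4 g5 cV cE cV' cE'.
split=> // C; apply/eqP; rewrite eqn_leq [X in _ && X](exle C) andbT -/(ex C).
move: sgle; rewrite (bigD1 C) //= [X in (_ <= X)%N](bigD1 C) //=.
have : (\sum_(i | i != C) ex i <= \sum_(i | i != C) gw i)%N by apply: leq_sum => i _; exact: exle.
have arith2 (p q r s : nat) : (p <= q -> r + q <= s + p -> r <= s)%N by lia.
exact: arith2.
Qed.

Lemma modif_contract : modif lamy ly posy trky tay tby cy.
Proof.
have [gwC count] := new_gw_count.
split=> //.
- exact: ly_gt0.
- move=> C p /posyP[u [cu _ ->]]; move: cu; rewrite /core; case pu: (pos u) => [q|] // _.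
  case: (core_cases md pu) => [[v pv]|[k [t [_ pk tin st]]]].
    by rewrite pv in pu; rewrite (posf_GV pu).
  by rewrite pk in pu; rewrite (posf_stop st pu); apply: npt_valid; exact: newpos_in.
- exact: posy_inj.
- by move=> w; have [v <-] := ct_surj ctH w; exists (phi' (vat v)); exact: posy_vat.
- exact: modif_contract_tile.
- move=> k e1 e2 ne12 /trkyP k1 /trkyP k2; rewrite /tay /tby k1 k2.
  have ne12' : psi' e1 <> psi' e2 by move/(ct_inj ctG).
  by case: (md_disj md ne12' k1 k2) => h; [left|right]; exact: newpos_mono.
- move=> k; rewrite -untrk_tlen /newlen (sum_edges_split ctG y) [X in _ = _ + X]big1 ?addr0.
    by apply: eq_bigl => e; apply/eqP/eqP => /trkyP.
  by move=> e /andP[/eqP].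
- by move=> i; exact: newlen_ge0.
- exact: modif_contract_on.
- move=> i; rewrite (ct_leg ctG) posyE ?core_legv //.
  rewrite (@posf_tpt _ (inr i) (c i)) /=; last exact: (md_leg md).
    by rewrite newpos_end.
  by rewrite lexx (md_c md).
- exact: Gy_connected.
Qed.

End ModifContract.

(** * Contracting and counting covers *)

Section CoverContract.
Variables (n : nat) (a : 'I_n -> int) (G' : graph n) (l' : 'I_(ne G') -> R).
Variables (D : graph 2) (dl : 'I_(ne D) -> R).
Variables (tv : 'I_(nv G') -> 'I_(nv D)) (te : 'I_(ne G') -> 'I_(ne D)).
Variables (fl : 'I_(ne G') -> bool) (s : 'I_(ne G') -> nat).
Variables (tl : 'I_n -> 'I_2) (sl : 'I_n -> nat) (dg : 'I_(nv G') -> nat).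
Hypothesis hm : hmor a l' dl tv te fl s tl sl dg.
Hypothesis g0 : genus0_two_legs dl.
Variable y : 'I_(ne D) -> R.
Hypothesis y_ge0 : forall e, 0 <= y e.

(** The length forced on a source edge by target lengths [y]. Slopes are positive, so an edge is
    contracted exactly when its image is. *)
Definition ylen (e : 'I_(ne G')) : R := y (te e) / (s e)%:R.

Lemma ylen_ge0 e : 0 <= ylen e.
Proof. by rewrite divr_ge0. Qed.

Lemma ylen_eq0 e : (ylen e == 0) = (y (te e) == 0).
Proof. by rewrite mulf_eq0 invr_eq0 pnatr_eq0 -[s e == _]negbK -lt0n (hm_s hm) orbF. Qed.

Variables (Gy : graph n) (phi' : 'I_(nv G') -> 'I_(nv Gy)) (psi' : 'I_(ne Gy) -> 'I_(ne G')).
Hypothesis ctG : contraction (fun e => ylen e == 0) phi' psi'.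
Variables (Dy : graph 2) (phiD : 'I_(nv D) -> 'I_(nv Dy)) (psiD : 'I_(ne Dy) -> 'I_(ne D)).
Hypothesis ctD : contraction (fun e => y e == 0) phiD psiD.

(** Contraction keeps the total genus 0, and connectedness makes the Betti number nonnegative; hence
    the vertex genera and the Betti number vanish separately. *)
Lemma genus0_contract : genus0_two_legs (fun e => y (psiD e)).
Proof.
have [cD [tD [gD _]]] := g0; have cDy := ct_connected ctD cD.
have h1 := ct_genus ctD; have h2 := ct_ne ctD.
have h3 : (\sum_(v : 'I_(nv D)) gw v = 0)%N by apply: big1.
have [nv0 cc] := cDy.
have h4 : (nv Dy <= ne Dy + 1)%N.
  have e1 : #|{: 'I_(nv Dy)}| = nv Dy by rewrite card_ord.
  have e2 : #|[pred e : 'I_(ne Dy) | predT e && predT (esrc e)]| = ne Dy.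
    by rewrite -[RHS]card_ord; apply: eq_card.
  apply: leq_trans (eq_leq (esym e1)) _; rewrite -[X in (_ <= X + _)%N]e2.
  by apply: (connected_fiber_card (v0 := Ordinal nv0)) => // v _; rewrite -connect_adjE.
have arith (sD sDy neD nvD neDy nvDy z : nat) : (sDy + nvD = sD + z + nvDy ->
   neDy + z = neD -> sD = 0 -> nvDy <= neDy + 1 -> neD + 1 = nvD -> sDy = 0 /\ neDy + 1 = nvDy)%N by lia.
have [sg0 tDy] := arith _ _ _ _ _ _ _ h1 h2 h3 h4 tD.
split=> //; split=> //; split.
  by move=> v; move/eqP: sg0; rewrite sum_nat_eq0 => /forallP/(_ v)/implyP/(_ isT)/eqP.
by move=> e; rewrite lt_neqAle y_ge0 andbT eq_sym; exact: (ct_psiZ ctD).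
Qed.

Lemma ct_card_edges : ne Dy = #|[pred e | y e != 0]|.
Proof.
have h := ct_ne ctD; have := card_predID xpredT (fun e => y e == 0).
have -> : #|[pred x : 'I_(ne D) | xpredT x]| = ne D by rewrite -[RHS]card_ord; apply: eq_card.
have arith (p q r t : nat) : (p + q = t -> t = q + r -> p = r)%N by lia.
exact: arith.
Qed.

Lemma tv_fiber u u' : phi' u = phi' u' -> phiD (tv u) = phiD (tv u').
Proof.
move/(ct_fib ctG); apply: (connect_cadj_const (f := phiD \o tv)) => e /=.
rewrite ylen_eq0 => y0; have [-> ->] := hm_ends hm e.
by case: (fl e); rewrite (ct_edge ctD).
Qed.

(** The local degree of the contracted cover at [C], measured over a single vertex [w] of the old
    target; [fdeg_const] removes the choice of [w]. *)
Definition fdeg (C : 'I_(nv Gy)) (w : 'I_(nv D)) : nat :=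
  (\sum_(u | (phi' u == C) && (tv u == w)) dg u)%N.

Lemma fdeg_flag C (h : flag D) : fdeg C (fl_vert h) =
  (\sum_(h' : flag G' | (phi' (fl_vert h') == C) && (tflag te fl tl h' == h)) fslope s sl h')%N.
Proof.
rewrite (partition_big (fun h' : flag G' => fl_vert h')
  (fun u => (phi' u == C) && (tv u == fl_vert h))) /=; last first.
  by move=> h' /andP[-> /eqP <-]; rewrite (fl_vert_tflag hm) eqxx.
apply: eq_bigr => u /andP[uC /eqP uh]; rewrite -(hm_deg hm (esym uh)).
apply: eq_bigl => h'; case: (fl_vert h' =P u) => [->|_]; last by rewrite andbF.
by rewrite uC andbT.
Qed.

Lemma sum_tflag_edge (V : nmodType) (P : pred (flag G')) (F : flag G' -> V) e0 b :
  \sum_(h' : flag G' | P h' && (tflag te fl tl h' == inl (e0, b))) F h' =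
  \sum_(e | P (inl (e, b (+) fl e)) && (te e == e0)) F (inl (e, b (+) fl e)).
Proof.
rewrite sum_flags_G /= [X in _ + X]big1 ?addr0; last by move=> i; rewrite andbF.
rewrite [in RHS]big_mkcond [in LHS]big_mkcond [X in _ + X]big_mkcond -big_split /=.
apply: eq_bigr => e _.
have eqb (b1 b2 : bool) : (inl (te e, b1) == inl (e0, b2) :> flag D) = (te e == e0) && (b1 == b2) by [].
rewrite !eqb; case: (te e == e0); last by rewrite !andbF addr0.
by case: b; case: (fl e); rewrite /= ?andbF ?andbT ?addr0 ?add0r.
Qed.

(** At either end of a contracted target edge the degree is the total slope of the same source
    edges. *)
Lemma fdeg_const C w w' : phiD w = phiD w' -> fdeg C w = fdeg C w'.
Proof.
move/(ct_fib ctD); apply: connect_cadj_const => e0 y0.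
have aux b : fdeg C (fl_vert (inl (e0, b) : flag D)) =
    (\sum_(e | (phi' (esrc e) == C) && (te e == e0)) s e)%N.
  rewrite fdeg_flag sum_tflag_edge; apply: eq_bigl => e.
  case: (te e =P e0) => [tE|]; rewrite ?andbF ?andbT // /=.
  case: (b (+) fl e) => //; rewrite (ct_edge ctG) //.
  by rewrite ylen_eq0 tE.
exact: (etrans (aux false) (esym (aux true))).
Qed.

Lemma hmor_contract : exists tvy tey dgy,
  hmor a (fun e => ylen (psi' e)) (fun e => y (psiD e)) tvy tey
    (fun e => fl (psi' e)) (fun e => s (psi' e)) tl sl dgy.
Proof.
have [sec secP] := fin_all_exists (ct_surj ctG).
have [secD secDP] := fin_all_exists (ct_surj ctD).
pose tvy C := phiD (tv (sec C)).
have tvyE u : tvy (phi' u) = phiD (tv u) by apply: tv_fiber; rewrite secP.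
have teyE e : exists f, psiD f = te (psi' e).
  by apply/(ct_im ctD); rewrite -ylen_eq0; exact: (ct_psiZ ctG).
have [tey teyP] := fin_all_exists teyE.
exists tvy, tey, (fun C => fdeg C (secD (tvy C))); split.
- by move=> e; exact: (hm_s hm).
- exact: (hm_sl hm).
- move=> e; rewrite (ct_src ctG) (ct_tgt ctG) !tvyE (ct_src ctD) (ct_tgt ctD) teyP.
  by have [-> ->] := hm_ends hm (psi' e); case: (fl _).
- move=> e; rewrite teyP /ylen mulrC divfK // pnatr_eq0 -lt0n; exact: (hm_s hm).
- by move=> i; rewrite (ct_leg ctG) tvyE (ct_leg ctD) (hm_leg hm).
- move=> C h hC.
  have -> : fdeg C (secD (tvy C)) = fdeg C (fl_vert (lift_flag psiD h)).
    by apply: fdeg_const; rewrite secDP -(fl_vert_lift ctD).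
  rewrite fdeg_flag.
  rewrite (sum_flags_fiber ctG (fslope s sl) (fun h' => tflag te fl tl h' == lift_flag psiD h)).
  rewrite [X in _ + (X + _)]big1 ?[X in _ + (_ + X)]big1 ?addr0; last 2 first.
  + move=> e /andP[+ /andP[_ /eqP eE]]; rewrite ylen_eq0.
    case: h {hC} eE => [[f b]|i] //= [-> _].
    by rewrite (negbTE (ct_psiZ ctD f)).
  + move=> e /andP[+ /andP[_ /eqP eE]]; rewrite ylen_eq0.
    case: h {hC} eE => [[f b]|i] //= [-> _].
    by rewrite (negbTE (ct_psiZ ctD f)).
  apply: eq_big => h'; last by case: h' => [[]|].
  congr (_ && _).
  have -> : tflag te fl tl (lift_flag psi' h') =
    lift_flag psiD (tflag tey (fun e => fl (psi' e)) tl h').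
    by case: h' => [[e b]|i] //=; rewrite teyP.
  by rewrite (inj_eq (lift_flag_inj ctD)).
- move=> C; rewrite (ct_chi ctG C) (ct_chi ctD (tvy C)) mulr_sumr.
  have -> : \sum_(v | phiD v == tvy C) (fdeg C (secD (tvy C)))%:Z * chi v =
    \sum_(u | phi' u == C) (dg u)%:Z * chi (tv u).
    rewrite [RHS](partition_big tv (fun v => phiD v == tvy C)) /=; last first.
      by move=> u /eqP <-; rewrite tvyE.
    apply: eq_bigr => w /eqP wC.
    have -> : fdeg C (secD (tvy C)) = fdeg C w by apply: fdeg_const; rewrite secDP.
    by rewrite /fdeg Posz_sum mulr_suml; apply: eq_bigr => u /andP[_ /eqP ->].
  by rewrite -sumrB; apply: sumr_ge0 => u _; exact: (hm_eff hm).
- exact: (hm_a hm).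
Qed.

Hypothesis a_neq0 : forall i, a i != 0.
Hypothesis cD : connected D.

Local Notation tflag := (@tflag n G' D te fl tl).
Local Notation fslope := (@fslope n G' s sl).

Definition gdeg (w : 'I_(nv D)) : nat := (\sum_(u | tv u == w) dg u)%N.

Lemma fslope_gt0 h' : (0 < fslope h')%N.
Proof. by case: h' => [[e b]|i]; [exact: (hm_s hm)|exact: (hm_sl hm)]. Qed.

Lemma sum_over_flag (V : nmodType) (F : flag G' -> V) (h : flag D) :
  \sum_(h' | tflag h' == h) F h' =
  \sum_(u | tv u == fl_vert h) \sum_(h' : flag G' | (fl_vert h' == u) && (tflag h' == h)) F h'.
Proof.
rewrite (partition_big (fun h' : flag G' => fl_vert h') (fun u => tv u == fl_vert h)) /=.
  by apply: eq_bigr => u _; apply: eq_bigl => h'; rewrite andbC.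
by move=> h' /eqP <-; rewrite (fl_vert_tflag hm).
Qed.

Lemma gdeg_flag (h : flag D) : gdeg (fl_vert h) = (\sum_(h' | tflag h' == h) fslope h')%N.
Proof.
rewrite sum_over_flag; apply: eq_bigr => u /eqP uh.
by rewrite (hm_deg hm (esym uh)).
Qed.

Lemma sum_over_edge x b (V : nmodType) (F : flag G' -> V) :
  \sum_(h' | tflag h' == inl (x, b)) F h' = \sum_(e | te e == x) F (inl (e, b (+) fl e)).
Proof. exact: (sum_tflag_edge xpredT). Qed.

Definition degree : nat := (\sum_(i | (0 < a i)%R) `|a i|)%N.

(** The degree is constant along target edges and can be read at the leg [0], whose preimages are
    the legs with [a i > 0]. *)
Lemma gdeg_degree w : gdeg w = degree.
Proof.
have gc e : gdeg (esrc e) = gdeg (etgt e).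
  have aux b : gdeg (fl_vert (inl (e, b) : flag D)) = (\sum_(e' | te e' == e) s e')%N.
    by rewrite gdeg_flag sum_over_edge.
  exact: (etrans (aux false) (esym (aux true))).
rewrite (connected_const (f := gdeg) cD gc w (legv D ord0)).
rewrite -[legv D ord0]/(fl_vert (inr ord0 : flag D)) gdeg_flag sum_flags_G /=.
rewrite [X in X + _ + _]big_pred0 // [X in _ + X + _]big_pred0 // !add0r /degree; apply: eq_big => i.
  have [pos neg] := hm_a hm i; have := a_neq0 i.
  case: (ltgtP (a i) 0) => // ai _; first by have [-> _] := neg ai.
  by have [-> _] := pos ai; rewrite eqxx.
move=> /eqP[ti]; have [pos neg] := hm_a hm i; have := a_neq0 i.
case: (ltgtP (a i) 0) => // ai _; first by move: (neg ai); rewrite ti => -[].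
by have [_ <-] := pos ai.
Qed.

Lemma sum_slopes x : (\sum_(e | te e == x) s e)%N = degree.
Proof.
by rewrite -(gdeg_degree (fl_vert (inl (x, false) : flag D))) gdeg_flag sum_over_edge.
Qed.

Lemma slope_le e : (s e <= degree)%N.
Proof. by rewrite -(sum_slopes (te e)) (bigD1 e) //= leq_addr. Qed.

Lemma card_over_edge x : (#|[pred e | te e == x]| <= degree)%N.
Proof. by rewrite -(sum_slopes x) card_sum1; apply: leq_sum => e _; exact: (hm_s hm). Qed.

End CoverContract.

(** * The length matrix of a cover and the size of its target *)

Definition DRk n (a : 'I_n -> int) (m : nat) (H : graph n) (lam : 'I_(ne H) -> R) : Prop :=
  exists (G' : graph n) (l' : 'I_(ne G') -> R) (D : graph 2) (dl : 'I_(ne D) -> R),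
    [/\ TropModif lam l', genus0_two_legs dl, DR_morphism a l' dl & ne D = m].

Section TypeMatrix.
Variables (n : nat) (a : 'I_n -> int) (G H : graph n) (l : 'I_(ne G) -> R) (lam : 'I_(ne H) -> R).
Variables (phi0 : 'I_(nv G) -> 'I_(nv H)) (psi0 : 'I_(ne H) -> 'I_(ne G)).
Hypothesis ct0 : contraction (fun e => l e == 0) phi0 psi0.
Hypothesis lamE : forall f, lam f = l (psi0 f).
Hypothesis l_ge0 : forall e, 0 <= l e.
Variables (G' : graph n) (l' : 'I_(ne G') -> R).
Variables (pos : 'I_(nv G') -> option (gpoint H)).
Variables (trk : 'I_(ne G') -> option (track H)) (ta tb : 'I_(ne G') -> R) (c : 'I_n -> R).
Hypothesis md : modif lam l' pos trk ta tb c.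
Variables (D : graph 2) (dl : 'I_(ne D) -> R).
Variables (tv : 'I_(nv G') -> 'I_(nv D)) (te : 'I_(ne G') -> 'I_(ne D)).
Variables (fl : 'I_(ne G') -> bool) (s : 'I_(ne G') -> nat).
Variables (tl : 'I_n -> 'I_2) (sl : 'I_n -> nat) (dg : 'I_(nv G') -> nat).
Hypothesis hm : hmor a l' dl tv te fl s tl sl dg.
Hypothesis g0 : genus0_two_legs dl.
Variable i0 : 'I_n.

(* The edge lengths of the curve as a linear function of those of the target. *)
Definition tmx (e : 'I_(ne G)) (x : 'I_(ne D)) : R :=
  \sum_(e' | [exists f, (psi0 f == e) && (trk e' == Some (inl f))] && (te e' == x)) (s e')%:R^-1.

Lemma lam_pos f : 0 < lam f.
Proof. by rewrite lamE lt_neqAle l_ge0 andbT eq_sym; exact: (ct_psiZ ct0). Qed.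

Lemma tmx_newlen (y : 'I_(ne D) -> R) f :
  \sum_x tmx (psi0 f) x * y x = newlen trk (ylen te s y) (inl f).
Proof.
rewrite /newlen (partition_big te xpredT) //=; apply: eq_bigr => x _.
rewrite /tmx mulr_suml; apply: eq_big => [e'|e' /andP[_ /eqP <-]]; last by rewrite /ylen mulrC.
congr (_ && _); apply/existsP/eqP => [[f' /andP[/eqP/(ct_inj ct0) -> /eqP //]]|ke].
by exists f; rewrite ke !eqxx.
Qed.

Lemma tmx_contracted e x : l e = 0 -> tmx e x = 0.
Proof.
move=> l0; rewrite /tmx big1 // => e' /andP[/existsP[f /andP[/eqP fe _]] _].
by have := ct_psiZ ct0 f; rewrite fe l0 eqxx.
Qed.

Lemma tmx_dl e : l e = \sum_x tmx e x * dl x.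
Proof.
case: (eqVneq (l e) 0) => [l0|nz].
  by rewrite l0 big1 // => x _; rewrite tmx_contracted // mul0r.
have [f fe] := (ct_im ct0 e).1 nz.
rewrite -fe tmx_newlen -lamE -[LHS](md_sum md (inl f)) /newlen.
apply: eq_bigr => e' _; rewrite /ylen (hm_len hm) mulrC mulKf // pnatr_eq0 -lt0n.
exact: (hm_s hm).
Qed.

(** The number of target edges is recorded because a minimal cover will be reached by descent on
    it. *)
Lemma tmx_DRk (y : 'I_(ne D) -> R) : (forall x, 0 <= y x) ->
  exists (Hy : graph n) (lamy : 'I_(ne Hy) -> R),
    Contract (fun e => \sum_x tmx e x * y x) lamy /\ DRk a #|[pred x | y x != 0]| lamy.
Proof.
move=> y_ge0; pose yl := ylen te s y.
have [Gy [phi' [psi' ctG]]] := contraction_exists (fun e : 'I_(ne G') => yl e == 0).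
have [Dy [phiD [psiD ctD]]] := contraction_exists (fun e : 'I_(ne D) => y e == 0).
have [Hy [phi [psi ctH]]] := contraction_exists (fun f : 'I_(ne H) => newlen trk yl (inl f) == 0).
have [vat vatP] := vat_exists md.
exists Hy, (lamy trk yl psi); split.
  apply/ContractP; exists (phi \o phi0), (psi0 \o psi); split=> [|f]; last by rewrite /= tmx_newlen.
  apply: (ct_comp ct0 ctH) => [e /eqP l0|f]; last by rewrite tmx_newlen.
  by rewrite big1 // => x _; rewrite tmx_contracted // mul0r.
have yl_ge0 e : 0 <= yl e by exact: ylen_ge0.
exists Gy, (ly yl psi'), Dy, (fun e => y (psiD e)); split.
- have mdy := modif_contract md lam_pos (legv H i0) yl_ge0 ctH ctG vatP.
  by apply: (modif_ModifGen mdy).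
- exact: (genus0_contract g0 y_ge0 ctD).
- have [tvy [tey [dgy hmy]]] := hmor_contract hm ctG ctD.
  by apply/DR_morphismP; exists tvy, tey, (fun e => fl (psi' e)), (fun e => s (psi' e)), tl, sl, dgy.
- exact: ct_card_edges ctD.
Qed.

Variable g : nat.
Hypothesis stG : stable_type g G.
Hypothesis a_neq0 : forall i, a i != 0.

Local Notation tflag := (@tflag n G' D te fl tl).
Local Notation fslope := (@fslope n G' s sl).
Local Notation core := (core pos).
Local Notation ftrk := (ftrk trk).

Let lam_gt0 := lam_pos.
Let stH := stable_contracted ct0 stG.
Let cD : connected D. Proof. by have [] := g0. Qed.

Definition on_edge (e : 'I_(ne G)) (h : flag G') : bool :=
  [exists f, (psi0 f == e) && (ftrk h == Some (inl f))].

(** Columns indexed by target flags: an edge end gets the column of its edge and a leg gets 0, so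
    the two flags at a vertex of valence 2 can be compared even if one is a leg. *)
Definition fcol (h : flag D) (e : 'I_(ne G)) : R :=
  \sum_(h' | tflag h' == h) (if on_edge e h' then (fslope h')%:R^-1 else 0).

Lemma fcol_tmx x b e : fcol (inl (x, b)) e = tmx e x.
Proof.
rewrite /fcol sum_over_edge /tmx [RHS]big_mkcond [LHS]big_mkcond /=.
by apply: eq_bigr => e' _; rewrite andbC; case: (te e' == x).
Qed.

Lemma fcol_leg i e : fcol (inr i) e = 0.
Proof.
rewrite /fcol big1 // => -[[e' b]|j] //= _; rewrite /on_edge /=.
by case: existsP => // -[f /andP[_ /eqP]].
Qed.

Hypothesis tmx_neq0 : forall x, exists e, tmx e x <> 0.
Hypothesis tmx_distinct : forall x x', (forall e, tmx e x = tmx e x') -> x = x'.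

(** A nonzero column excludes target edges covered by attached trees and legs alone. *)
Lemma core_over x : exists e' f, te e' = x /\ trk e' = Some (inl f).
Proof.
have [e nz] := tmx_neq0 x.
case: (pickP (fun e' => [exists f, (psi0 f == e) && (trk e' == Some (inl f))] && (te e' == x))) => [e'|none].
  by case/andP => /existsP[f /andP[_ /eqP ke]] /eqP tE; exists e', f.
by exfalso; apply: nz; rewrite /tmx big_pred0.
Qed.

Lemma core_edge_vert e' k b : trk e' = Some k -> core (fl_vert (inl (e', b) : flag G')).
Proof.
move=> ke; have ce : core_edge trk e' by rewrite /core_edge ke.
by have [cs ct] := core_edge_ends md ce; case: b.
Qed.

(** Connectedness directly supplies an edge leaving [w]; loops of the target need not be
    discussed. *)
Lemma proper_edge w : (1 < nv D)%N -> exists x b,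
  fl_vert (inl (x, b) : flag D) = w /\ fl_vert (inl (x, ~~ b) : flag D) <> w.
Proof.
move=> nv2.
case: (pickP (fun x : 'I_(ne D) => (esrc x == w) (+) (etgt x == w))) => [x|none].
  case: (esrc x =P w) => [es|es]; case: (etgt x =P w) => [et|et] // _.
    by exists x, false.
  by exists x, true.
have h u : (u == w) = true.
  rewrite (connected_const (f := fun v => v == w) cD _ u w) ?eqxx // => x.
  by have := none x; rewrite /=; case: (esrc x == w); case: (etgt x == w).
have := h (Ordinal nv2); have := h (Ordinal (ltnW nv2)).
by move=> /eqP <- /eqP [].
Qed.

Definition ram (w : 'I_(nv D)) : int := \sum_(u | tv u == w) ((dg u)%:Z * chi w - chi u).

Lemma ram_term_ge0 u : 0 <= (dg u)%:Z * chi (tv u) - chi u.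
Proof. exact: (hm_eff hm). Qed.

Lemma ram_ge0 w : 0 <= ram w.
Proof. by apply: sumr_ge0 => u /eqP <-; exact: ram_term_ge0. Qed.

Lemma ram_ge u : (dg u)%:Z * chi (tv u) - chi u <= ram (tv u).
Proof.
rewrite /ram (bigD1 u) //= lerDl; apply: sumr_ge0 => u' /andP[/eqP <- _]; exact: ram_term_ge0.
Qed.

Lemma ram_eq0 w u : ram w = 0 -> tv u = w -> (dg u)%:Z * chi w - chi u = 0.
Proof.
move=> r0 uw; apply/eqP; rewrite eq_le; apply/andP; split.
  by have := ram_ge u; rewrite uw r0.
by rewrite -uw; exact: ram_term_ge0.
Qed.

(** Riemann-Hurwitz. For a tree with two legs the values of [chi] sum to 0, so the degree drops out
    of the formula. *)
Lemma sum_ram_le : \sum_w ram w <= g%:Z *+ 2 - 2 + n%:Z.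
Proof.
have [_ [tD [gD _]]] := g0.
have -> : \sum_w ram w = - \sum_(u : 'I_(nv G')) chi u.
  rewrite /ram; under eq_bigr do rewrite sumrB -mulr_suml -Posz_sum.
  rewrite sumrB -[RHS]sub0r; congr (_ - _).
    under eq_bigr do rewrite -/(gdeg tv dg _) (gdeg_degree hm a_neq0 cD).
    rewrite -mulr_sumr sum_chi.
    have -> : \sum_(v : 'I_(nv D)) (gw v)%:Z = 0 by apply: big1 => v _; rewrite gD.
    by rewrite -tD PoszD; ring.
  by rewrite [RHS](partition_big tv xpredT).
rewrite sum_chi.
have := stable_sum_chi ct0 stG; rewrite sum_chi -!Posz_sum.
have := modif_genus_le md.
set s1 := (\sum_v gw v)%N; set s2 := (\sum_v gw v)%N.
lia.
Qed.

Lemma chi_target (w : 'I_(nv D)) : chi w = 2 - (Defs.val w)%:Z :> int.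
Proof. by have [_ [_ [gD _]]] := g0; rewrite /chi gD mulr0 subr0. Qed.

Lemma val_ge1 (K : graph n) (v : 'I_(nv K)) : connected K -> (0 < Defs.val v)%N.
Proof.
move=> cK; have [h hv] := vertex_has_flag i0 v cK.
by apply/card_gt0P; exists h; rewrite inE hv.
Qed.

Lemma dg_gt0 u : (0 < dg u)%N.
Proof.
have [h hu] := vertex_has_flag i0 u (md_conn md).
have hh : fl_vert (tflag h) = tv u by rewrite (fl_vert_tflag hm) hu.
rewrite -(hm_deg hm hh) (bigD1 h) /=; last by rewrite hu !eqxx.
by rewrite ltn_addr // (fslope_gt0 hm).
Qed.

Lemma flag_over u h : fl_vert h = tv u -> exists h' : flag G', fl_vert h' = u /\ tflag h' = h.
Proof.
move=> hu; have := dg_gt0 u; rewrite -(hm_deg hm hu).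
case: (pickP (fun h' : flag G' => (fl_vert h' == u) && (tflag h' == h))) => [h' /andP[/eqP ? /eqP ?]|none].
  by exists h'.
by rewrite big_pred0.
Qed.

(** Take a core vertex [u] over [w]. All its flags lie over the single flag at [w], so [dg u] is at
    least its valence, and valence 1 forces positive genus; in both cases [dg u - chi u >= 2]. *)
Lemma leaf_ram (w : 'I_(nv D)) : (1 < nv D)%N -> Defs.val w = 1%N -> 2 <= ram w.
Proof.
move=> nv2 val1; have [x [b [xw _]]] := proper_edge w nv2.
have only h : fl_vert h = w -> h = inl (x, b) :> flag D.
  move=> hw; apply/eqP; apply/negP => /negP hx.
  suff : (2 <= Defs.val w)%N by rewrite val1.
  by rewrite /Defs.val (cardD1 (inl (x, b))) inE xw eqxx (cardD1 h) !inE hw eqxx hx.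
have [e' [f [tE ke]]] := core_over x.
pose u := fl_vert (inl (e', b (+) fl e') : flag G').
have uw : tv u = w.
  rewrite /u -(fl_vert_tflag hm) /= tE -xw.
  by case: (b) (fl e') => [] [].
have cu : core u by exact: (core_edge_vert _ ke).
apply: le_trans (_ : (dg u)%:Z * chi (tv u) - chi u <= _); last by rewrite -uw; exact: ram_ge.
rewrite uw chi_target val1.
have dgv : (Defs.val u <= dg u)%N.
  rewrite -(hm_deg hm (h := inl (x, b)) _); last by rewrite xw uw.
  rewrite /Defs.val card_sum1.
  apply: leq_trans (_ : (\sum_(h' : flag G' | fl_vert h' == u) fslope h' <= _)%N).
    by apply: leq_sum => h' _; exact: (fslope_gt0 hm).
  apply: eq_leq; apply: eq_bigl => h'; case: eqP => //= hu.
  by apply/esym/eqP; apply: only; rewrite (fl_vert_tflag hm) hu.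
have v1 := val_ge1 u (md_conn md).
have gw1 := core_val1 md lam_gt0 stH cu.
rewrite /chi; move: dgv v1 gw1.
case: (Defs.val u =P 1%N) => [->|]; first by move=> ? _ /(_ erefl); lia.
lia.
Qed.

(** Without ramification every vertex over [w] has genus 0 and two flags of equal slope, on the same
    edge of the curve if on any. The two flags at [w] then have equal columns: either two columns of
    the matrix coincide or one equals the zero column of a leg. *)
Lemma val2_ram (w : 'I_(nv D)) : (1 < nv D)%N -> Defs.val w = 2%N -> 1 <= ram w.
Proof.
move=> nv2 val2; case: (ltP 0 (ram w)) => [|r_le0]; first by rewrite -gtz0_ge1.
exfalso; have r0 : ram w = 0 by apply/eqP; rewrite eq_le r_le0 ram_ge0.
have [x [b [xw xw']]] := proper_edge w nv2.
pose h1 : flag D := inl (x, b).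
have [h2 /andP[h21 /eqP h2w]] : exists h2 : flag D, (h2 != h1) && (fl_vert h2 == w).
  case: (pickP (fun h2 : flag D => (h2 != h1) && (fl_vert h2 == w))) => [h2|none]; first by exists h2.
  by move: val2; rewrite /Defs.val (cardD1 h1) inE xw eqxx eq_card0.
have chi0 : chi w = 0 by rewrite chi_target val2.
have uval u : tv u = w -> gw u = 0%N /\ Defs.val u = 2%N.
  move=> /(ram_eq0 r0); rewrite chi0 mulr0 sub0r /chi.
  have := val_ge1 u (md_conn md); lia.
have colE e : fcol h1 e = fcol h2 e.
  rewrite /fcol !(sum_over_flag hm) xw h2w; apply: eq_bigr => u /eqP uw.
  have [gu vu] := uval u uw.
  have hv1 : fl_vert h1 = tv u by rewrite uw.
  have hv2 : fl_vert h2 = tv u by rewrite uw.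
  have [k1 [k1u k1h]] := flag_over hv1; have [k2 [k2u k2h]] := flag_over hv2.
  have k12 : k1 != k2 by apply: contraNneq h21 => kk; rewrite -k1h -k2h kk.
  have only h' : fl_vert h' = u -> (h' == k1) || (h' == k2).
    move=> hu; rewrite -[X in is_true X]negbK; apply/negP; rewrite negb_or => /andP[h1' h2'].
    suff : (3 <= Defs.val u)%N by rewrite vu.
    rewrite /Defs.val (cardD1 k1) inE k1u eqxx (cardD1 k2) !inE k2u eqxx (cardD1 h') !inE hu eqxx.
    by rewrite eq_sym k12 h1' h2'.
  have one1 h' : ((fl_vert h' == u) && (tflag h' == h1)) = (h' == k1).
    apply/andP/eqP => [[/eqP/only/orP[/eqP //|/eqP ->]]|->]; last by rewrite k1u k1h.
    by rewrite k2h (negbTE h21).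
  have one2 h' : ((fl_vert h' == u) && (tflag h' == h2)) = (h' == k2).
    apply/andP/eqP => [[/eqP/only/orP[/eqP ->|/eqP //]]|->]; last by rewrite k2u k2h.
    by rewrite k1h eq_sym (negbTE h21).
  have s1 : fslope k1 = dg u by rewrite -(hm_deg hm hv1) (eq_bigl _ _ one1) big_pred1_eq.
  have s2 : fslope k2 = dg u by rewrite -(hm_deg hm hv2) (eq_bigl _ _ one2) big_pred1_eq.
  rewrite (eq_bigl _ _ one1) (eq_bigl _ _ one2) !big_pred1_eq s1 s2.
  suff -> : on_edge e k1 = on_edge e k2 by [].
  have tr (p q : flag G') f : fl_vert p = u -> fl_vert q = u -> ftrk p = Some (inl f) -> ftrk q = Some (inl f).
    move=> pu qu kp; apply: (val2_ftrk md lam_gt0 stH gu vu _ pu qu kp).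
    by case: p pu kp => [[e' b']|] //= <- ke; exact: (core_edge_vert b' ke).
  apply: eq_existsb => f; congr (_ && _); apply/eqP/eqP; exact: tr.
have [e0 nz] := tmx_neq0 x.
case: h2 h21 h2w colE => [[x2 b2]|j] h21 h2w colE; last first.
  by apply: nz; rewrite -(fcol_tmx _ b) colE fcol_leg.
have x12 : x = x2 by apply: tmx_distinct => e; rewrite -(fcol_tmx _ b) colE fcol_tmx.
apply: xw'; rewrite -h2w x12; congr (fl_vert (inl (_, _) : flag D)).
move: h21; rewrite /h1 x12; case: (b) (b2) => [] [] //; by rewrite eqxx.
Qed.

(* [chi] sums to zero over the target, so [ram w - chi w = ram w + val w - 2 >= 1]
   bounds the number of vertices by the total ramification. *)
Lemma cover_bound : (1 <= g)%N -> (2 <= n)%N -> (ne D <= 2 * g + n - 3)%N.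
Proof.
move=> g1 n2; have [_ [tD [gD _]]] := g0.
case: (ltnP 1 (nv D)) => nv2; last by lia.
have key w : 1 <= ram w - chi w.
  have v1 : (0 < Defs.val w)%N.
    by have [x [b [xw _]]] := proper_edge w nv2; apply/card_gt0P; exists (inl (x, b)); rewrite inE xw.
  rewrite chi_target; have := ram_ge0 w.
  case E: (Defs.val w) v1 => [|[|[|m]]] // _.
  - by have := leaf_ram nv2 E; lia.
  - by have := val2_ram nv2 E; lia.
  - by lia.
have : \sum_(w : 'I_(nv D)) 1 <= \sum_w (ram w - chi w) by apply: ler_sum => w _; exact: key.
rewrite sumr_const card_ord sumrB sum_chi.
have -> : \sum_(v : 'I_(nv D)) (gw v)%:Z = 0 by apply: big1 => v _; rewrite gD.
have := sum_ram_le; set S := \sum_w ram w; rewrite -tD PoszD; lia.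
Qed.

End TypeMatrix.

(** * Representation by bounded integer matrices *)

(** Targets have varying numbers of edges; matrices are padded with zero columns to a common
    width. *)
Lemma sum_insub (V : nmodType) m k (F : 'I_m -> V) : (m <= k)%N ->
  \sum_(j < k) (if insub (j : nat) is Some x then F x else 0) = \sum_x F x.
Proof.
move=> mk; rewrite (bigID (fun j : 'I_k => isSome (insub (j : nat) : option 'I_m))) /=.
rewrite [X in _ + X]big1 ?addr0; last by move=> j; case: insub.
rewrite (reindex_omap (widen_ord mk) (fun j : 'I_k => insub (j : nat))) /=.
  apply: eq_big => [x|x _] /=; last by rewrite valK.
  by rewrite valK eqxx.
move=> j; case: insubP => [x _ xj|] // _ /=; congr Some; exact: val_inj.
Qed.

Lemma caratheodory_step m (d z : 'I_m -> R) : (forall i, 0 < d i) -> (exists i, z i <> 0) ->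
  exists t, (forall i, 0 <= d i + t * z i) /\ exists i, d i + t * z i = 0.
Proof.
move=> d0.
have neg (z' : 'I_m -> R) : (exists i, z' i < 0) ->
    exists t, (forall i, 0 <= d i + t * z' i) /\ exists i, d i + t * z' i = 0.
  case=> i1 zi1.
  (* The smallest ratio among the decreasing coordinates is the moment at which the first of them
     reaches 0. *)
  case: (@arg_minP _ _ _ i1 (fun i => z' i < 0) (fun i => d i / - z' i) zi1) => i zi imin.
  have zn : z' i != 0 by rewrite lt_eqF.
  exists (d i / - z' i); split; last by exists i; field.
  move=> j; have t0 : 0 < d i / - z' i by rewrite divr_gt0 // oppr_gt0.
  case: (ltP (z' j) 0) => zj; last by apply: addr_ge0; [exact: ltW|apply: mulr_ge0 => //; exact: ltW].
  have := imin j zj; rewrite /= ler_pdivlMr ?oppr_gt0 //.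
  by set t := _ / - z' i; lra.
case=> i /eqP; case: (ltgtP (z i) 0) => // zi _; first by apply: neg; exists i.
have [|t [h1 [j hj]]] := neg (fun i => - z i); first by exists i; rewrite oppr_lt0.
exists (- t); split=> [i'|]; first by rewrite mulNr -mulrN.
by exists j; rewrite mulNr -mulrN.
Qed.

Section Representation.
Variables (g n : nat) (a : 'I_n -> int).
Hypothesis g1 : (1 <= g)%N.
Hypothesis n2 : (2 <= n)%N.
Hypothesis a_neq0 : forall i, a i != 0.
Variable G : graph n.
Hypothesis stG : stable_type g G.

Let i0 : 'I_n := Ordinal (ltnW n2).
Let d := degree a.
Let k := (2 * g + n - 3)%N.
(** At most [d] source edges lie over a target edge, and each contributes at most [d!] to an entry
    scaled by [d!]. *)
Let B := (d * d`!)%N.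

Definition bmx : finType := {ffun 'I_(ne G) * 'I_k -> 'I_B.+1}.

Definition bmx_mul (N : bmx) (x : 'I_k -> R) (e : 'I_(ne G)) : R :=
  \sum_j (N (e, j) : nat)%:R * x j.

Definition inDRk (l : 'I_(ne G) -> R) (m : nat) : Prop :=
  exists (H : graph n) (lam : 'I_(ne H) -> R), Contract l lam /\ DRk a m lam.

Lemma DR_DRk (H : graph n) (lam : 'I_(ne H) -> R) : DR a lam <-> exists m, DRk a m lam.
Proof.
split=> [[G' [l' [D [dl [h1 [h2 h3]]]]]]|[m [G' [l' [D [dl [h1 h2 h3 _]]]]]]].
  by exists (ne D), G', l', D, dl.
by exists G', l', D, dl.
Qed.

(* A cover whose target has the fewest edges has a matrix with trivial kernel. *)
Lemma DR_representation l : DR_set a l -> exists N : bmx,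
  (exists2 x, forall j, 0 <= x j & l = bmx_mul N x) /\
  (forall x, (forall j, 0 <= x j) -> DR_set a (bmx_mul N x)).
Proof.
case=> l_ge0 [H0 [lam0 [ct00 /DR_DRk[m0 dr0]]]].
have exm : exists m, `[< inDRk l m >] by exists m0; apply/asboolP; exists H0, lam0.
case: (ex_minnP exm) => m /asboolP[H [lam [/ContractP[phi0 [psi0 [ct0 lamE]]] drk]]] mmin.
have [G' [l' [D [dl [/ModifGen_modif[pos [trk [ta [tb [c [md _]]]]]] gD /DR_morphismP hm0 neD]]]]] := drk.
have [tv [te [fl [s [tl [sl [dg hm]]]]]]] := hm0.
have [cD [tD [_ dl0]]] := gD.
pose M := tmx psi0 trk te s.
have Ml := tmx_dl ct0 lamE md hm; rewrite -/M in Ml.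
have Mdr y : (forall x, 0 <= y x) -> inDRk (fun e => \sum_x M e x * y x) #|[pred x | y x != 0]|.
  by move=> y0; exact: (tmx_DRk ct0 lamE l_ge0 md hm gD i0 y0).
have ker z : (forall e, \sum_x M e x * z x = 0) -> forall x, z x = 0.
  move=> Mz; case: (pselect (exists x, z x <> 0)) => [nz|nz x]; last first.
    by case: (eqVneq (z x) 0) => // /eqP h; case: nz; exists x.
  have [t [y0 [x1 yx1]]] := caratheodory_step dl0 nz.
  have := Mdr _ y0.
  have -> : (fun e => \sum_x M e x * (dl x + t * z x)) = l.
    apply/funext => e; rewrite [RHS]Ml.
    under eq_bigr do rewrite mulrDr mulrCA.
    by rewrite big_split /= -mulr_sumr Mz mulr0 addr0.
  move=> /asboolP/mmin; rewrite -neD leqNgt => /negP[].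
  rewrite -[X in (_ < X)%N]card_ord; apply: proper_card; apply/properP; split.
    by apply/subsetP.
  by exists x1; rewrite // !inE yx1 eqxx.
have delta x e : \sum_y M e y * (y == x)%:R = M e x.
  rewrite (bigD1 x) //= eqxx mulr1 big1 ?addr0 // => y /negbTE ->.
  by rewrite mulr0.
(* A zero column, or two equal columns, would give an explicit kernel vector; these are the two
   consequences of independence used in the bound. *)
have Mneq0 x : exists e, M e x <> 0.
  apply: contrapT => none; have := ker (fun y => (y == x)%:R).
  move=> /(_ _ x); rewrite eqxx; move=> /(_ _)/eqP; rewrite oner_eq0 => h.
  suff : false by []; apply: h => e; rewrite delta; apply: contrapT => h'.
  by apply: none; exists e.
have Mdist x x' : (forall e, M e x = M e x') -> x = x'.
  move=> xx; apply/eqP; apply/negPn/negP => ne.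
  have := ker (fun y => (y == x)%:R - (y == x')%:R) _ x.
  rewrite eqxx (negbTE ne) subr0 => h.
  suff /eqP : 1 = 0 :> R by rewrite oner_eq0.
  apply: h => e; under eq_bigr do rewrite mulrBr.
  by rewrite sumrB !delta xx subrr.
have Dk : (ne D <= k)%N.
  exact: (cover_bound ct0 lamE l_ge0 md hm gD i0 stG a_neq0 Mneq0 Mdist g1 n2).
(* Slopes are at most [d], so they divide [d!] and the natural-number quotients are exact. *)
pose Nn e x : nat := (\sum_(e' | ([exists f, (psi0 f == e) && (trk e' == Some (inl f))] && (te e' == x))) d`! %/ s e')%N.
have Nle e x : (Nn e x < B.+1)%N.
  rewrite ltnS /Nn /B; apply: leq_trans (_ : (\sum_(e' | te e' == x) d`! <= _)%N).
    rewrite [X in (_ <= X)%N](bigID (fun e' => [exists f, (psi0 f == e) && (trk e' == Some (inl f))])) /=.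
    apply: leq_trans (leq_addr _ _); under [X in (_ <= X)%N]eq_bigl do rewrite andbC.
    by apply: leq_sum => e' _; exact: leq_div.
  rewrite sum_nat_const leq_mul2r; apply/orP; right.
  by have := card_over_edge hm a_neq0 cD x.
have NM e x : (Nn e x)%:R = d`!%:R * M e x.
  rewrite /Nn /M /tmx natr_sum mulr_sumr; apply: eq_bigr => e' _.
  rewrite natf_div // dvdn_fact // (hm_s hm); exact: (slope_le hm a_neq0 cD).
have df : d`!%:R != 0 :> R by rewrite pnatr_eq0 -lt0n fact_gt0.
pose N : bmx := [ffun p : 'I_(ne G) * 'I_k => if insub (p.2 : nat) is Some x then Ordinal (Nle p.1 x) else ord0].
have NE (x : 'I_k -> R) e : bmx_mul N x e =
    \sum_(j : 'I_(ne D)) M e j * (d`!%:R * x (widen_ord Dk j)).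
  rewrite /bmx_mul -(sum_insub _ Dk); apply: eq_bigr => j _; rewrite ffunE /=.
  case: insubP => [y _ yj|_]; last by rewrite mul0r.
  rewrite /= NM; have -> : widen_ord Dk y = j by apply: val_inj.
  by ring.
exists N; split.
  exists (fun j => if insub (j : nat) is Some x then dl x / d`!%:R else 0).
    by move=> j; case: insubP => // x _ _; rewrite divr_ge0 // ltW.
  apply/funext => e; rewrite NE Ml; apply: eq_bigr => j _.
  by rewrite /= valK mulrC [d`!%:R * _]mulrC divfK // mulrC.
move=> x x0; split=> [e|]; first by apply: sumr_ge0 => j _; rewrite mulr_ge0.
have [|H1 [lam1 [c1 dr1]]] := Mdr (fun j => d`!%:R * x (widen_ord Dk j)).
  by move=> j; rewrite mulr_ge0.
exists H1, lam1; split; last by apply/DR_DRk; eexists; exact: dr1.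
suff -> : bmx_mul N x = fun e => \sum_j M e j * (d`!%:R * x (widen_ord Dk j)) by [].
by apply/funext => e; rewrite NE.
Qed.

End Representation.

(** * Fourier-Motzkin elimination and dimension *)

Section FourierMotzkin.

Lemma seq_between (Rf : realFieldType) (L U : seq Rf) :
  (forall l u, l \in L -> u \in U -> l <= u) ->
  exists t, (forall l, l \in L -> l <= t) /\ (forall u, u \in U -> t <= u).
Proof.
elim: L => [|l L IH] LU.
  elim: U {LU} => [|u U [t [_ tU]]]; first by exists 0.
  exists (Num.min u t); split=> // u'; rewrite inE => /orP[/eqP ->|/tU h]; first by rewrite ge_min lexx.
  by rewrite ge_min h orbT.
have [l' u' lL uU|t [tL tU]] := IH; first by apply: LU => //; rewrite inE lL orbT.
exists (Num.max l t); split=> [l'|u uU].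
  rewrite inE => /orP[/eqP ->|/tL h]; first by rewrite le_max lexx.
  by rewrite le_max h orbT.
by rewrite ge_max tU // LU // mem_head.
Qed.

Variable Rf : realFieldType.

Definition idot (I : finType) (c : {ffun I -> int}) (x : I -> Rf) : Rf := \sum_i (c i)%:~R * x i.

Lemma idotD (I : finType) (c c' : {ffun I -> int}) x : idot (c + c') x = idot c x + idot c' x.
Proof. by rewrite /idot -big_split; apply: eq_bigr => i _; rewrite ffunE rmorphD mulrDl. Qed.

Lemma idotMz (I : finType) (c : {ffun I -> int}) x (z : int) : idot (c *~ z) x = z%:~R * idot c x.
Proof.
rewrite /idot mulr_sumr; apply: eq_bigr => i _.
have -> : (c *~ z) i = z * c i by rewrite ffunMzE mulrzz mulrC.
by rewrite rmorphM mulrA.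
Qed.

(** Each lower bound on [t] is paired with each upper bound; cross-multiplying instead of dividing
    keeps the coefficients integral. *)
Lemma fm_eliminate (I : finType) (cs : seq ({ffun I -> int} * int)) :
  exists ds : seq {ffun I -> int}, forall x : I -> Rf,
    (exists t, all (fun c => 0 <= idot c.1 x + c.2%:~R * t) cs) <->
    all (fun d => 0 <= idot d x) ds.
Proof.
pose P := [seq c <- cs | 0 < c.2]; pose N := [seq c <- cs | c.2 < 0].
pose ds := [seq c.1 | c <- cs & c.2 == 0] ++
  [seq q.1 *~ p.2 + p.1 *~ (- q.2) | p <- P, q <- N].
exists ds => x; split.
  case=> t /allP h; rewrite all_cat; apply/andP; split; apply/allP => d.
    case/mapP => c; rewrite mem_filter => /andP[/eqP c0 /h] + ->.
    by rewrite c0 mul0r addr0.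
  case/allpairsP => -[p q] /= []; rewrite !mem_filter => /andP[p0 /h hp] /andP[q0 /h hq] ->.
  rewrite idotD !idotMz rmorphN /=.
  move: p0 q0; rewrite -(ltr0z Rf) -(ltrz0 Rf) => p0 q0.
  have := mulr_ge0 (ltW p0) hq; have q0' : 0 <= - q.2%:~R :> Rf by lra.
  have := mulr_ge0 q0' hp; lra.
rewrite all_cat => /andP[/allP h0 /allP hpn].
have [|t [tL tU]] := @seq_between Rf [seq - idot p.1 x / p.2%:~R | p <- P] [seq idot q.1 x / - q.2%:~R | q <- N].
  move=> l u /mapP[p pP ->] /mapP[q qN ->].
  have /hpn : q.1 *~ p.2 + p.1 *~ (- q.2) \in [seq q.1 *~ p.2 + p.1 *~ (- q.2) | p <- P, q <- N].
    by apply/allpairsP; exists (p, q).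
  move: pP qN; rewrite !mem_filter -(ltr0z Rf) -(ltrz0 Rf) => /andP[p0 _] /andP[q0 _].
  rewrite idotD !idotMz rmorphN /= => h.
  have q0' : 0 < - q.2%:~R :> Rf by lra.
  rewrite ler_pdivrMr // mulrAC ler_pdivlMr //; lra.
exists t; apply/allP => c ccs; case: (ltgtP c.2 0) => c0.
- have /tU : idot c.1 x / - c.2%:~R \in [seq idot q.1 x / - q.2%:~R | q <- N].
    by apply: map_f; rewrite mem_filter c0.
  have c0' : 0 < - c.2%:~R :> Rf by rewrite oppr_gt0 ltrz0.
  by rewrite ler_pdivlMr //; lra.
- have /tL : - idot c.1 x / c.2%:~R \in [seq - idot p.1 x / p.2%:~R | p <- P].
    by apply: map_f; rewrite mem_filter c0.
  have c0' : 0 < c.2%:~R :> Rf by rewrite ltr0z.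
  by rewrite ler_pdivrMr //; lra.
- rewrite c0 mul0r addr0; apply: h0; apply: map_f; by rewrite mem_filter c0 eqxx.
Qed.

(** To eliminate the first variable, the remaining ones are counted among the parameters; hence the
    induction is over all parameter types [I]. *)
Lemma fm_project (I : finType) k (cs : seq ({ffun I -> int} * {ffun 'I_k -> int})) :
  exists ds : seq {ffun I -> int}, forall x : I -> Rf,
    (exists y : 'I_k -> Rf, all (fun c => 0 <= idot c.1 x + idot c.2 y) cs) <->
    all (fun d => 0 <= idot d x) ds.
Proof.
elim: k I cs => [|k IH] I cs.
  exists (map fst cs) => x; rewrite all_map; split.
    by case=> y; apply: sub_all => c; rewrite /idot big_ord0 addr0.
  move=> h; exists (fun=> 0); apply: sub_all h => c /=.
  by rewrite [idot c.2 _]/idot big_ord0 addr0.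
pose cs1 : seq ({ffun I + 'I_k -> int} * int) :=
  [seq ([ffun z : I + 'I_k => match z with inl i => c.1 i | inr j => c.2 (lift ord0 j) end], c.2 ord0)
    | c : {ffun I -> int} * {ffun 'I_k.+1 -> int} <- cs].
have [ds1 ds1P] := fm_eliminate cs1.
pose cs2 : seq ({ffun I -> int} * {ffun 'I_k -> int}) :=
  [seq ([ffun i => c (inl i)], [ffun j => c (inr j)]) | c : {ffun I + 'I_k -> int} <- ds1].
have [ds dsP] := IH _ cs2.
exists ds => x; rewrite -dsP.
pose xy (y : 'I_k -> Rf) (z : I + 'I_k) := match z with inl i => x i | inr j => y j end.
have E2 y : all (fun c => 0 <= idot c.1 x + idot c.2 y) cs2 = all (fun d => 0 <= idot d (xy y)) ds1.
  rewrite all_map; apply: eq_all => c /=; congr (0 <= _).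
  rewrite /idot big_sumType /=; congr (_ + _); apply: eq_bigr => j _; by rewrite ffunE.
have E1 y t : all (fun c => 0 <= idot c.1 (xy y) + c.2%:~R * t) cs1 =
    all (fun c => 0 <= idot c.1 x + idot c.2 (fun j => if unlift ord0 j is Some j' then y j' else t)) cs.
  rewrite all_map; apply: eq_all => c /=; congr (0 <= _).
  rewrite /idot big_sumType /= [in RHS]big_ord_recl unlift_none -addrA; congr (_ + _).
    by apply: eq_bigr => j _; rewrite ffunE.
  rewrite addrC; congr (_ + _); apply: eq_bigr => j _; by rewrite ffunE liftK.
split.
  case=> y h; exists (fun j => y (lift ord0 j)); rewrite E2; apply/ds1P; exists (y ord0).
  rewrite E1; apply: sub_all h => c; congr (is_true (0 <= _ + _)).
  apply: eq_bigr => j _; case: unliftP => [j' ->|->] //.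
case=> y; rewrite E2 => /ds1P[t]; rewrite E1 => h.
by exists (fun j => if unlift ord0 j is Some j' then y j' else t).
Qed.

Lemma fm_cone (I : finType) k (N : I -> 'I_k -> int) :
  exists ds : seq {ffun I -> int}, forall x : I -> Rf,
    (exists2 y : 'I_k -> Rf, forall j, 0 <= y j & forall i, x i = \sum_j (N i j)%:~R * y j) <->
    all (fun d => 0 <= idot d x) ds.
Proof.
pose c1 i : {ffun I -> int} * {ffun 'I_k -> int} := ([ffun i' => (i' == i)%:R], [ffun j => - N i j]).
pose c2 i : {ffun I -> int} * {ffun 'I_k -> int} := ([ffun i' => - (i' == i)%:R], [ffun j => N i j]).
pose c3 j : {ffun I -> int} * {ffun 'I_k -> int} := ([ffun=> 0], [ffun j' => (j' == j)%:R]).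
pose cs := [seq c1 i | i <- enum I] ++ [seq c2 i | i <- enum I] ++ [seq c3 j | j <- enum 'I_k].
have [ds dsP] := fm_project cs; exists ds => x; rewrite -dsP.
have delta (T : finType) (t0 : T) (y : T -> Rf) : \sum_t ((t == t0)%:R : int)%:~R * y t = y t0.
  rewrite (bigD1 t0) //= eqxx mul1r big1 ?addr0 // => t /negbTE ->; by rewrite mul0r.
have E1 i y : idot (c1 i).1 x + idot (c1 i).2 y = x i - \sum_j (N i j)%:~R * y j.
  rewrite /idot /=; congr (_ + _).
    by rewrite -[RHS](delta _ i); apply: eq_bigr => i' _; rewrite ffunE.
  by rewrite -sumrN; apply: eq_bigr => j _; rewrite ffunE rmorphN mulNr.
have E2 i y : idot (c2 i).1 x + idot (c2 i).2 y = \sum_j (N i j)%:~R * y j - x i.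
  rewrite /idot /= addrC; congr (_ + _); first by apply: eq_bigr => j _; rewrite ffunE.
  by rewrite -[in RHS](delta _ i x) -sumrN; apply: eq_bigr => i' _; rewrite ffunE rmorphN mulNr.
have E3 j y : idot (c3 j).1 x + idot (c3 j).2 y = y j.
  rewrite /idot /= big1 ?add0r; last by move=> i _; rewrite ffunE mul0r.
  by rewrite -[RHS](delta _ j); apply: eq_bigr => i' _; rewrite ffunE.
split.
  case=> y y0 xy; exists y; rewrite !all_cat !all_map; apply/and3P; split; apply/allP => i _ /=.
  - by rewrite E1 xy subrr.
  - by rewrite E2 xy subrr.
  - by rewrite E3.
case=> y; rewrite !all_cat !all_map => /and3P[/allP h1 /allP h2 /allP h3]; exists y.
  by move=> j; rewrite -(E3 j); apply: h3.
move=> i; have : 0 <= idot (c1 i).1 x + idot (c1 i).2 y by apply: h1.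
have : 0 <= idot (c2 i).1 x + idot (c2 i).2 y by apply: h2.
by rewrite E1 E2; lra.
Qed.

End FourierMotzkin.

Lemma semilinear_union m (T : finType) (good : pred T) (ds : T -> seq {ffun 'I_m -> int})
    (S : ('I_m -> R) -> Prop) :
  (forall x, S x <-> exists t, good t /\ all (fun d => 0 <= idot d x) (ds t)) -> Defs.semilinear S.
Proof.
(* All pieces must have the same number of inequalities; shorter lists are filled up with the zero
   form. *)
move=> SP; pose p := (\max_t size (ds t))%N.
exists #|good|, p, (fun (j : 'I_#|good|) (q : 'I_p) (i : 'I_m) => (nth 0 (ds (enum_val j)) q) i) => x; rewrite SP; split.
  case=> t [gt /allP ht]; exists (enum_rank_in gt t) => q; rewrite enum_rankK_in //.
  case: (ltnP q (size (ds t))) => hq; first by have := ht _ (mem_nth 0 hq).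
  by rewrite nth_default // big1 // => i _; rewrite ffunE mul0r.
case=> j h; exists (enum_val j); split; first exact: enum_valP.
apply/(all_nthP 0) => q hq.
have qp : (q < p)%N by apply: leq_trans hq _; exact: (leq_bigmax (enum_val j)).
exact: (h (Ordinal qp)).
Qed.

(** The points [1/(i+2)] lie strictly between 0 and 1, and a list of [size p] of them is too long to
    consist of roots. *)
Lemma poly_nonroot (p : {poly R}) : p != 0 -> exists2 t : R, 0 < t < 1 & p.[t] != 0.
Proof.
move=> p0; pose rs := [seq (i.+2%:R : R)^-1 | i <- iota 0 (size p)].
have urs : uniq rs.
  rewrite map_inj_uniq ?iota_uniq // => i j /invr_inj/eqP; rewrite eqr_nat => /eqP[]; exact.
case: (boolP (all (root p) rs)) => [ar|/allPn[t /mapP[i _ tE] nr]].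
  by have := max_poly_roots p0 ar urs; rewrite size_map size_iota ltnn.
exists t; last exact: nr.
by rewrite tE invr_gt0 ltr0n /= invf_lt1 ?ltr0n // ltr1n.
Qed.

Section BallDimension.
Variables (m k : nat) (T : finType) (W : T -> 'M[R]_(k, m)) (S : ('I_m -> R) -> Prop).
Hypothesis SW : forall l, S l -> exists t, (\row_i l i <= W t)%MS.

(* On a curve of moment type, membership in one of finitely many subspaces is a
   nontrivial polynomial condition. *)
Lemma has_ball_le k' : has_ball S k' -> (k' <= k)%N.
Proof.
case=> x0 [v [vfree [r [r0 ball]]]]; rewrite leqNgt; apply/negP => kk'.
pose V : 'M[R]_(k', m) := \matrix_(j, i) v j i.
have Vfree : row_free V.
  apply: inj_row_free => c cV; apply/rowP => j; rewrite mxE.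
  apply: (vfree (fun j => c 0 j)) => i.
  have := congr1 (fun A : 'rV_m => A 0 i) cV; rewrite !mxE => h; rewrite -[RHS]h.
  by apply: eq_bigr => j' _; rewrite mxE.
have colM q (A : 'M[R]_(q, m)) (C : 'M[R]_m) i : A *m col i C = col i (A *m C).
  by apply/matrixP => x z; rewrite !mxE; apply: eq_bigr => ? _; rewrite mxE.
(* Because [k < k'], the span of the directions [v] is not contained in [W t]; some linear form
   vanishes on [W t] but not on that span. *)
have [psi psiP] : exists psi : T -> 'cV[R]_m, forall t, W t *m psi t = 0 /\ V *m psi t != 0.
  suff h t : exists q : 'cV[R]_m, W t *m q = 0 /\ V *m q != 0 by exact: (fin_all_exists h).
  have : V *m cokermx (W t) != 0.
    apply/negP => /eqP h; have : (V <= W t)%MS by rewrite submxE h.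
    by move/mxrankS; rewrite (eqP Vfree) leqNgt (leq_ltn_trans (rank_leq_row _) kk').
  move=> nz; case: (pickP (fun i => V *m col i (cokermx (W t)) != 0)) => [i hi|none].
    exists (col i (cokermx (W t))); split=> //.
    by rewrite colM mulmx_coker; apply/colP => j; rewrite !mxE.
  case/negP: nz; apply/eqP/matrixP => j i; have /negbFE/eqP := none i.
  by rewrite colM => /(congr1 (fun A : 'cV_k' => A j 0)); rewrite !mxE.
(* The points [rho * t^(j+1)] stay in the ball for [0 < t < 1]. Exponents start at 1 so that the
   constant contributed by [x0] cannot cancel a nonzero coefficient. *)
pose rho := r / 2.
pose p t : {poly R} := (((\row_i x0 i) *m psi t) 0 0)%:P +
  \sum_(j < k') ((V *m psi t) j 0 * rho) *: 'X^(j.+1).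
have pnz t : p t != 0.
  have [_ nz] := psiP t.
  have [j jnz] : exists j, (V *m psi t) j 0 != 0.
    case: (pickP (fun j => (V *m psi t) j 0 != 0)) => [j|none]; first by exists j.
    by case/negP: nz; apply/eqP/colP => j; have /negbFE/eqP -> := none j; rewrite mxE.
  apply/negP => /eqP /(congr1 (fun q : {poly R} => q`_j.+1)).
  rewrite coef0 coefD coefC /= add0r coef_sum (bigD1 j) //= coefZ coefXn eqxx mulr1 big1 ?addr0.
    by move/eqP; rewrite mulf_eq0 (negbTE jnz) /= gt_eqF // divr_gt0.
  move=> j' ne; rewrite coefZ coefXn eqSS [(j : nat) == _]eq_sym (inj_eq val_inj) (negbTE ne).
  by rewrite mulr0.
have [t /andP[t0 t1] tnr] : exists2 t : R, 0 < t < 1 & (\prod_q p q).[t] != 0.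
  by apply: poly_nonroot; apply/prodf_neq0 => q _; exact: pnz.
have tk j : 0 < t ^+ j <= 1 by rewrite exprn_gt0 //= exprn_ile1 // ltW.
have /SW[q] : S (fun i => x0 i + \sum_j (rho * t ^+ (val j).+1) * v j i).
  apply: (ball (fun j : 'I_k' => rho * t ^+ (val j).+1)) => j.
  have := tk (val j).+1 => /andP[h1 h2].
  have rho0 : 0 < rho by rewrite divr_gt0.
  rewrite ger0_norm; last by rewrite mulr_ge0 // ltW.
  apply: le_lt_trans (_ : rho < r); first by rewrite ler_piMr // ltW.
  by rewrite /rho; lra.
have [Wq _] := psiP q; case/submxP => A AE.
move: tnr; rewrite horner_prod => /prodf_neq0/(_ q isT)/negP[]; apply/eqP.
have : ((\row_i (x0 i + \sum_j (rho * t ^+ (val j).+1) * v j i)) *m psi q) 0 0 = 0.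
  by rewrite AE -mulmxA Wq mulmx0 mxE.
have -> : \row_i (x0 i + \sum_j (rho * t ^+ (val j).+1) * v j i) =
   \row_i x0 i + \sum_j (rho * t ^+ (val j).+1) *: row j V.
  apply/rowP => i; rewrite !mxE summxE; congr (_ + _).
  by apply: eq_bigr => j _; rewrite !mxE.
rewrite mulmxDl mxE mulmx_suml summxE => <-.
rewrite /p hornerD hornerC horner_sum; congr (_ + _); apply: eq_bigr => j _.
rewrite hornerZ hornerXn -scalemxAl -row_mul [in RHS]mxE [row _ _ _ _]mxE; ring.
Qed.

End BallDimension.

Section Consequences.
Variables (g n : nat) (a : 'I_n -> int).
Hypothesis g1 : (1 <= g)%N.
Hypothesis n2 : (2 <= n)%N.
Hypothesis a_neq0 : forall i, a i != 0.
Variable G : graph n.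
Hypothesis stG : stable_type g G.

Lemma DR_semilinear : Defs.semilinear (@DR_set n a G).
Proof.
(* Of the finitely many bounded matrices, keep those whose whole cone lies in the locus; every point
   of the locus lies in one of these cones. *)
pose good (N : bmx g a G) := `[< forall x, (forall j, 0 <= x j) -> DR_set a (bmx_mul N x) >].
have fm (N : bmx g a G) := @fm_cone R _ _ (fun e j => (N (e, j) : nat)%:Z).
have [ds dsP] := fin_all_exists fm.
apply: (semilinear_union (good := good) (ds := ds)) => l; split.
  move=> /(DR_representation g1 n2 a_neq0 stG)[N [[x x0 lE] gN]]; exists N; split; first exact/asboolP.
  by apply/dsP; exists x => // e; rewrite lE.
case=> N [/asboolP gN /dsP[x x0 lE]].
suff -> : l = bmx_mul N x by exact: gN.
by apply/funext => e; rewrite lE.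
Qed.

Lemma DR_dim_le k : has_ball (@DR_set n a G) k -> (k <= 2 * g + n - 3)%N.
Proof.
pose W (N : bmx g a G) : 'M[R]_(2 * g + n - 3, ne G) := \matrix_(j, e) (N (e, j) : nat)%:R.
apply: (has_ball_le (W := W)) => l /(DR_representation g1 n2 a_neq0 stG)[N [[x _ lE] _]].
exists N; apply/submxP; exists (\row_j x j); apply/rowP => e; rewrite !mxE lE /bmx_mul.
by apply: eq_bigr => j _; rewrite !mxE mulrC.
Qed.

End Consequences.

(** * Covers of a path *)

Section FinGraph.
Variables (L : nat) (V E : finType) (src tgt : E -> V) (leg : 'I_L -> V).

(** Allows sum types and subtypes as vertices and edges; the cover below mixes those of the curve
    with subdivision points of its legs. *)
Definition fgraph : graph L := {| nv := #|V|; ne := #|E|;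
  esrc e := enum_rank (src (enum_val e)); etgt e := enum_rank (tgt (enum_val e));
  gw _ := 0; legv i := enum_rank (leg i) |}.

Lemma sum_enum_ord (W : nmodType) (T : finType) (P : pred T) (F : T -> W) :
  \sum_(i < #|T| | P (enum_val i)) F (enum_val i) = \sum_(t | P t) F t.
Proof.
rewrite (reindex (@enum_rank T)) /=; last exact: onW_bij (enum_rank_bij T).
by apply: eq_big => t; rewrite enum_rankK.
Qed.

Lemma fgraph_connected (v0 : V) :
  (forall f : V -> bool, (forall e, f (src e) = f (tgt e)) -> forall v, f v = f v0) ->
  connected fgraph.
Proof.
move=> h; apply: connected_const_test; first by apply/card_gt0P; exists v0.
move=> f fc u w; have hf := h (fun v => f (enum_rank v)).
have {}hf v : f v = f (enum_rank v0).
  rewrite -(enum_valK v); apply: hf => e.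
  by have := fc (enum_rank e); rewrite /= enum_rankK.
by rewrite !hf.
Qed.

End FinGraph.

Section Layered.
Variables (n m N : nat) (a : 'I_n -> int).
Variables (epos : 'I_N -> 'I_m) (slope : 'I_N -> nat) (lev : 'I_n -> 'I_m.+1).
Variable main_edge : 'I_m -> 'I_N.

Definition lo (x : 'I_m) : 'I_m.+1 := widen_ord (leqnSn m) x.
Definition hi (x : 'I_m) : 'I_m.+1 := lift ord0 x.

Definition layered : graph n := {| nv := m.+1; ne := N;
  esrc e := lo (epos e); etgt e := hi (epos e); gw _ := 0; legv := lev |}.

Definition path_graph : graph 2 := {| nv := m.+1; ne := m;
  esrc := lo; etgt := hi; gw _ := 0; legv i := if i == ord0 then ord0 else ord_max |}.

Definition lw (i : 'I_n) : nat := `|a i|%N.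

(** Leg [i] leaves level [lev i] to the left if [a i > 0] and to the right otherwise. [off] selects
    the levels strictly beyond its root, where it must be subdivided, and [lpass] the path edges it
    runs over. *)
Definition off (p : 'I_n * 'I_m.+1) : bool :=
  if 0 < a p.1 then (p.2 < lev p.1)%N else (lev p.1 < p.2)%N.
Definition lpass (p : 'I_n * 'I_m) : bool :=
  if 0 < a p.1 then (p.2 < lev p.1)%N else (lev p.1 <= p.2)%N.

Hypothesis a_neq0 : forall i, a i != 0.
Hypothesis m_gt0 : (0 < m)%N.
Hypothesis slope_gt0 : forall e, (0 < slope e)%N.
Hypothesis main_edgeP : forall x, epos (main_edge x) = x.
Variable d : nat.
Hypothesis balance : forall x,
  (\sum_(e | epos e == x) slope e + \sum_(i | lpass (i, x)) lw i = d)%N.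
Hypothesis sum_pos : (\sum_(i | (0 < a i)%R) lw i = d)%N.
Hypothesis sum_neg : (\sum_(i | ~~ (0 < a i)%R) lw i = d)%N.
Hypothesis last_leg : exists i, ~~ (0 < a i) && (lev i == ord_max).

Variable y : 'I_m -> R.
Hypothesis y_gt0 : forall x, 0 < y x.

Lemma lw_gt0 i : (0 < lw i)%N.
Proof. by rewrite /lw absz_gt0. Qed.

Lemma path_connected : connected path_graph.
Proof.
apply: connected_const_test => // f fc.
suff h u : f u = f ord0 by move=> u w; rewrite !h.
case: u => u; elim: u => [|u IH] lu; first by congr f; apply: val_inj.
have lu' : (u < m)%N by [].
rewrite -(IH (ltnW lu)); have := fc (Ordinal lu') => /= h.
transitivity (f (hi (Ordinal lu'))); first by congr f; apply: val_inj; rewrite /= /bump.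
by rewrite -h; congr f; apply: val_inj.
Qed.

Lemma path_val (w : 'I_m.+1) : Defs.val (G := path_graph) w = 2%N.
Proof.
apply/eqP; rewrite -(eqr_nat int) natz val_sum sum_flags_G /=.
have cnt (P : pred 'I_m) (b : bool) : (forall x x', P x -> P x' -> x = x') -> [exists x, P x] = b ->
    \sum_(x | P x) (1 : int) = b%:R.
  move=> uP eb; case: (pickP P) => [x Px|none].
    have -> : b = true by rewrite -eb; apply/existsP; exists x.
    by rewrite (big_pred1 x) // => x'; apply/idP/eqP => [|-> //]; move/(uP _ _); exact.
  have -> : b = false by rewrite -eb; apply/existsP => -[x]; rewrite none.
  by rewrite big_pred0.
rewrite (cnt _ (w < m)%N); last 2 first.
- by move=> x x' /eqP e1 /eqP e2; apply: val_inj; have := congr1 val (etrans e1 (esym e2)).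
- apply/existsP/idP => [[x /eqP <-]|h]; first exact: (ltn_ord x).
  by exists (Ordinal h); apply/eqP; apply: val_inj.
rewrite (cnt _ (0 < w)%N); last 2 first.
- by move=> x x' /eqP e1 /eqP e2; apply: (lift_inj (h := ord0)); rewrite [LHS]e1 -e2.
- apply/existsP/idP => [[x /eqP <-]|h]; first by [].
  have h' : (w.-1 < m)%N by rewrite prednK // -ltnS.
  by exists (Ordinal h'); apply/eqP; apply: val_inj; rewrite /= /bump /= add1n prednK.
rewrite big_mkcond !big_ord_recl big_ord0 /=.
case: w => w lw' /=; rewrite -!val_eqE /=.
case: w lw' => [|w] lw'; first by rewrite m_gt0 /= eq_sym gtn_eqF.
rewrite /= ltnS in lw'; rewrite [m == _]eq_sym; case: (ltngtP w.+1 m) => // h; lia.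
Qed.

Lemma path_chi (w : 'I_(nv path_graph)) : chi w = 0.
Proof. by rewrite /chi path_val mulr0. Qed.

Definition LV : finType := ('I_m.+1 + {p : 'I_n * 'I_m.+1 | off p})%type.
Definition LE' : finType := ('I_N + {p : 'I_n * 'I_m | lpass p})%type.

(** The point of leg [i] above level [j]; at the root [j = lev i] it falls back to the vertex of the
    curve. *)
Definition lvx (i : 'I_n) (j : 'I_m.+1) : LV :=
  if insub (i, j) is Some z then inr z else inl j.

Definition lsrc (e : LE') : LV :=
  match e with inl e => inl (lo (epos e)) | inr z => lvx (\val z).1 (lo (\val z).2) end.
Definition ltgt (e : LE') : LV :=
  match e with inl e => inl (hi (epos e)) | inr z => lvx (\val z).1 (hi (\val z).2) end.
Definition lend (i : 'I_n) : 'I_m.+1 := if 0 < a i then ord0 else ord_max.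
Definition lleg (i : 'I_n) : LV := lvx i (lend i).

Definition LG : graph n := fgraph lsrc ltgt lleg.

Definition llevel (v : LV) : 'I_m.+1 := match v with inl j => j | inr z => (\val z).2 end.
Definition ledge (e : LE') : 'I_m := match e with inl e => epos e | inr z => (\val z).2 end.
Definition lslope (e : LE') : nat := match e with inl e => slope e | inr z => lw (\val z).1 end.

Lemma llevel_lvx i j : llevel (lvx i j) = j.
Proof. by rewrite /lvx; case: insubP => // z _ zE; rewrite /= zE. Qed.

Lemma lvx_inl i j j' : (lvx i j == inl j') = (j == j') && ~~ off (i, j).
Proof.
rewrite /lvx; case: insubP => [z oz zE|noz]; first by rewrite oz andbF.
by rewrite noz andbT.
Qed.

Lemma lvx_inr i j z : (lvx i j == inr z) = ((i, j) == \val z).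
Proof.
rewrite /lvx; case: insubP => [z' oz zE|noz].
  by rewrite -zE; apply/eqP/eqP => [[->] //|/val_inj ->].
by apply/esym/negP => /eqP ij; move: noz; rewrite ij (valP z).
Qed.

(** The local degree read on the right: edges leaving to the right and negative legs rooted here. At
    the last level only the legs remain. *)
Definition ldl (j : 'I_m.+1) : nat :=
  if insub (j : nat) is Some x
  then (\sum_(e | epos e == x) slope e + \sum_(i | ~~ (0 < a i)%R && (lev i == j)) lw i)%N
  else (\sum_(i | ~~ (0 < a i)%R && (lev i == j)) lw i)%N.
Definition ldg (v : LV) : nat := match v with inl j => ldl j | inr z => lw (\val z).1 end.

Lemma ldl_lo x : ldl (lo x) =
  (\sum_(e | epos e == x) slope e + \sum_(i | ~~ (0 < a i)%R && (lev i == lo x)) lw i)%N.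
Proof. by rewrite /ldl /= valK. Qed.

Lemma sum_lw_split (P Q S T : pred 'I_n) :
  (forall i, (P i + Q i = S i + T i)%N) ->
  (\sum_(i | P i) lw i + \sum_(i | Q i) lw i = \sum_(i | S i) lw i + \sum_(i | T i) lw i)%N.
Proof.
move=> h.
have mk (X : pred 'I_n) : (\sum_(i | X i) lw i = \sum_i (if X i then lw i else 0))%N.
  by rewrite big_mkcond.
rewrite !mk -!big_split /=.
apply: eq_bigr => i _; have := h i; case: (P i); case: (Q i); case: (S i); case: (T i); lia.
Qed.

(** Compare the balance on both sides of a level: a positive leg rooted there passes only on the
    left, a negative one only on the right. *)
Lemma ldl_left x : (\sum_(e | epos e == x) slope e + \sum_(i | (0 < a i)%R && (lev i == hi x)) lw i)%N = ldl (hi x).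
Proof.
have hx : (hi x : nat) = x.+1 by rewrite /hi /= /bump.
have b1 := balance x; rewrite /ldl; case: insubP => [x' _ xE|].
  have b2 := balance x'.
  have h : (\sum_(i | lpass (i, x)) lw i + \sum_(i | ~~ (0 < a i)%R && (lev i == hi x)) lw i =
     \sum_(i | lpass (i, x')) lw i + \sum_(i | (0 < a i)%R && (lev i == hi x)) lw i)%N.
    apply: sum_lw_split => i; rewrite /lpass /= -!val_eqE /= -/(hi x) /bump.
    have := xE; rewrite hx => ->; case: (0 < a i) => /=; case: (lev i : nat) => *; lia.
  have arith (s s' l1 l2 u v d0 : nat) : (s + l1 = d0 -> s' + l2 = d0 -> l1 + u = l2 + v ->
    s + v = s' + u)%N by lia.
  exact: (arith _ _ _ _ _ _ _ b1 b2 h).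
rewrite -leqNgt hx => mx.
have h : (\sum_(i | lpass (i, x)) lw i + \sum_(i | ~~ (0 < a i)%R && (lev i == hi x)) lw i =
     \sum_(i | ~~ (0 < a i)%R) lw i + \sum_(i | (0 < a i)%R && (lev i == hi x)) lw i)%N.
  apply: sum_lw_split => i; rewrite /lpass /= -!val_eqE /= /bump /=.
  have := ltn_ord (lev i); have := ltn_ord x; case: (0 < a i) => /=; lia.
rewrite sum_neg in h.
have arith (s l1 u v d0 : nat) : (s + l1 = d0 -> l1 + u = d0 + v -> s + v = u)%N by lia.
exact: (arith _ _ _ _ _ b1 h).
Qed.

Lemma ldl_first : (\sum_(i | (0 < a i)%R && (lev i == ord0)) lw i)%N = ldl ord0.
Proof.
have b1 := balance (Ordinal m_gt0); have -> : ord0 = lo (Ordinal m_gt0) by apply: val_inj.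
rewrite ldl_lo.
have h : (\sum_(i | lpass (i, Ordinal m_gt0)) lw i + \sum_(i | (0 < a i)%R && (lev i == lo (Ordinal m_gt0))) lw i =
     \sum_(i | (0 < a i)%R) lw i + \sum_(i | ~~ (0 < a i)%R && (lev i == lo (Ordinal m_gt0))) lw i)%N.
  apply: sum_lw_split => i; rewrite /lpass /= -!val_eqE /=; case: (0 < a i) => /=; lia.
rewrite sum_pos in h.
have arith (s l1 u v d0 : nat) : (s + l1 = d0 -> l1 + v = d0 + u -> v = s + u)%N by lia.
exact: (arith _ _ _ _ _ b1 h).
Qed.

Lemma ldl_last : (\sum_(i | ~~ (0 < a i)%R && (lev i == ord_max)) lw i)%N = ldl ord_max.
Proof. by rewrite /ldl insubF // /= ltnn. Qed.

Lemma ldg_gt0 v : (0 < ldg v)%N.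
Proof.
case: v => [j|z] /=; last exact: lw_gt0.
case: (ltnP j m) => jm.
  have -> : j = lo (Ordinal jm) by apply: val_inj.
  by rewrite ldl_lo (bigD1 (main_edge (Ordinal jm))) ?main_edgeP //= -!addnA ltn_addr.
have -> : j = ord_max by apply: val_inj; apply/eqP; rewrite eqn_leq jm -ltnS ltn_ord.
have [i il] := last_leg.
by rewrite -ldl_last (bigD1 i) //= ltn_addr // lw_gt0.
Qed.

Definition ltl (i : 'I_n) : 'I_2 := if 0 < a i then ord0 else 1.

Lemma sum_LE (W : nmodType) (P : pred LE') (F : LE' -> W) :
  \sum_(e | P e) F e = \sum_(e | P (inl e)) F (inl e) +
    \sum_(p | lpass p && (if insub p is Some z then P (inr z) else false))
       (if insub p is Some z then F (inr z) else 0).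
Proof.
rewrite big_sumType /=; congr (_ + _).
rewrite (big_sub_cond [pred p | lpass p] (fun p => if insub p is Some z then P (inr z) else false)).
by apply: eq_big => z; rewrite valK.
Qed.

Lemma sum_leg_edges (P : pred ('I_n * 'I_m)) (x : 'I_m) :
  (\sum_(p | lpass p && (P p && (p.2 == x))) lw p.1 = \sum_(i | lpass (i, x) && P (i, x)) lw i)%N.
Proof.
transitivity (\sum_(p : 'I_n * 'I_m | (lpass (p.1, p.2) && P (p.1, p.2)) && (p.2 == x)) lw p.1)%N.
  by apply: eq_bigl => -[i x']; rewrite andbA.
rewrite -(pair_big_dep xpredT (fun i x' => (lpass (i, x') && P (i, x')) && (x' == x)) (fun i _ => lw i)) /=.
rewrite [RHS]big_mkcond /=; apply: eq_bigr => i _; rewrite big_mkcondl.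
by rewrite big_pred1_eq.
Qed.

Definition lside (b : bool) (x : 'I_m) : 'I_m.+1 := if b then hi x else lo x.

Lemma sum_side (b : bool) v x :
  (\sum_(e : LE' | ((if b then ltgt e else lsrc e) == v) && (ledge e == x)) lslope e =
   if llevel v == lside b x then ldg v else 0)%N.
Proof.
have E : (\sum_(e : LE' | ((if b then ltgt e else lsrc e) == v) && (ledge e == x)) lslope e =
    \sum_(e | (inl (lside b (epos e)) == v :> LV) && (epos e == x)) slope e +
    \sum_(i | lpass (i, x) && (lvx i (lside b x) == v)) lw i)%N.
  rewrite (@sum_LE _ (fun e => ((if b then ltgt e else lsrc e) == v) && (ledge e == x)) lslope) /=.
  congr (_ + _)%N; first by case: b.
  rewrite -(sum_leg_edges (fun p => lvx p.1 (lside b p.2) == v)); apply: eq_big => p.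
    by case: insubP => [z lz zE|/negbTE ->] //; rewrite /lside /= zE; case: b.
  by case: insubP => [z lz zE _|/negbTE ->] //; rewrite /= zE.
rewrite E; case: v {E} => [j|z] /=.
  case: (j =P lside b x) => [->|jx].
    transitivity (\sum_(e | epos e == x) slope e +
      \sum_(i | (if b then 0 < a i else ~~ (0 < a i))%R && (lev i == lside b x)) lw i)%N.
      congr (_ + _)%N; apply: eq_bigl.
        by move=> e; case: (epos e =P x) => [->|]; rewrite ?eqxx ?andbF.
      move=> i; rewrite lvx_inl eqxx /lside /lpass /off /= -val_eqE.
      by case: b; rewrite /= ?/bump /=; case: (0 < a i) => /=; lia.
    by rewrite /lside; case: b; rewrite ?ldl_left ?ldl_lo.
  rewrite !big1 // => i /andP[].
    by rewrite lvx_inl => _ /andP[/eqP ?]; case: jx.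
  by move=> /eqP[je] /eqP ex; case: jx; rewrite -je ex.
rewrite big_pred0 // add0n.
transitivity (\sum_(i | (i == (\val z).1) && ((\val z).2 == lside b x)) lw i)%N.
  apply: eq_bigl => i; rewrite lvx_inr; case: z => -[i' j'] oz /=.
  rewrite xpair_eqE; case: (i =P i') => [->|]; rewrite ?andbF //= [lside b x == _]eq_sym.
  case: eqP => [jE|]; rewrite ?andbF // andbT; move: oz; rewrite jE /off /lpass /lside /= {jE}.
  by case: (0 < a i'); case: b; rewrite /= ?/bump /=; lia.
case: eqP => _; first by under eq_bigl do rewrite andbT; rewrite big_pred1_eq.
by rewrite big_pred0 // => i; rewrite andbF.
Qed.

Lemma sum_legs v t : (\sum_(i | (lleg i == v) && (ltl i == t)) lw i =
  if llevel v == legv path_graph t then ldg v else 0)%N.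
Proof.
set w := legv path_graph t.
have [b [wE tE]] : exists b, w = (if b then ord0 else ord_max) /\
    forall i, (ltl i == t) = ((0 < a i) == b).
  exists (t == ord0); split=> // i; rewrite /ltl.
  have [->|->] : t = ord0 \/ t = 1 by case: t {w} => -[|[|]] // ?; [left|right]; apply: val_inj.
    by case: (0 < a i).
  by case: (0 < a i).
transitivity (\sum_(i | (ltl i == t) && (lvx i w == v)) lw i)%N.
  apply: eq_bigl => i; rewrite andbC tE /lleg /lend wE.
  by clear wE tE; case: (0 < a i); case: b.
case: v => [j|z] /=.
  case: (j =P w) => [->|jw]; last first.
    rewrite big_pred0 // => i; rewrite lvx_inl.
    by case: (w =P j) => [wj|]; rewrite ?andbF //; case: jw.
  transitivity (\sum_(i | (ltl i == t) && (lev i == w)) lw i)%N.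
    apply: eq_bigl => i; rewrite lvx_inl eqxx tE wE /off -val_eqE /=; have := ltn_ord (lev i).
    by clear wE tE; case: (0 < a i); case: b => //=; lia.
  rewrite wE; clear wE; case: b tE => tE; rewrite -?ldl_first -?ldl_last; apply: eq_bigl => i;
    by rewrite tE; case: (0 < a i).
transitivity (\sum_(i | (i == (\val z).1) && ((\val z).2 == w)) lw i)%N.
  apply: eq_bigl => i; case: z => -[i' j'] oz /=; rewrite lvx_inr /= xpair_eqE tE [w == _]eq_sym.
  case: (i =P i') => [->|]; rewrite ?andbF //=; case: (j' =P w) => [jE|]; rewrite ?andbF ?andbT //.
  move: oz; rewrite jE wE /off /=; have := ltn_ord (lev i'); clear wE tE jE.
  by case: (0 < a i'); case: b => //=; lia.
case: eqP => _; first by under eq_bigl do rewrite andbT; rewrite big_pred1_eq.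
by rewrite big_pred0 // => i; rewrite andbF.
Qed.

Lemma enum_rank_eq (T : finType) (t : T) (i : 'I_#|T|) : (enum_rank t == i) = (t == enum_val i).
Proof. by rewrite -(inj_eq enum_val_inj) enum_rankK. Qed.

Definition Llen (e : 'I_(ne LG)) : R := y (ledge (enum_val e)) / (lslope (enum_val e))%:R.

Lemma lslope_gt0 e : (0 < lslope e)%N.
Proof. by case: e => [e|z] /=; [exact: slope_gt0|exact: lw_gt0]. Qed.

Lemma llevel_src e : llevel (lsrc e) = lo (ledge e).
Proof. by case: e => [e|z] //=; rewrite llevel_lvx. Qed.
Lemma llevel_tgt e : llevel (ltgt e) = hi (ledge e).
Proof. by case: e => [e|z] //=; rewrite llevel_lvx. Qed.

Lemma legv_ltl i : legv path_graph (ltl i) = lend i.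
Proof. by rewrite /ltl /lend /=; case: (0 < a i). Qed.

Local Notation ltflag := (@tflag n LG path_graph (fun e => ledge (enum_val e)) (fun=> false) ltl).

Lemma layered_deg (v : 'I_(nv LG)) (h : flag path_graph) : fl_vert h = llevel (enum_val v) ->
  (\sum_(h' : flag LG | (fl_vert h' == v) && (ltflag h' == h))
     @fslope n LG (fun e => lslope (enum_val e)) lw h')%N = ldg (enum_val v).
Proof.
rewrite sum_flags_G /=; case: h => [[x b]|t] /= hv.
  rewrite [X in _ + X]big1 ?addr0 => [|i /andP[_ /eqP] //].
  have := sum_side b (enum_val v) x; rewrite -hv eqxx => <-.
  rewrite -(sum_enum_ord (fun e => ((if b then ltgt e else lsrc e) == enum_val v) && (ledge e == x)) lslope).
  case: b {hv}.
    rewrite [X in X + _]big1 => [|e /andP[_ /eqP[]] //]; rewrite add0r; apply: eq_bigl => e.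
    by rewrite enum_rank_eq; congr (_ && _); apply/eqP/eqP => [[->]|->].
  rewrite [X in _ + X]big1 => [|e /andP[_ /eqP[]] //]; rewrite addr0; apply: eq_bigl => e.
  by rewrite enum_rank_eq; congr (_ && _); apply/eqP/eqP => [[->]|->].
rewrite [X in X + _ + _]big1 => [|e /andP[_ /eqP] //].
rewrite [X in _ + X + _]big1 => [|i /andP[_ /eqP] //]; rewrite !add0r.
have := sum_legs (enum_val v) t; rewrite -hv eqxx => <-.
by apply: eq_bigl => i; rewrite enum_rank_eq; congr (_ && _).
Qed.

Lemma layered_hmor : hmor a Llen y (fun v => llevel (enum_val v)) (fun e => ledge (enum_val e))
  (fun=> false) (fun e => lslope (enum_val e)) ltl lw (fun v => ldg (enum_val v))
  (D := path_graph).
Proof.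
split.
- by move=> e; exact: lslope_gt0.
- exact: lw_gt0.
- by move=> e /=; rewrite !enum_rankK llevel_src llevel_tgt.
- by move=> e; rewrite /Llen mulrC divfK // pnatr_eq0 -lt0n lslope_gt0.
- by move=> i; rewrite /= enum_rankK llevel_lvx -legv_ltl.
- exact: layered_deg.
(* With [chi = 0] on the path and genus 0 above, effectivity only asks for valence at least 2; both
   flags at the image of [v] have a preimage at [v]. *)
- move=> v; rewrite path_chi mulr0 sub0r oppr_ge0 /chi /= mulr0 subr0.
  suff : (1 < Defs.val (G := LG) v)%N by lia.
  have : (1 < Defs.val (G := path_graph) (llevel (enum_val v)))%N by rewrite path_val.
  case/card_gt1P => h1 [h2 []]; rewrite !inE => /eqP hv1 /eqP hv2 h12.
  have over (h : flag path_graph) : fl_vert h = llevel (enum_val v) -> exists h' : flag LG, fl_vert h' = v /\ ltflag h' = h.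
    move=> hv; have := ldg_gt0 (enum_val v); rewrite -(layered_deg hv).
    case: (pickP (fun h' : flag LG => (fl_vert h' == v) && (ltflag h' == h))) => [h' /andP[/eqP ? /eqP ?]|none].
      by exists h'.
    by rewrite big_pred0.
  have [k1 [k1v k1h]] := over _ hv1; have [k2 [k2v k2h]] := over _ hv2.
  apply/card_gt1P; exists k1, k2; split; rewrite ?inE ?k1v ?k2v //.
  by apply: contraNneq h12 => kk; rewrite -k1h -k2h kk.
- move=> i; rewrite /ltl /lw; split=> ai; first by rewrite ai gtz0_abs.
  by rewrite ltNge (ltW ai) /= ltz0_abs.
Qed.

Definition Pl (j : nat) : R := \sum_(x < m | (x < j)%N) y x.

Lemma Pl_mono j j' : (j <= j')%N -> Pl j <= Pl j'.
Proof.
move=> jj; rewrite /Pl [X in _ <= X](bigID (fun x : 'I_m => (x < j)%N)) /=.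
rewrite [X in X <= _](_ : _ = \sum_(x < m | (x < j')%N && (x < j)%N) y x).
  by rewrite lerDl sumr_ge0 // => x _; exact: ltW.
apply: eq_bigl => x; apply/idP/andP => [h|[]//]; split=> //; exact: leq_trans jj.
Qed.

Lemma Pl_hi x : Pl (hi x) = Pl (lo x) + y x.
Proof.
rewrite /Pl (bigD1 x) /= /bump ?add1n // addrC; congr (_ + _).
by apply: eq_bigl => x'; rewrite -val_eqE /=; lia.
Qed.

Lemma Pl_lt (j j' : 'I_m.+1) : (j < j')%N -> Pl j < Pl j'.
Proof.
move=> jj; have jm : (j < m)%N by have := ltn_ord j'; lia.
have -> : j = lo (Ordinal jm) by apply: val_inj.
apply: lt_le_trans (_ : Pl (hi (Ordinal jm)) <= _).
  by rewrite Pl_hi ltrDl.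
by apply: Pl_mono; rewrite /= /bump.
Qed.

(** Distance from the root along leg [i]: the leg maps with slope [lw i], so path lengths are
    divided by it. *)
Definition dist (i : 'I_n) (j : 'I_m.+1) : R :=
  (if 0 < a i then Pl (lev i) - Pl j else Pl j - Pl (lev i)) / (lw i)%:R.

Lemma lwR_gt0 i : 0 < (lw i)%:R :> R.
Proof. by rewrite ltr0n lw_gt0. Qed.

Lemma dist_lev i : dist i (lev i) = 0.
Proof. by rewrite /dist subrr; case: ifP; rewrite mul0r. Qed.

Lemma dist_off i j : off (i, j) -> 0 < dist i j.
Proof.
rewrite /off /dist /= => h; apply: divr_gt0; last exact: lwR_gt0.
by move: h; case: (0 < a i) => h; rewrite subr_gt0; exact: Pl_lt.
Qed.

Lemma dist_inj i j j' : dist i j = dist i j' -> j = j'.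
Proof.
move=> h; have {}h : Pl j = Pl j'.
  have := mulIf (lt0r_neq0 (_ : 0 < (lw i)%:R^-1 :> R)) h; rewrite invr_gt0 lwR_gt0 => /(_ isT).
  by case: (0 < a i) => h'; lra.
case: (ltngtP j j') => [/Pl_lt|/Pl_lt|/val_inj //]; by rewrite h ltxx.
Qed.

Definition reach i (j : 'I_m.+1) : bool := if 0 < a i then (j <= lev i)%N else (lev i <= j)%N.

Lemma reach_off i j : reach i j = off (i, j) || (j == lev i).
Proof. by rewrite /reach /off /= -val_eqE /=; case: (0 < a i); lia. Qed.

Lemma lpass_reach i x : lpass (i, x) -> reach i (lo x) /\ reach i (hi x).
Proof. by rewrite /lpass /reach /= /bump; case: (0 < a i) => /= h; split; lia. Qed.

Lemma lend_reach i : reach i (lend i).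
Proof. by rewrite /reach /lend; case: (0 < a i) => //=; rewrite -ltnS ltn_ord. Qed.

Definition llam (e : 'I_N) : R := y (epos e) / (slope e)%:R.

Lemma llam_gt0 e : 0 < llam e.
Proof. by rewrite divr_gt0 // ltr0n. Qed.

Definition lpos (v : LV) : option (gpoint layered) :=
  match v with
  | inl j => Some (@GV _ layered j)
  | inr z => Some (@GL _ layered (\val z).1 (dist (\val z).1 (\val z).2))
  end.

Lemma lpos_lvx i j : reach i j -> lpos (lvx i j) = Some (ptL layered i (dist i j)).
Proof.
rewrite reach_off /lvx /ptL; case: insubP => [z oz zE _|noz] /=.
  by rewrite zE gt_eqF // dist_off.
by rewrite (negbTE noz) /= => /eqP ->; rewrite dist_lev eqxx.
Qed.

Definition ltrk (e : LE') : option (track layered) :=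
  match e with inl e => Some (inl e) | inr z => Some (inr (\val z).1) end.
Definition lta (e : LE') : R := match e with
  | inl _ => 0
  | inr z => if 0 < a (\val z).1 then dist (\val z).1 (hi (\val z).2) else dist (\val z).1 (lo (\val z).2)
  end.
Definition ltb (e : LE') : R := match e with
  | inl e => llam e
  | inr z => if 0 < a (\val z).1 then dist (\val z).1 (lo (\val z).2) else dist (\val z).1 (hi (\val z).2)
  end.
Definition lc (i : 'I_n) : R := dist i (lend i).

Lemma ltb_lta z : ltb (inr z) - lta (inr z) = y (\val z).2 / (lw (\val z).1)%:R.
Proof.
rewrite /ltb /lta; case: ifP => ai; rewrite /dist ai -mulrBl Pl_hi; congr (_ / _); ring.
Qed.

Lemma dist_mono i (j j' : 'I_m.+1) : (j <= j')%N ->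
  if 0 < a i then dist i j' <= dist i j else dist i j <= dist i j'.
Proof.
move=> /Pl_mono h; rewrite /dist; case: (0 < a i); rewrite ler_pM2r ?invr_gt0 ?lwR_gt0 //; lra.
Qed.

Lemma dist_ge0 i j : reach i j -> 0 <= dist i j.
Proof. by rewrite reach_off => /orP[/dist_off/ltW //|/eqP ->]; rewrite dist_lev. Qed.

Lemma dist_le_end i j : reach i j -> dist i j <= lc i.
Proof.
rewrite /reach /lc /lend => h; have := @dist_mono i ord0 j (leq0n _).
have := @dist_mono i j ord_max (leq_ord _).
by case: (0 < a i).
Qed.

Lemma sum_leg_len i : \sum_(x | lpass (i, x)) y x / (lw i)%:R = lc i.
Proof.
rewrite -mulr_suml /lc /dist; congr (_ / _); rewrite /lpass /lend /=; case: (0 < a i).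
  have -> : Pl (@ord0 m) = 0 by rewrite /Pl big_pred0.
  by rewrite subr0.
have -> : Pl (@ord_max m) = \sum_(x < m) y x by apply: eq_bigl => x; exact: ltn_ord.
rewrite [in RHS](bigID (fun x : 'I_m => (x < lev i)%N)) /= [X in _ = X - _]addrC addrK.
by apply: eq_bigl => x; rewrite leqNgt.
Qed.

Lemma LG_connected : connected LG.
Proof.
apply: (@fgraph_connected _ _ _ _ _ _ (inl ord0 : LV)) => f fc.
have cst (u w : 'I_m.+1) : f (inl u) = f (inl w).
  apply: (connected_const (G := path_graph) (f := fun j => f (inl j)) path_connected) => x /=.
  by have := fc (inl (main_edge x)); rewrite /= main_edgeP.
have step i x : lpass (i, x) -> f (lvx i (lo x)) = f (lvx i (hi x)).
  by move=> h; exact: (fc (inr (Sub (i, x) h))).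
have leg i (j : 'I_m.+1) : reach i j -> f (lvx i j) = f (inl (lev i)).
  have base : f (lvx i (lev i)) = f (inl (lev i)).
    by congr f; apply/eqP; rewrite lvx_inl eqxx /off /= !ltnn; case: ifP.
  rewrite /reach; case: (boolP (0 < a i)) => ai.
    have [k kE] : exists k, (lev i - j = k)%N by exists (lev i - j)%N.
    elim: k j kE => [|k IH] j kE jl.
      by have -> : j = lev i by apply: val_inj; rewrite /=; lia.
    have jm : (j < m)%N by have := ltn_ord (lev i); lia.
    have jE : j = lo (Ordinal jm) by apply: val_inj.
    rewrite jE step; last by rewrite /lpass ai /=; lia.
    by apply: IH; rewrite /= /bump /=; lia.
  have [k kE] : exists k, (j - lev i = k)%N by exists (j - lev i)%N.
  elim: k j kE => [|k IH] j kE jl.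
    by have -> : j = lev i by apply: val_inj; rewrite /=; lia.
  have jm : (j.-1 < m)%N by have := ltn_ord j; lia.
  have jE : j = hi (Ordinal jm) by apply: val_inj; rewrite /= /bump /=; lia.
  rewrite jE -step; last by rewrite /lpass (negbTE ai) /=; lia.
  by apply: IH; rewrite /=; lia.
case=> [j|z]; first exact: cst.
rewrite -(cst (lev (\val z).1)) -(leg _ (\val z).2).
  by congr f; apply/eqP; rewrite eq_sym lvx_inr; case: (\val z).
by rewrite reach_off; case: z => -[i j] /= ->.
Qed.

(** No tree is attached and each edge is a single tile: only the legs are subdivided. *)
Lemma layered_modif : modif (H := layered) llam Llen (fun v => lpos (enum_val v))
  (fun e => ltrk (enum_val e)) (fun e => lta (enum_val e)) (fun e => ltb (enum_val e)) lc.
Proof.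
have lposT v : isSome (lpos v) by case: v.
have ltrkT e : isSome (ltrk e) by case: e.
split.
- by move=> e; rewrite divr_gt0 // ltr0n lslope_gt0.
- move=> u p; case: (enum_val u) => [j|[[i j] oz]] /= [<-] //=; exact: dist_off.
- move=> u w p pu pw; apply: enum_val_inj; move: pu; rewrite -pw.
  case: (enum_val u) => [j|z]; case: (enum_val w) => [j'|z'] //= []; first by move=> ->.
  case: z => -[i j] oz; case: z' => -[i' j'] oz' /= ii dd.
  congr inr; apply: val_inj; congr pair => //.
  by apply: (@dist_inj i); rewrite dd ii.
- by move=> v; exists (enum_rank (inl v : LV)); rewrite enum_rankK.
- by move=> u /=; case: (lpos _) => // -[].
- move=> e' k /=; rewrite !enum_rankK /Llen; case: (enum_val e') => [e|z] /= [<-] /=.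
    split=> //; [exact: llam_gt0|by rewrite subr0|left].
    by rewrite /ptE eqxx gt_eqF ?llam_gt0 // eqxx.
  have [r1 r2] : reach (\val z).1 (lo (\val z).2) /\ reach (\val z).1 (hi (\val z).2).
    by case: z => -[i x] /= lz; exact: lpass_reach.
  have diff := ltb_lta z; rewrite /lta /ltb in diff.
  have lt : 0 < y (\val z).2 / (lw (\val z).1)%:R by rewrite divr_gt0 // lwR_gt0.
  rewrite !lpos_lvx //; case: (boolP (0 < a (\val z).1)) diff => ai diff; split=> //.
  + exact: dist_ge0.
  + by lra.
  + exact: dist_le_end.
  + by right.
  + exact: dist_ge0.
  + by lra.
  + exact: dist_le_end.
  + by left.
- move=> k e1 e2 ne12; have {}ne12 : enum_val e1 <> enum_val e2 by move/enum_val_inj.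
  case: (enum_val e1) (enum_val e2) ne12 => [x1|[[i1 x1] l1]] [x2|[[i2 x2] l2]] ne12 //= [<-] // [ee].
    by case: ne12; rewrite ee.
  move: l2 ne12; rewrite ee => l2 ne12.
  have lt : (x1 < x2)%N \/ (x2 < x1)%N.
    case: (ltngtP x1 x2) => [|?|/val_inj xx]; [by left|by right|].
    by case: ne12; congr inr; apply: val_inj; rewrite /= xx.
  have hilo (u w : 'I_m) : (u < w)%N -> (hi u <= lo w)%N by rewrite /= /bump.
  case: lt => /hilo/(@dist_mono i1); case: (0 < a i1) => h; auto.
- move=> k; rewrite (sum_enum_ord (fun e => ltrk e == Some k) (fun e => y (ledge e) / (lslope e)%:R)).
  rewrite (sum_LE (fun e => ltrk e == Some k)) /=; case: k => [e|i] /=.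
    rewrite [X in _ + X]big1 ?addr0; last by move=> p; case: insubP => // z _ _; rewrite andbC.
    by rewrite (big_pred1 e) // => e'; apply/eqP/eqP => [[->]|->].
  rewrite big_pred0 // add0r -sum_leg_len.
  transitivity (\sum_(p : 'I_n * 'I_m | (p.1 == i) && lpass (p.1, p.2)) y p.2 / (lw p.1)%:R).
    apply: eq_big => -[i' x] /=; case: insubP => [z lz zE|/negbTE -> //] /=; rewrite ?zE ?andbF //=.
    by rewrite [in RHS]lz lz /= andbT; apply/eqP/eqP => [[->]|->].
  rewrite -(pair_big_dep (fun i' => i' == i) (fun i' x => lpass (i', x)) (fun i' x => y x / (lw i')%:R)) /=.
  by rewrite big_pred1_eq.
- by move=> i; apply: dist_ge0; exact: lend_reach.
- move=> u k t; case: (enum_val u) => [j|[[i j] oz]] /=; first by case: k.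
  case: k => [e|i'] //= [<- <-].
  move: (oz); rewrite /off /=; case: (boolP (0 < a i)) => ai oz'.
    have jm : (j < m)%N by have := ltn_ord (lev i); lia.
    have lz : lpass (i, Ordinal jm) by rewrite /lpass ai.
    exists (enum_rank (inr (Sub (i, Ordinal jm) lz) : LE')); rewrite enum_rankK //=.
    by right; rewrite ai; congr dist; apply: val_inj.
  have jm : (j.-1 < m)%N by have := ltn_ord j; lia.
  have lz : lpass (i, Ordinal jm) by rewrite /lpass (negbTE ai) /=; lia.
  exists (enum_rank (inr (Sub (i, Ordinal jm) lz) : LE')); rewrite enum_rankK //=.
  by right; rewrite (negbTE ai); congr dist; apply: val_inj; rewrite /= /bump /=; lia.
- by move=> i; rewrite /= enum_rankK lpos_lvx // lend_reach.
- exact: LG_connected.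
- rewrite /= addnC; congr addn.
    by rewrite -[RHS]card_ord; apply: eq_card => u; rewrite !inE lposT.
  by rewrite -[LHS]card_ord; apply: eq_card => e; rewrite !inE ltrkT.
Qed.

Lemma layered_DR : DR a (H := layered) llam.
Proof.
exists LG, Llen, path_graph, y; split; last split.
- exact: modif_ModifGen layered_modif _.
- by split; [exact: path_connected|split; [rewrite /= addn1|split]].
- apply/DR_morphismP; do 7 eexists; exact: layered_hmor.
Qed.

End Layered.

(** * A caterpillar with g double edges *)

Lemma Contract_id n (G : graph n) (l : 'I_(ne G) -> R) : (forall e, 0 < l e) -> Contract l l.
Proof.
move=> l0; have nz e : (l e == 0) = false by rewrite gt_eqF.
apply/ContractP; exists id, id; split=> //; split=> //.
- by move=> w; exists w.
- by move=> e; rewrite nz; split=> // _; exists e.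
- move=> u w; split=> [->|]; first exact: connect0.
  by apply: (connect_cadj_const (f := id)) => e; rewrite nz.
- move=> w; rewrite big_pred1_eq.
  have -> : #|[pred e | (l e == 0) && (esrc e == w)]| = 0%N.
    by apply: eq_card0 => e; rewrite !inE nz.
  by rewrite addn0; congr addn; rewrite -(card1 w); apply: eq_card => v; rewrite !inE.
Qed.

Section Caterpillar.
Variables (g n : nat) (a : 'I_n -> int).
Hypothesis g1 : (1 <= g)%N.
Hypothesis n2 : (2 <= n)%N.
Hypothesis a_neq0 : forall i, a i != 0.
Hypothesis a_sum0 : \sum_i a i = 0.
Hypothesis a_deg : 2 <= \sum_(i | 0 < a i) a i.

Let m := (2 * g + n - 3)%N.
Let posl := enum [pred i | 0 < a i].
Let negl := enum [pred i | ~~ (0 < a i)].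
Let p := size posl.
Let q := size negl.
Let d := (\sum_(i | (0 < a i)%R) lw a i)%N.
Let i0 : 'I_n := Ordinal (ltnW n2).

Let pq : (p + q = n)%N.
Proof.
rewrite /p /q -!cardE -[RHS]card_ord -(cardC [pred i | 0 < a i]).
by congr addn.
Qed.

Let in_posl i : (i \in posl) = (0 < a i).
Proof. by rewrite mem_enum inE. Qed.
Let in_negl i : (i \in negl) = ~~ (0 < a i).
Proof. by rewrite mem_enum inE. Qed.

Let d_int : d%:Z = \sum_(i | 0 < a i) a i.
Proof. by rewrite Posz_sum; apply: eq_bigr => i ai; rewrite /lw gtz0_abs. Qed.

Let d2 : (2 <= d)%N.
Proof. by have := a_deg; rewrite -d_int. Qed.

Let sum_neg : (\sum_(i | ~~ (0 < a i)%R) lw a i = d)%N.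
Proof.
apply/eqP; rewrite -eqz_nat d_int Posz_sum; apply/eqP.
have := a_sum0; rewrite (bigID (fun i => 0 < a i)) /= => /eqP; rewrite addr_eq0 => /eqP ->.
rewrite -sumrN; apply: eq_bigr => i; rewrite -leNgt => ai.
by rewrite /lw lez0_abs.
Qed.

Let nonempty (P : pred 'I_n) : (0 < \sum_(i | P i) lw a i)%N -> exists i, P i.
Proof. by case: (pickP P) => [i|none]; [exists i|rewrite big_pred0]. Qed.

Let p1 : (1 <= p)%N.
Proof.
have [i ai] := nonempty (leq_trans (isT : 0 < 2)%N d2).
by rewrite /p; have := in_posl i; rewrite ai; case: posl.
Qed.

Let q1 : (1 <= q)%N.
Proof.
have [i ai] : exists i, ~~ (0 < a i) by apply: nonempty; rewrite sum_neg; exact: leq_trans d2.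
by rewrite /q; have := in_negl i; rewrite ai; case: negl.
Qed.

(* Each level merges one positive leg, opens or closes a cycle, or splits off one
   negative leg; the first two legs of either sign share a level, hence the
   truncated predecessors. *)
Let levn (i : 'I_n) : nat :=
  if 0 < a i then (index i posl).-1 else (m - (index i negl).-1)%N.

Let levn_lt i : (levn i < m.+1)%N.
Proof.
rewrite /levn; case: (boolP (0 < a i)) => ai; last by lia.
have : (index i posl < p)%N by rewrite index_mem in_posl.
by rewrite /m; lia.
Qed.

Let lev i : 'I_m.+1 := Ordinal (levn_lt i).

Let lev_pos i : 0 < a i -> (levn i = (index i posl).-1)%N /\ (index i posl < p)%N.
Proof. by move=> ai; rewrite /levn ai index_mem in_posl. Qed.

Let lev_neg i : ~~ (0 < a i) -> (levn i = m - (index i negl).-1)%N /\ (index i negl < q)%N.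
Proof. by move=> ai; rewrite /levn (negbTE ai) index_mem in_negl. Qed.

Let nth_pos k : (k < p)%N -> 0 < a (nth i0 posl k) /\ index (nth i0 posl k) posl = k.
Proof. by move=> kp; rewrite index_uniq ?enum_uniq // -in_posl mem_nth. Qed.

Let nth_neg k : (k < q)%N -> ~~ (0 < a (nth i0 negl k)) /\ index (nth i0 negl k) negl = k.
Proof. by move=> kp; rewrite index_uniq ?enum_uniq // -in_negl mem_nth. Qed.

(** The double edges start after the [p - 1] levels that receive positive legs when [p >= 2]; the
    step 2 leaves a single edge between consecutive cycles. *)
Let ekn (k : 'I_g) : nat := (p.-1 + 2 * k)%N.
Let ekn_lt k : (ekn k < m)%N.
Proof. by rewrite /ekn /m; have := ltn_ord k; lia. Qed.

Let epos (e : 'I_(m + g)) : 'I_m :=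
  match split e with inl x => x | inr k => Ordinal (ekn_lt k) end.
Let LP x := (\sum_(i | lpass a lev (i, x)) lw a i)%N.
Let ex (x : 'I_m) := (\sum_(k < g | ekn k == x) 1)%N.
(** The main strand takes the part of the degree left over by the passing legs and the extra
    strand. *)
Let slope (e : 'I_(m + g)) : nat :=
  match split e with inl x => (d - ex x - LP x)%N | inr k => 1%N end.
Let main_edge (x : 'I_m) : 'I_(m + g) := lshift g x.

Let split_l (x : 'I_m) : split (lshift g x) = inl x. Proof. exact: (unsplitK (inl x)). Qed.
Let split_r (k : 'I_g) : split (rshift m k) = inr k. Proof. exact: (unsplitK (inr k)). Qed.

Let ex_le1 x : (ex x <= 1)%N.
Proof.
rewrite /ex -card_sum1; apply/card_le1P => k; rewrite inE => /eqP kx k'; rewrite !inE.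
by apply/eqP/eqP => [k'x|-> //]; apply: val_inj; move: kx k'x; rewrite /ekn /=; lia.
Qed.

Let ex_range x : (0 < ex x)%N -> (p.-1 <= x < p.-1 + 2 * g - 1)%N.
Proof.
rewrite /ex; case: (pickP (fun k : 'I_g => ekn k == x)) => [k /eqP <- _|none]; last by rewrite big_pred0.
by rewrite /ekn; have := ltn_ord k; lia.
Qed.

Let LP_lt (P : pred 'I_n) i1 x : P i1 -> (\sum_(i | P i) lw a i = d)%N ->
  (forall i, lpass a lev (i, x) -> P i && (i != i1)) -> (LP x < d)%N.
Proof.
move=> P1 Pd h; rewrite -Pd [X in (_ < X)%N](bigD1 i1) //=.
apply: leq_ltn_trans (_ : (\sum_(i | P i && (i != i1)) lw a i < _)%N).
  rewrite /LP [X in (_ <= X)%N](bigID (fun i => lpass a lev (i, x))) /=.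
  apply: leq_trans (leq_addr _ _); apply: eq_leq; apply: eq_bigl => i.
  by case L: (lpass a lev (i, x)); rewrite ?andbF ?andbT // h.
by rewrite -[X in (X < _)%N]add0n ltn_add2r lw_gt0.
Qed.

(** On the left the first positive leg does not pass [x], and on the right the first negative one
    does not. In the middle no leg passes, and [d >= 2] leaves room beside an extra strand. *)
Let room x : (ex x + LP x < d)%N.
Proof.
have m_eq : (m = 2 * g + n - 3)%N by [].
have xm := ltn_ord x.
have exx := ex_le1 x; have exr := @ex_range x.
case: (ltnP x p.-1) => xp.
  have ex0 : ex x = 0%N by lia.
  rewrite ex0 add0n; have [apos idx] := nth_pos p1.
  apply: (LP_lt (P := fun i => 0 < a i) apos) => // i; rewrite /lpass /=.
  case: (boolP (0 < a i)) => ai /= lx.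
    by apply/eqP => ii; move: lx; have [-> _] := lev_pos ai; rewrite ii idx.
  by have [] := lev_neg ai; lia.
case: (ltnP x (p.-1 + 2 * g - 1)) => xq.
  suff -> : LP x = 0%N by lia.
  rewrite /LP big_pred0 // => i; rewrite /lpass /=.
  case: (boolP (0 < a i)) => ai; first by have [] := lev_pos ai; lia.
  by have [] := lev_neg ai; lia.
have ex0 : ex x = 0%N by lia.
rewrite ex0 add0n; have [apos idx] := nth_neg q1.
apply: (LP_lt (P := fun i => ~~ (0 < a i)) apos) => // i; rewrite /lpass /=.
case: (boolP (0 < a i)) => ai /= lx; first by have [] := lev_pos ai; lia.
by apply/eqP => ii; move: lx; have [-> _] := lev_neg ai; rewrite ii idx; lia.
Qed.

Let slope_gt0 e : (0 < slope e)%N.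
Proof. by rewrite /slope; case: (split e) => // x; have := room x; lia. Qed.

Let main_edgeP x : epos (main_edge x) = x.
Proof. by rewrite /epos split_l. Qed.

Let balance x : (\sum_(e | epos e == x) slope e + \sum_(i | lpass a lev (i, x)) lw a i = d)%N.
Proof.
rewrite big_split_ord /=.
have -> : (\sum_(j < m | epos (lshift g j) == x) slope (lshift g j) = d - ex x - LP x)%N.
  rewrite (big_pred1 x) => [|j]; first by rewrite /slope split_l.
  by rewrite /epos split_l.
have -> : (\sum_(k < g | epos (rshift m k) == x) slope (rshift m k) = ex x)%N.
  by apply: eq_big => k; rewrite /epos /slope split_r.
have arith (u v w : nat) : (u + v < w -> w - u - v + u + v = w)%N by lia.
exact: arith (room x).
Qed.

Let last_leg : exists i, ~~ (0 < a i) && (lev i == ord_max).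
Proof.
have [apos idx] := nth_neg q1; exists (nth i0 negl 0); rewrite apos /= -val_eqE /=.
by have [-> _] := lev_neg apos; rewrite idx subn0.
Qed.

Let m_gt0 : (0 < m)%N.
Proof. by rewrite /m; lia. Qed.

Let CG : graph n := layered epos lev.

Let CG_connected : connected CG.
Proof.
apply: connected_const_test => // f fc.
apply: (connected_const (G := path_graph m) (f := f) (path_connected m)) => x.
by have := fc (main_edge x); rewrite /= main_edgeP.
Qed.

Let flags3 (j : 'I_m.+1) (h1 h2 h3 : flag CG) : fl_vert h1 = j -> fl_vert h2 = j -> fl_vert h3 = j ->
  uniq [:: h1; h2; h3] -> (3 <= Defs.val (G := CG) j)%N.
Proof.
move=> e1 e2 e3 u; apply/card_geqP; exists [:: h1; h2; h3]; split=> // h.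
by rewrite !inE => /or3P[] /eqP ->; rewrite ?e1 ?e2 ?e3.
Qed.

Let posleg k (j : 'I_m.+1) : (k < p)%N -> k.-1 = j -> fl_vert (inr (nth i0 posl k) : flag CG) = j.
Proof.
move=> kp kj; have [ai idx] := nth_pos kp; apply: val_inj => /=.
by have [-> _] := lev_pos ai; rewrite idx.
Qed.

Let negleg k (j : 'I_m.+1) : (k < q)%N -> (m - k.-1 = j)%N -> fl_vert (inr (nth i0 negl k) : flag CG) = j.
Proof.
move=> kp kj; have [ai idx] := nth_neg kp; apply: val_inj => /=.
by have [-> _] := lev_neg ai; rewrite idx.
Qed.

Let mainR (j : 'I_m.+1) (jm : (j < m)%N) : fl_vert (inl (main_edge (Ordinal jm), false) : flag CG) = j.
Proof. by rewrite /= main_edgeP; apply: val_inj. Qed.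

Let mainL (j : 'I_m.+1) (jm : (j.-1 < m)%N) : (0 < j)%N ->
  fl_vert (inl (main_edge (Ordinal jm), true) : flag CG) = j.
Proof. by move=> j0; rewrite /= main_edgeP; apply: val_inj; rewrite /= /bump /=; lia. Qed.

Let extraR (j : 'I_m.+1) k : ekn k = j -> fl_vert (inl (rshift m k, false) : flag CG) = j.
Proof. by move=> kj; rewrite /= /epos split_r; apply: val_inj. Qed.

Let extraL (j : 'I_m.+1) k : (ekn k).+1 = j -> fl_vert (inl (rshift m k, true) : flag CG) = j.
Proof. by move=> kj; rewrite /= /epos split_r; apply: val_inj; rewrite /= /bump. Qed.

(** At an end level the three flags are the main edge with two legs of one sign or, when there is
    just one such leg, the main edge, that leg and an edge of the adjacent cycle. *)
Let CG_val (j : 'I_m.+1) : (3 <= Defs.val (G := CG) j)%N.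
Proof.
have m_eq : (m = 2 * g + n - 3)%N by []; have lm := ltn_ord j; rewrite /= in lm.
have main_ne (x : 'I_m) k b b' : (inl (main_edge x, b) == inl (rshift m k, b') :> flag CG) = false.
  by apply/negP => /eqP[e1 _]; have := ltn_ord x; move: e1; rewrite /=; lia.
case: (posnP j) => j0.
  have jm : (j < m)%N by rewrite j0.
  case: (ltnP 1 p) => hp.
    apply: (flags3 (posleg p1 _) (posleg hp _) (mainR jm)) => //.
    rewrite /= !inE /= !andbT orbF; apply/eqP => -[e12].
    have [_ i1] := nth_pos p1; have [_ i2] := nth_pos hp.
    by move: i2; rewrite -e12 i1.
  have e0 : ekn (Ordinal g1) = j by rewrite /ekn /=; lia.
  apply: (flags3 (posleg p1 _) (mainR jm) (extraR e0)) => //.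
  by rewrite /= !inE main_ne.
have jm' : (j.-1 < m)%N by lia.
case: (ltnP j m) => jm.
  have ne12 : inl (main_edge (Ordinal jm), false) != inl (main_edge (Ordinal jm'), true) :> flag CG.
    by apply/eqP => -[].
  case: (ltnP j p.-1) => jp.
    have hk : (j.+1 < p)%N by lia.
    apply: (flags3 (mainR jm) (mainL jm' j0) (posleg hk _)) => //.
    by rewrite /= !inE (negbTE ne12).
  case: (ltnP j (p.-1 + 2 * g)) => jq.
    (* A level at odd offset closes a cycle, one at even offset opens the next. *)
    case ev: (odd (j - p.-1)).
      have kg : ((j - p.-1)./2 < g)%N by lia.
      have e0 : (ekn (Ordinal kg)).+1 = j by rewrite /ekn /=; lia.
      apply: (flags3 (mainR jm) (mainL jm' j0) (extraL e0)) => //.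
      by rewrite /= !inE (negbTE ne12) !main_ne.
    have kg : ((j - p.-1)./2 < g)%N by lia.
    have e0 : ekn (Ordinal kg) = j by rewrite /ekn /=; lia.
    apply: (flags3 (mainR jm) (mainL jm' j0) (extraR e0)) => //.
    by rewrite /= !inE (negbTE ne12) !main_ne.
  have hk : ((m - j).+1 < q)%N by lia.
  have hj : (m - (m - j).+1.-1 = j)%N by lia.
  apply: (flags3 (mainR jm) (mainL jm' j0) (negleg hk hj)) => //.
  by rewrite /= !inE (negbTE ne12).
have jE : (m - 0 = j)%N by lia.
case: (ltnP 1 q) => hq.
  apply: (flags3 (negleg q1 jE) (negleg hq jE) (mainL jm' j0)) => //.
  rewrite /= !inE /= !andbT orbF; apply/eqP => -[e12].
  have [_ i1] := nth_neg q1; have [_ i2] := nth_neg hq.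
  by move: i2; rewrite -e12 i1.
have kg : (g.-1 < g)%N by lia.
have e0 : (ekn (Ordinal kg)).+1 = j by rewrite /ekn /=; lia.
apply: (flags3 (negleg q1 jE) (mainL jm' j0) (extraL e0)) => //.
by rewrite /= !inE main_ne.
Qed.

Lemma DR_dim_ge : exists G : graph n, stable_type g G /\ has_ball (@DR_set n a G) (2 * g + n - 3)%N.
Proof.
exists CG; split.
  split; first exact: CG_connected.
  split; last by move=> v; rewrite muln0 add0n; exact: CG_val.
  by rewrite /genus /= big1 //; lia.
(* The centre comes from the path with unit edge lengths and direction [x] lengthens path edge [x];
   radius 1 keeps all lengths positive. Independence is read off at the main edges. *)
exists (fun e => (slope e)%:R^-1), (fun x e => if epos e == x then (slope e)%:R^-1 else 0); split.
  move=> c c0 x; have := c0 (main_edge x).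
  rewrite (bigD1 x) //= main_edgeP eqxx big1 ?addr0 => [/eqP|x' /negbTE]; last first.
    by rewrite eq_sym => ->; rewrite mulr0.
  by rewrite mulf_eq0 invr_eq0 pnatr_eq0 -[slope _ == _]negbK -lt0n slope_gt0 orbF => /eqP.
exists 1; split=> // z z1.
pose y x := 1 + z x.
have y0 x : 0 < y x by have := z1 x; rewrite /y ltr_norml; lra.
have -> : (fun e : 'I_(ne CG) => (slope e)%:R^-1 + \sum_x z x * (if epos e == x then (slope e)%:R^-1 else 0)) =
    llam epos slope y.
  apply/funext => e; rewrite (bigD1 (epos e)) //= eqxx big1 ?addr0 => [|x' /negbTE].
    by rewrite /llam /y; ring.
  by rewrite eq_sym => ->; rewrite mulr0.
have ll0 e : 0 < llam epos slope y e by exact: (llam_gt0 epos slope_gt0 y0).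
split=> [e|]; first exact: ltW.
exists CG, (llam epos slope y); split; first exact: Contract_id.
exact: (layered_DR a_neq0 m_gt0 slope_gt0 main_edgeP balance erefl sum_neg last_leg y0).
Qed.

End Caterpillar.

Theorem theorem5p2 (g n : nat) (a : 'I_n -> int) :
  (1 <= g)%N -> (2 <= n)%N ->
  (forall i, a i != 0) -> \sum_i a i = 0 ->
  2 <= \sum_(i | 0 < a i) a i ->
  [/\ Mtrop_semilinear g (DR_set a),
      Mtrop_subset g (DR_set a) (PD_set a) &
      Mtrop_dim g (DR_set a) (2 * g + n - 3)%N].
Proof.
move=> g1 n2 a_neq0 a_sum0 a_deg; split.
- by move=> G stG; exact: (DR_semilinear g1 n2 a_neq0 stG).
- move=> G _ l [l0 [H [lam [ct dr]]]]; split=> //; exists H, lam; split=> //.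
  exact: (DR_PD (Ordinal (ltnW n2)) a_neq0 dr).
- split; first exact: DR_dim_ge.
  by move=> G stG k; exact: (DR_dim_le g1 n2 a_neq0 stG).
Qed.
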